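(* Suppose that $\eta,z_1,\dots,z_n$ are generic and $\Lambda_1,\dots,\Lambda_n\in\mathbb Z_{\ge0}$. Let $a(z),b(z),c(z),d(z)$ be the difference operators given in the context, restricted to functions on $S_0$, and let $\kappa(z)=\prod_{i=1}^n\theta(z-z_i-\eta\Lambda_i)^{-1}$. Then $\bar a(z)=\kappa(z)a(z)$, $\bar b(z)=\kappa(z)b(z)$, $\bar c(z)=\kappa(z)c(z)$, $\bar d(z)=\kappa(z)d(z)$ define an $E_{\tau,\eta}(sl_2)$-module isomorphic to the tensor product $L_{\Lambda_1}(z_1-\eta)\otimes\cdots\otimes L_{\Lambda_n}(z_n-\eta)$ of irreducible evaluation modules.
   Context: Let $\mathrm{Im}\,\tau>0$, $\theta(z)=-\sum_{j\in\mathbb Z}\exp(i\pi(j+\frac12)^2\tau+2\pi i(j+\frac12)(z+\frac12))$. ''Generic'' means outside a countable union of proper analytic hypersurfaces in the space of $(\eta,z_1,\dots,z_n)\in\mathbb C^{n+1}$. Difference operators. On meromorphic functions of $\lambda,x_1,\dots,x_n$ let $T_{x_i}^a,T_\lambda^a$ shift the argument $x_i$, resp. $\lambda$, by $a$. Set $\Delta_\pm(z)=\prod_i\theta(z-z_i\mp\Lambda_i\eta)$, $s=\sum_i(x_i+z_i)$, let $h$ act by multiplication by $-\eta^{-1}\sum_i(x_i+z_i)$, and \[a(z)=\prod_{i}\theta(z+x_i)\frac{\theta(\lambda+\sum_l(x_l+z_l+\Lambda_l\eta))}{\theta(\lambda)}T_\lambda^{-2\eta},\] \[b(z)=-\sum_{i}\frac{\theta(\lambda+z+x_i)}{\theta(\lambda)}\prod_{j\ne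 i}\frac{\theta(z+x_j)}{\theta(x_i-x_j)}\Delta_+(-x_i)T_{x_i}^{-2\eta}T_\lambda^{2\eta},\] \[c(z)=-\sum_{i}\frac{\theta(-\lambda+z+x_i-2s)}{\theta(\lambda)}\prod_{j\ne i}\frac{\theta(z+x_j)}{\theta(x_i-x_j)}\Delta_-(-x_i)T_{x_i}^{2\eta}T_\lambda^{-2\eta},\] with $d(z)$ defined by $a(z+2\eta)d(z)-c(z+2\eta)b(z)=\frac{\theta(\lambda-2\eta h)}{\theta(\lambda)}\prod_i\theta(z-z_i-\Lambda_i\eta)\theta(z-z_i+\Lambda_i\eta+2\eta)$. Let $S_0=\{(\lambda,x_1,\dots,x_n)\in\mathbb C^{n+1}: -x_i=z_i+\eta(\Lambda_i-2m_i),\ m_i\in\{0,1,\dots,\Lambda_i\},\ i=1,\dots,n\}$. For generic $\eta,z_i$ these operators and $h$ restrict to functions on $S_0$ meromorphic in $\lambda$ (a vector space of dimension $\prod_i(\Lambda_i+1)$ over the field of meromorphic functions of $\lambda$); the restriction is the induced action on the quotient by functions vanishing on $S_0$. Modules. Let $V$ have basis $e[1],e[-1]$, $E_{ij}e[k]=\delta_{jk}e[i]$, $h=E_{11}-E_{-1,-1}$, $\alpha(z,\lambda)=\frac{\theta(\lambda+2\eta)\theta(z)}{\theta(\lambda)\theta(z-2\eta)}$, $\beta(z,\lambda)=-\frac{\theta(\lambda+z)\theta(2\eta)}{\theta(\lambda)\theta(z-2\eta)}$, and $R(z,\lambda)=E_{11}\otimes E_{11}+E_{-1,-1}\otimes E_{-1,-1}+\alpha(z,\lambda)E_{11}\otimes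 E_{-1,-1}+\alpha(z,-\lambda)E_{-1,-1}\otimes E_{11}+\beta(z,\lambda)E_{1,-1}\otimes E_{-1,1}+\beta(z,-\lambda)E_{-1,1}\otimes E_{1,-1}$. A module over $E_{\tau,\eta}(sl_2)$ is a space $W$ with diagonalizable $h$ with finite dimensional eigenspaces and an operator $L(z,\lambda)$ on $V\otimes W$, meromorphic in $z,\lambda$, commuting with $h\otimes 1+1\otimes h$, with \[R^{(12)}(z-w,\lambda-2\eta h^{(3)})L^{(13)}(z,\lambda)L^{(23)}(w,\lambda-2\eta h^{(1)})=L^{(23)}(w,\lambda)L^{(13)}(z,\lambda-2\eta h^{(2)})R^{(12)}(z-w,\lambda)\] on $V\otimes V\otimes W$ ($h^{(i)}$ in an argument is replaced by its eigenvalue on the $i$th component of the vector acted on). Let $\mathrm{Fun}(W)$ be the space of $W$-valued meromorphic functions of $\lambda$. The operator algebra is generated by $h$ and operators $a(z),\dots,d(z)$ on $\mathrm{Fun}(W)$ given by $\tilde L(z)(e[1]\otimes f)=e[1]\otimes a(z)f+e[-1]\otimes c(z)f$, $\tilde L(z)(e[-1]\otimes f)=e[1]\otimes b(z)f+e[-1]\otimes d(z)f$, where $(\tilde L(z)(v\otimes f))(\lambda)=L(z,\lambda)(v\otimes f(\lambda-2\eta\mu))$ if $hv=\mu v$. Conversely operators $a,b,c,d$ of this form define $L$. Two modules are isomorphic if there is an isomorphism, linear over the field of meromorphic functions of $\lambda$, between their spaces $\mathrm{Fun}(W)$ intertwining $h,a(z),b(z),c(z),d(z)$. Tensor product: on $W_1\otimes\cdots\otimes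 W_n$ (with $V$ as factor $0$), $h=\sum_ih^{(i)}$ and $L(z,\lambda)=L^{(01)}(z,\lambda-2\eta\sum_{i=2}^nh^{(i)})\cdots L^{(0,n-1)}(z,\lambda-2\eta h^{(n)})L^{(0n)}(z,\lambda)$. Irreducible evaluation module $L_\Lambda(p)$ ($\Lambda\in\mathbb Z_{\ge0}$, $p\in\mathbb C$): basis $e_0,\dots,e_\Lambda$ ($e_{-1}=e_{\Lambda+1}=0$), $he_k=(\Lambda-2k)e_k$, and the entries of $L(w,\lambda)$ (i.e. $a,b,c,d$ without the shift of $\lambda$) act, with $D=\theta(w-p-(\Lambda+1)\eta)\theta(\lambda)$, by \[a\,e_k=\tfrac{\theta(w-p-(\Lambda+1-2k)\eta)\theta(\lambda+2k\eta)}{D}e_k,\quad b\,e_k=\tfrac{\theta(\lambda+w-p-(\Lambda-2k-1)\eta)\theta(2(k+1)\eta)}{D}e_{k+1},\] \[c\,e_k=-\tfrac{\theta(-\lambda+w-p+(\Lambda-2k+1)\eta)\theta(2(\Lambda-k+1)\eta)}{D}e_{k-1},\quad d\,e_k=\tfrac{\theta(w-p+(\Lambda-2k-1)\eta)\theta(\lambda-2(\Lambda-k)\eta)}{D}e_k.\] *)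

(* Defs.v *)
From HB Require Import structures.
From mathcomp Require Import all_boot all_order all_algebra.
From mathcomp Require Import complex.
From mathcomp Require Import all_classical all_reals all_analysis.
Set Implicit Arguments.
Unset Strict Implicit.
Unset Printing Implicit Defensive.
Import Order.TTheory GRing.Theory Num.Theory numFieldNormedType.Exports.
Local Open Scope classical_set_scope.
Local Open Scope ring_scope.

(* R[i] packed as a numClosedFieldType, so that its topology and its
   structure of normed module over itself are inferred. Differentiability
   is then complex differentiability. *)
Definition Cplx (R : realType) : numClosedFieldType := R[i]%C.

(* Meromorphic functions on a normed space V over C, such as C, C * C or
   C * C^n, are represented by total functions V -> C whose values on a proper
   analytic hypersurface (poles, indeterminacy points) are irrelevant; the
   equality of meromorphic functions is mero_eq. *)
Section ComplexAnalysis.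
Context {R : realType} {V : normedModType (Cplx R)}.
Local Notation C := (Cplx R).
Implicit Types (f g h : V -> C) (p q : V) (P : V -> Prop).

Definition holomorphic_at f p := \forall q \near p, differentiable f q.

Definition nonzero_germ f p := ~ (\forall q \near p, f q = 0).

Definition analytic_hypersurface (H : set V) := forall p, exists h,
  [/\ holomorphic_at h p, nonzero_germ h p
    & \forall q \near p, H q <-> h q = 0].

Definition off_hypersurface P := forall p, exists h,
  [/\ holomorphic_at h p, nonzero_germ h p
    & \forall q \near p, h q != 0 -> P q].

Definition mero_eq f g := off_hypersurface (fun q => f q = g q).

Definition meromorphic f := forall p, exists g h,
  [/\ holomorphic_at g p, holomorphic_at h p, nonzero_germ h p
    & \forall q \near p, h q != 0 -> f q = g q / h q].

Definition for_generic P := exists H : nat -> set V,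
  (forall k, analytic_hypersurface (H k)) /\
  (forall p, (forall k, ~ H k p) -> P p).

End ComplexAnalysis.

Section Theta.
Context {R : realType}.
Local Notation C := (Cplx R).

Definition cexp (z : C) : C :=
  (expR (complex.Re z) * cos (complex.Im z)
   +i* (expR (complex.Re z) * sin (complex.Im z)))%C.

Definition cpi : C := (pi : R)%:C%C.

Definition theta_term (tau z : C) (j : int) : C :=
  cexp ('i * cpi * (j%:~R + 2^-1) ^+ 2 * tau
        + 2 * 'i * cpi * (j%:~R + 2^-1) * (z + 2^-1)).

Definition theta (tau z : C) : C :=
  - (limn (series (fun k : nat => theta_term tau z k%:Z))
     + limn (series (fun k : nat => theta_term tau z (- k.+1%:Z)))).

End Theta.

(* Matrices over C with rows and columns indexed by a finite type K. *)
Section Kernels.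
Context {R : realType} {K : finType}.
Local Notation C := (Cplx R).

Definition opcomp (A B : K -> K -> C) : K -> K -> C :=
  fun k l => \sum_j A k j * B j l.

Definition opid : K -> K -> C := fun k l => (k == l)%:R.

End Kernels.

Section Modules.
Context {R : realType}.
Variables tau eta : Cplx R.
Local Notation C := (Cplx R).
Local Notation th := (theta tau).

(* V has basis e[1], e[-1], indexed by true, false. *)
Definition spin (v : bool) : C := if v then 1 else -1.

Definition Emx (i j : bool) : bool -> bool -> C :=
  fun k l => ((k == i) && (l == j))%:R.

Definition ktens (A B : bool -> bool -> C) : bool * bool -> bool * bool -> C :=
  fun k l => A k.1 l.1 * B k.2 l.2.

Definition alpha (z lam : C) : C :=
  th (lam + 2 * eta) * th z / (th lam * th (z - 2 * eta)).

Definition beta (z lam : C) : C :=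
  - (th (lam + z) * th (2 * eta) / (th lam * th (z - 2 * eta))).

Definition Rmx (z lam : C) : bool * bool -> bool * bool -> C := fun k l =>
  ktens (Emx true true) (Emx true true) k l
  + ktens (Emx false false) (Emx false false) k l
  + alpha z lam * ktens (Emx true true) (Emx false false) k l
  + alpha z (- lam) * ktens (Emx false false) (Emx true true) k l
  + beta z lam * ktens (Emx true false) (Emx false true) k l
  + beta z (- lam) * ktens (Emx false true) (Emx true false) k l.

(* A finite dimensional W with a basis of eigenvectors of h indexed by I, with
   eigenvalues wt. The operator L(z,lambda) on the tensor product of V and W is
   given by its matrix: ent z lam s t is the coefficient of the basis vector s
   in the image of the basis vector t. *)
Record Ldata (I : finType) := {
  wt : I -> C;
  ent : C -> C -> bool * I -> bool * I -> C }.

Section Ldata.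
Context {I : finType}.
Variable W : Ldata I.

(* Matrices on the tensor product of V, V and W, indexed by bool * bool * I.
   A dynamical shift by h^(i) uses the eigenvalue of the i-th component of the
   vector acted on, that is of the column index t. *)
Definition R12_h3 (z lam : C) : bool * bool * I -> bool * bool * I -> C :=
  fun s t => (s.2 == t.2)%:R * Rmx z (lam - 2 * eta * wt W t.2) s.1 t.1.

Definition R12 (z lam : C) : bool * bool * I -> bool * bool * I -> C :=
  fun s t => (s.2 == t.2)%:R * Rmx z lam s.1 t.1.

Definition L13 (z lam : C) : bool * bool * I -> bool * bool * I -> C :=
  fun s t => (s.1.2 == t.1.2)%:R * ent W z lam (s.1.1, s.2) (t.1.1, t.2).

Definition L13_h2 (z lam : C) : bool * bool * I -> bool * bool * I -> C :=
  fun s t => (s.1.2 == t.1.2)%:R *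
    ent W z (lam - 2 * eta * spin t.1.2) (s.1.1, s.2) (t.1.1, t.2).

Definition L23 (w lam : C) : bool * bool * I -> bool * bool * I -> C :=
  fun s t => (s.1.1 == t.1.1)%:R * ent W w lam (s.1.2, s.2) (t.1.2, t.2).

Definition L23_h1 (w lam : C) : bool * bool * I -> bool * bool * I -> C :=
  fun s t => (s.1.1 == t.1.1)%:R *
    ent W w (lam - 2 * eta * spin t.1.1) (s.1.2, s.2) (t.1.2, t.2).

Definition is_module :=
  [/\ forall s t, meromorphic (fun p : C * C => ent W p.1 p.2 s t),
      forall s t, mero_eq
        (fun p : C * C => (spin s.1 + wt W s.2) * ent W p.1 p.2 s t)
        (fun p : C * C => ent W p.1 p.2 s t * (spin t.1 + wt W t.2))
    & forall s t, mero_eq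
        (fun p : C * C * C => let: (z, w, lam) := p in
          opcomp (opcomp (R12_h3 (z - w) lam) (L13 z lam)) (L23_h1 w lam) s t)
        (fun p : C * C * C => let: (z, w, lam) := p in
          opcomp (opcomp (L23 w lam) (L13_h2 z lam)) (R12 (z - w) lam) s t)].

Definition op_h (f : C -> I -> C) : C -> I -> C := fun lam k => wt W k * f lam k.

(* opL v u z f is the e[v] component of Ltilde(z) (e[u] (x) f). *)
Definition opL (v u : bool) (z : C) (f : C -> I -> C) : C -> I -> C :=
  fun lam k =>
    \sum_k' ent W z lam (v, k) (u, k') * f (lam - 2 * eta * spin u) k'.

Definition op_a := opL true true.
Definition op_b := opL true false.
Definition op_c := opL false true.
Definition op_d := opL false false.

End Ldata.

(* Fun(W) consists of the f with fun_mero f, modulo fun_eq. *)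
Definition fun_mero {I : finType} (f : C -> I -> C) :=
  forall k, meromorphic (fun lam : C => f lam k).

Definition fun_eq {I : finType} (f g : C -> I -> C) :=
  forall k, mero_eq (fun lam : C => f lam k) (fun lam : C => g lam k).

(* The intertwining property is an equality of operators depending
   meromorphically on z, hence is required outside a hypersurface of values
   of z. *)
Definition intertwines {I J : finType} (Phi : (C -> I -> C) -> (C -> J -> C))
    (A : C -> (C -> I -> C) -> (C -> I -> C))
    (B : C -> (C -> J -> C) -> (C -> J -> C)) :=
  off_hypersurface (fun z : C => forall f, fun_mero f ->
    fun_eq (Phi (A z f)) (B z (Phi f))).

Definition mero_linear_iso {I J : finType}
    (Phi : (C -> I -> C) -> (C -> J -> C)) :=
  [/\ forall f, fun_mero f -> fun_mero (Phi f),
      forall f g, fun_mero f -> fun_mero g ->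
        (fun_eq f g <-> fun_eq (Phi f) (Phi g)),
      forall (u : C -> C) f g, meromorphic u -> fun_mero f -> fun_mero g ->
        fun_eq (Phi (fun lam k => u lam * f lam k + g lam k))
               (fun lam k => u lam * Phi f lam k + Phi g lam k)
    & forall g, fun_mero g -> exists2 f, fun_mero f & fun_eq (Phi f) g].

Definition module_iso {I J : finType} (W : Ldata I) (W' : Ldata J) :=
  exists Phi : (C -> I -> C) -> (C -> J -> C),
    mero_linear_iso Phi /\
    [/\ forall f, fun_mero f -> fun_eq (Phi (op_h W f)) (op_h W' (Phi f)),
        intertwines Phi (op_a W) (op_a W'),
        intertwines Phi (op_b W) (op_b W'),
        intertwines Phi (op_c W) (op_c W')
      & intertwines Phi (op_d W) (op_d W')].

Section Tensor.
Context {n : nat} {I : 'I_n -> finType}.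
Variable W : forall i, Ldata (I i).

(* L^(0i)(z, lambda - 2 eta sum_(j > i) h^(j)) *)
Definition L0 (i : 'I_n) (z lam : C)
    (s t : bool * {dffun forall i, I i}) : C :=
  if [forall j, (j != i) ==> (s.2 j == t.2 j)]
  then ent (W i) z
         (lam - 2 * eta * \sum_(j < n | (i < j)%N) wt (W j) (t.2 j))
         (s.1, s.2 i) (t.1, t.2 i)
  else 0.

Definition tensor : Ldata {dffun forall i, I i} := {|
  wt := fun k : {dffun forall i, I i} => \sum_i wt (W i) (k i);
  ent := fun z lam => \big[opcomp/opid]_(i < n) L0 i z lam |}.

End Tensor.

Section Evaluation.
Variables (Lam : nat) (p : C).
Local Notation L := (Lam%:R : C).

Definition eval_den (w lam : C) : C := th (w - p - (L + 1) * eta) * th lam.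

Definition eval_a (w lam : C) (k' k : 'I_Lam.+1) : C :=
  (k' == k)%:R *
  (th (w - p - (L + 1 - 2 * k%:R) * eta) * th (lam + 2 * k%:R * eta)
   / eval_den w lam).

Definition eval_b (w lam : C) (k' k : 'I_Lam.+1) : C :=
  (k' == k.+1 :> nat)%:R *
  (th (lam + w - p - (L - 2 * k%:R - 1) * eta) * th (2 * (k%:R + 1) * eta)
   / eval_den w lam).

Definition eval_c (w lam : C) (k' k : 'I_Lam.+1) : C :=
  (k'.+1 == k :> nat)%:R *
  - (th (- lam + w - p + (L - 2 * k%:R + 1) * eta)
     * th (2 * (L - k%:R + 1) * eta) / eval_den w lam).

Definition eval_d (w lam : C) (k' k : 'I_Lam.+1) : C :=
  (k' == k)%:R *
  (th (w - p + (L - 2 * k%:R - 1) * eta) * th (lam - 2 * (L - k%:R) * eta)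
   / eval_den w lam).

Definition eval_module : Ldata 'I_Lam.+1 := {|
  wt := fun k : 'I_Lam.+1 => L - 2 * k%:R;
  ent := fun w lam s t =>
    match s.1, t.1 with
    | true, true => eval_a w lam s.2 t.2
    | true, false => eval_b w lam s.2 t.2
    | false, true => eval_c w lam s.2 t.2
    | false, false => eval_d w lam s.2 t.2
    end |}.

End Evaluation.

Section DifferenceOperators.
Variables (n : nat) (zs : 'rV[C]_n) (Lam : 'I_n -> nat).
Implicit Types (F : C -> 'rV[C]_n -> C) (z lam : C) (x : 'rV[C]_n).

Definition Delta_plus z : C := \prod_i th (z - zs 0 i - (Lam i)%:R * eta).

Definition Delta_minus z : C := \prod_i th (z - zs 0 i + (Lam i)%:R * eta).

Definition sxz x : C := \sum_i (x 0 i + zs 0 i).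

Definition shift_x (i : 'I_n) (a : C) x : 'rV[C]_n := x + a *: delta_mx 0 i.

Definition dop_h F : C -> 'rV[C]_n -> C :=
  fun lam x => - eta^-1 * sxz x * F lam x.

Definition coef_a z lam x : C :=
  (\prod_i th (z + x 0 i))
  * (th (lam + \sum_l (x 0 l + zs 0 l + (Lam l)%:R * eta)) / th lam).

Definition dop_a z F : C -> 'rV[C]_n -> C :=
  fun lam x => coef_a z lam x * F (lam - 2 * eta) x.

Definition dop_b z F : C -> 'rV[C]_n -> C := fun lam x =>
  - \sum_i th (lam + z + x 0 i) / th lam
      * (\prod_(j | j != i) (th (z + x 0 j) / th (x 0 i - x 0 j)))
      * Delta_plus (- x 0 i)
      * F (lam + 2 * eta) (shift_x i (- (2 * eta)) x).

Definition dop_c z F : C -> 'rV[C]_n -> C := fun lam x =>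
  - \sum_i th (- lam + z + x 0 i - 2 * sxz x) / th lam
      * (\prod_(j | j != i) (th (z + x 0 j) / th (x 0 i - x 0 j)))
      * Delta_minus (- x 0 i)
      * F (lam - 2 * eta) (shift_x i (2 * eta) x).

(* Multiplication by the quantum determinant. By definition of h,
   -2 eta h = 2 sum_i (x_i + z_i). *)
Definition dop_det z F : C -> 'rV[C]_n -> C := fun lam x =>
  th (lam + 2 * sxz x) / th lam
  * (\prod_i (th (z - zs 0 i - (Lam i)%:R * eta)
              * th (z - zs 0 i + (Lam i)%:R * eta + 2 * eta)))
  * F lam x.

(* The equation defining d(z). Evaluated at (lam, x), it determines d(z) F at
   (lam - 2 eta, x) as soon as the coefficient of a(z + 2 eta) is nonzero. *)
Definition defines_d
    (dop_d : C -> (C -> 'rV[C]_n -> C) -> (C -> 'rV[C]_n -> C)) :=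
  forall z F lam x, coef_a (z + 2 * eta) lam x != 0 ->
    dop_a (z + 2 * eta) (dop_d z F) lam x
    - dop_c (z + 2 * eta) (dop_b z F) lam x = dop_det z F lam x.

Lemma defines_d_exists : exists dop_d, defines_d dop_d.
Proof.
exists (fun z F lam x =>
  (dop_det z F (lam + 2 * eta) x
   + dop_c (z + 2 * eta) (dop_b z F) (lam + 2 * eta) x)
  / coef_a (z + 2 * eta) (lam + 2 * eta) x) => z F lam x nz.
by rewrite {1}/dop_a subrK mulrCA divff // mulr1 addrK.
Qed.

(* S_0 is the union over m of the lines { (lam, S0_point m) | lam in C }, so a
   function on S_0 is a function of lam and m. *)
Definition S0_index := {dffun forall i : 'I_n, 'I_(Lam i).+1}.

Definition S0_point (m : S0_index) : 'rV[C]_n :=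
  \row_i - (zs 0 i + eta * ((Lam i)%:R - 2 * (m i)%:R)).

Definition res_S0 F : C -> S0_index -> C := fun lam m => F lam (S0_point m).

Definition kappa z : C := \prod_i (th (z - zs 0 i - eta * (Lam i)%:R))^-1.

(* Q is the action of kappa(z) D(z) induced on the quotient of the functions of
   (lam, x) by those vanishing on S_0: F ranges over all the representatives of
   a function on S_0, with no condition outside S_0. *)
Definition induced_on_S0
    (D : C -> (C -> 'rV[C]_n -> C) -> (C -> 'rV[C]_n -> C))
    (Q : C -> (C -> S0_index -> C) -> (C -> S0_index -> C)) :=
  off_hypersurface (fun z : C => forall F, fun_mero (res_S0 F) ->
    fun_eq (Q z (res_S0 F)) (fun lam m => kappa z * res_S0 (D z F) lam m)).

End DifferenceOperators.
End Modules.

Arguments S0_point {R} eta {n} zs Lam m.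
Arguments res_S0 {R} eta {n} zs Lam F _ m.

(* Main.v *)
Require Import Defs.
From HB Require Import structures.
From mathcomp Require Import all_boot all_order all_algebra.
From mathcomp Require Import complex.
From mathcomp Require Import all_classical all_reals all_analysis.
From mathcomp Require Import ring lra zify.
Set Implicit Arguments.
Unset Strict Implicit.
Unset Printing Implicit Defensive.
Import Order.TTheory GRing.Theory Num.Theory numFieldNormedType.Exports.
Local Open Scope ring_scope.

(** Put e = 2 eta and Y_i = z_i + eta Lambda_i. A point of S_0 has coordinates
    - x_i = Y_i - e m_i, and there a(z) is diagonal, with eigenvalue the product
    of the theta(z - Y_i + e m_i), up to a factor in lambda. The isomorphism
    must therefore send the delta functions of S_0 to eigenvectors of a(z) in
    the tensor product, and the proof constructs these eigenvectors.

    Evaluation modules are multiplied by their denominators in z throughout.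
    Each component of the RLL relation and of the quantum determinant relation
    of an evaluation module is a combination of Fay identities (eval_entry_RLL,
    eval_entry_det), and both relations pass to tensor products (RLL_tensors,
    qdet_tensors).

    The product of the highest weight vectors is an eigenvector of a(z), with
    eigenvalue the product of the theta(z - Y_i). If the eigenvalue of an
    eigenvector v vanishes at y, one term disappears from the relation between
    b(y) and a(z), and b(y) v is an eigenvector in whose eigenvalue the zero y
    has moved to y - e (op_a_vec). This gives a vector v_m for each m. By the
    determinant relation, c(y - e) takes b(y) v_m back to a multiple of v_m,
    which is nonzero as long as m_i < Lambda_i for the i with y = Y_i - e m_i
    (op_c_vec). So the v_m with m_i <= Lambda_i for all i are nonzero, and since
    their eigenvalues are distinct they form a basis (vec_free).

    The same relations, taken at the zeros of the eigenvalues, determine the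
    matrix elements of b(z) and c(z) in this basis (op_B_vec, op_C_vec): v_m is
    sent to its neighbours v_(m + 1_j), respectively v_(m - 1_j). An explicit
    rescaling of the v_m turns these elements into the coefficients of the
    difference operators, in which the summands that lead out of S_0 vanish
    (Mx_Wb, Mx_Wc, dop_bE, dop_cE). The operator d(z) is obtained on both sides
    by solving the determinant relation (Mx_Wd, S0_module_op_d). Conjugation by
    the matrix of the rescaled basis then carries the RLL relation over to the
    difference operators (RLL_W) and is an isomorphism of modules.

    These identities are proved where no denominator vanishes, in particular
    for lambda in the set of points with theta(lambda + k e) <> 0 for all
    integers k, which Baire's theorem shows to be dense (dense_dom). To deduce
    equalities of meromorphic functions one needs that nonzero germs of complex
    differentiable functions have nonzero products (slanted_sub, goodM,
    nonzero_germM) and that an entire function of one variable with a nonzero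
    germ has no zero germ (entire_nonzero_germ). This is the identity theorem,
    proved here without power series: Goursat's bisection gives a primitive F,
    which has a second order expansion at each point; functions with such
    expansions obey the maximum principle (max_modulus); and if F vanishes near
    0, the maximum principle for F / z^n and n tending to infinity shows that F
    vanishes on a fixed disc (vanish_near0).

    The Fay identity and the oddness of theta follow from the addition formula,
    which is a resummation of the double series for theta(x + y) theta(x - y)
    along j + k + 1 and j - k (theta_addition). The parameters are generic if
    theta(k e) <> 0 for integers k <> 0 and theta(z_i - z_j + k eta) <> 0 for
    i <> j and integers k (generic_parameters). *)

(** * Closure under finite sums and products *)

Lemma big_closed (T U : Type) (K : (T -> U) -> Prop) (idx : U) (op : U -> U -> U) :
  K (fun=> idx) -> (forall f g, K f -> K g -> K (fun x => op (f x) (g x))) ->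
  forall (I : Type) (r : seq I) (P : pred I) (F : I -> T -> U),
  (forall i, P i -> K (F i)) -> K (fun x => \big[op/idx]_(i <- r | P i) F i x).
Proof.
move=> K0 Kop I r P F KF; elim: r => [|i r IH].
  by rewrite (_ : (fun x => _) = fun=> idx) //; apply/funext => x; rewrite big_nil.
have [Pi|Pi] := boolP (P i).
  rewrite (_ : (fun x => _) = fun x => op (F i x) (\big[op/idx]_(j <- r | P j) F j x)).
    exact: Kop (KF _ Pi) IH.
  by apply/funext => x; rewrite big_cons Pi.
rewrite (_ : (fun x => _) = fun x => \big[op/idx]_(j <- r | P j) F j x) //.
by apply/funext => x; rewrite big_cons (negbTE Pi).
Qed.

(** * Dynamical R-matrix and evaluation modules *)

Section FormalTheta.
Variables (F : fieldType) (th : F -> F).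
Hypothesis thN : forall z, th (- z) = - th z.
(** Writing theta(u + v) theta(u - v) as [u, v], this is [p, q] [r, s] - [p,
    r] [q, s] + [p, s] [q, r] for p = a + (b + d) / 2, q = (b + d) / 2, r = (d
    - b) / 2, s = r - c. *)
Definition fay_sum a b c d :=
  (th (a + b + d) * th a) * (th (d - b - c) * th c)
  - (th (a + d) * th (a + b)) * (th (d - c) * th (b + c))
  + (th (a + d - c) * th (a + b + c)) * (th d * th b).
Hypothesis fay : forall a b c d, fay_sum a b c d = 0.

(** Identities between products of theta are proved by normalizing the
    arguments of theta, which are integral linear combinations of a few
    variables, up to sign. Arguments that agree up to sign become the same
    atom, after which the identity is one of rational functions. *)
Inductive lexp := Lv of nat | Ladd of lexp & lexp | Lopp of lexp.

Fixpoint leval (x : seq F) e := match e with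
  | Lv i => x`_i | Ladd a b => leval x a + leval x b | Lopp a => - leval x a end.

Fixpoint addv (v w : seq int) := match v, w with
  | a :: v', b :: w' => (a + b) :: addv v' w' | _, _ => [::] end.

Fixpoint lnorm n e : seq int := match e with
  | Lv i => [seq (j == i)%:Z | j <- iota 0 n]
  | Ladd a b => addv (lnorm n a) (lnorm n b)
  | Lopp a => map -%R (lnorm n a) end.

Fixpoint lcomb (x : seq F) (v : seq int) := match x, v with
  | a :: x', c :: v' => a *~ c + lcomb x' v' | _, _ => 0 end.

Lemma size_lnorm n e : size (lnorm n e) = n.
Proof.
elim: e => [i|a IHa b IHb|a IHa] /=; rewrite ?size_map ?size_iota //.
by elim: n (lnorm n a) (lnorm n b) IHa IHb => [|n IH] [|c v] [|d w] //= [/IH h] [/h ->].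
Qed.

Lemma levalE x e : leval x e = lcomb x (lnorm (size x) e).
Proof.
elim: e => [i|a ea b eb|a ea] /=; rewrite ?ea ?eb.
- have -> : [seq (j == i)%:Z | j <- iota 0 (size x)] =
      [seq (j == i + 0)%N%:Z | j <- iota 0 (size x)] by rewrite addn0.
  elim: x i 0%N => [|a x IH] [|i] k //=.
  + rewrite eqxx mulr1z -[LHS]addr0; congr (_ + _).
    have [j kj <-] : exists2 j, (k < j)%N & j = k.+1 by exists k.+1.
    by elim: x {IH} j kj => [|b x IH] j kj //=; rewrite gtn_eqF // mulr0z add0r -IH // ltnW.
  + rewrite ltn_eqF ?addSn ?ltnS ?leq_addl // ?mulr0z ?mulr0n ?add0r.
    by rewrite (IH i k.+1) addnS.
- move: (size_lnorm (size x) a) (size_lnorm (size x) b).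
  elim: x (lnorm _ a) (lnorm _ b) {ea eb} => [|y x IH] [|c v] [|d w] //=; rewrite ?addr0 //.
  by move=> [h] [h']; rewrite -IH // mulrzDr addrACA.
- elim: x (lnorm _ a) {ea} => [|y x IH] [|c v] //=; rewrite ?oppr0 //.
  by rewrite opprD IH mulrNz.
Qed.

Lemma th_lin x e (v : seq int) : lnorm (size x) e = v -> th (leval x e) = th (lcomb x v).
Proof. by rewrite levalE => ->. Qed.

Lemma th_linN x e (v : seq int) : map -%R (lnorm (size x) e) = v ->
  th (leval x e) = - th (lcomb x v).
Proof. by move=> ev; rewrite -(th_lin (e := Lopp e) ev) thN opprK. Qed.

(** Decides whether theta(t) is rewritten as - theta(- t). *)
Fixpoint lneg (v : seq int) := if v is a :: v' then
  if a == 0 then lneg v' else a < 0 else false.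

Ltac lreify x t := match t with
  | ?a + ?b => let a' := lreify x a in let b' := lreify x b in constr:(Ladd a' b')
  | 0 => constr:(Ladd (Lv 0) (Lopp (Lv 0)))
  | - ?a => let a' := lreify x a in constr:(Lopp a')
  | _ => let rec idx s := match s with t :: _ => constr:(0%N)
           | _ :: ?s' => let i := idx s' in constr:(S i) end in
         let i := idx x in constr:(Lv i) end.

Ltac lin_atoms x := repeat match goal with |- context [th ?t] =>
  lazymatch t with lcomb _ _ => fail | _ => idtac end;
  let e := lreify x t in
  let v := eval vm_compute in (lnorm (size x) e) in
  let s := eval vm_compute in (lneg v) in
  lazymatch s with
  | false => rewrite -> (th_lin (x := x) (e := e) (v := v) (erefl v) : th t = _)
  | true => let w := eval vm_compute in (map -%R v) in
      rewrite -> (th_linN (x := x) (e := e) (v := w) (erefl w) : th t = _) end end;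
  repeat match goal with |- context [th ?t] => move: (th t) => ? end.

Section FormalRLL.
Variable e : F.

Definition dyn_shift (u : bool) (l : F) := if u then l - e else l + e.

(** With K = e k for a basis vector of index k, the value of K at the index to
    which the entry (v, u) sends this vector. *)
Definition raised (v u : bool) (K : F) :=
  match v, u with true, false => K + e | false, true => K - e | _, _ => K end.

(** For K = e k and N = e (Lambda + 1) these are the matrix elements of an
    evaluation module multiplied by its denominator in z. K and N are kept
    free because the exchange relations hold for all of their values. *)
Definition eval_entry (N : F) (v u : bool) (K l z : F) := match v, u with
  | true, true => th (z + K) * th (l + K) / th l
  | true, false => th (l + z + K + e) * th (K + e) / th l
  | false, true => - (th (z - l + N - K) * th (N - K) / th l)
  | false, false => th (z + N - K - e) * th (l - N + K + e) / th l end.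

(** The R-matrix multiplied by theta(x - e). *)
Definition Rhat (x l : F) (s r : bool * bool) := match s, r with
  | (true, true), (true, true) | (false, false), (false, false) => th (x - e)
  | (true, false), (true, false) => th (l + e) * th x / th l
  | (false, true), (false, true) => th (l - e) * th x / th l
  | (true, false), (false, true) => - (th (l + x) * th e / th l)
  | (false, true), (true, false) => th (x - l) * th e / th l
  | _, _ => 0 end.

Lemma sum_bool2 (f : bool * bool -> F) : \sum_r f r =
  f (true, true) + f (true, false) + f (false, true) + f (false, false).
Proof.
have -> : \sum_r f r = \sum_a \sum_b f (a, b) by rewrite pair_bigA; apply: eq_bigr => -[].
by rewrite !big_bool; exact: addrA.
Qed.

Ltac fay_case vars hyps cof :=
  apply/subr0_eq; transitivity cof; [|by rewrite ?fay ?mulr0 ?addr0];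
  hyps; rewrite /fay_sum; lin_atoms vars; move=> *; field; rewrite //;
  repeat (apply/andP; split); assumption.

(** Each component is an identity between theta products: the difference of
    the two sides is the given combination of Fay identities. K' is the value
    of K at the final vector, so that l' is l shifted by its weight. *)
Lemma eval_entry_RLL (N K z w l : F) (s t : bool * bool)
    (K' := raised s.1 t.1 (raised s.2 t.2 K)) (l' := l - N + e + (K' + K')) :
  th l != 0 -> th (l - e) != 0 -> th (l + e) != 0 -> th l' != 0 ->
  \sum_r Rhat (z - w) l' s r *
      (eval_entry N r.1 t.1 (raised r.2 t.2 K) l z * eval_entry N r.2 t.2 K (dyn_shift t.1 l) w) =
  \sum_r eval_entry N s.2 r.2 (raised s.1 r.1 K) l w * eval_entry N s.1 r.1 K (dyn_shift r.2 l) z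
      * Rhat (z - w) l r t.
Proof.
rewrite !sum_bool2 /l' /K' {l' K'}; case: s => [[] []]; case: t => [[] []];
  rewrite /= ?(mul0r, mulr0, addr0, add0r) => n0 n1 n2 n3.
- fay_case [:: z; w; l; K; N; e] ltac:(move: n0 n1 n2 n3)
    (0 : F).
- fay_case [:: z; w; l; K; N; e] ltac:(move: n0 n1 n2 n3)
    (th (K + e) * th (l + K + e) / (th l * th l * th (l - e)) * fay_sum (z - w - e) (- z - K) (z + K + e) (w + l + K + e)).
- fay_case [:: z; w; l; K; N; e] ltac:(move: n0 n1 n2 n3)
    (th (K + e) * th (l + K + e) / (th l * th l * th (l + e)) * fay_sum l e (w + K) (z + K)).
- fay_case [:: z; w; l; K; N; e] ltac:(move: n0 n1 n2 n3)
    (0 : F).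
- fay_case [:: z; w; l; K; N; e] ltac:(move: n0 n1 n2 n3)
    (th (K - N) * th (l + K - e) / (th (l + K + K - N - e) * th l * th (l - e)) * fay_sum (z - w) (- e) (l + K + K - N) (w + K)).
- fay_case [:: z; w; l; K; N; e] ltac:(move: n0 n1 n2 n3)
    (th (w - K + N - e) * th (z - w) * th (z + K) / (th (l + K + K - N + e) * th l * th l * th (l - e)) * fay_sum (l + K) (- l - K - K + N - e) (l + K + K - N + e + e) (l + K - N + e) + - (th (K + e) * th e * th (K - N + e) / (th (l + K + K - N + e) * th l * th l * th (l - e))) * fay_sum l (- l - l - K - K + N - e) (w + l + K) (z + K)).
- fay_case [:: z; w; l; K; N; e] ltac:(move: n0 n1 n2 n3)
    (th (z + l + K) * th (z - w) * th (w - l - K + N - e) / (th (l + K + K - N + e) * th l * th l * th (l + e)) * fay_sum (l + K + K - N + e + e) (- K - K + N - e) (K - N) (- e) + - (th (l + K - N + e) * th (l + K + e) * th e / (th (l + K + K - N + e) * th l * th l * th (l + e))) * fay_sum (z - K + N - e) (- z - K) (z - w + l + K + K - N + e) (l + K + K - N + e)).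
- fay_case [:: z; w; l; K; N; e] ltac:(move: n0 n1 n2 n3)
    (th (K + e) * th (l + K - N + e + e) / (th (l + K + K - N + e + e + e) * th l * th (l + e)) * fay_sum (l + K + K - N + e + e + e + e) (- e) (z - w) (z - K + N - e - e)).
- fay_case [:: z; w; l; K; N; e] ltac:(move: n0 n1 n2 n3)
    (th (K - N) * th (l + K - e) / (th (l + K + K - N - e) * th l * th (l - e)) * fay_sum (z - w - l - K - K + N + e) (l + K + K - N - e - e) e (w + K)).
- fay_case [:: z; w; l; K; N; e] ltac:(move: n0 n1 n2 n3)
    (th (l + K) * th (l + K - N) * th e / (th (l + K + K - N + e) * th l * th l * th (l - e)) * fay_sum (w - K + N - e) (- z + l + K - N + e) (z + K) (z - w) + th (z - l - K + N - e) * th (z - w) * th (w + l + K) / (th (l + K + K - N + e) * th l * th l * th (l - e)) * fay_sum (K + e) (- K - K + N - e) (K - N + e) (l + K - N)).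
- fay_case [:: z; w; l; K; N; e] ltac:(move: n0 n1 n2 n3)
    (th K * th e * th (K - N) / (th (l + K + K - N + e) * th l * th l * th (l + e)) * fay_sum (z + l + K) (- z + l + K - N + e) (w - l - K + N - e) (- l - K - K + N - e) + th (z - w) * th (z - K + N - e) * th (w + K) / (th (l + K + K - N + e) * th l * th l * th (l + e)) * fay_sum (l + K - N + e) (- l - K - K + N - e) (l + K + e) (l + K)).
- fay_case [:: z; w; l; K; N; e] ltac:(move: n0 n1 n2 n3)
    (th (K + e) * th (l + K - N + e + e) / (th (l + K + K - N + e + e + e) * th l * th (l + e)) * fay_sum (w - K + N - e) (l + K + K - N + e + e) e (z - w)).
- fay_case [:: z; w; l; K; N; e] ltac:(move: n0 n1 n2 n3)
    (0 : F).
- fay_case [:: z; w; l; K; N; e] ltac:(move: n0 n1 n2 n3)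
    (th (l + K - N) * th (K - N) / (th l * th l * th (l - e)) * fay_sum (w - K + N - e) (- z + l + K - N + e) (z - l - K + N) (z - w)).
- fay_case [:: z; w; l; K; N; e] ltac:(move: n0 n1 n2 n3)
    (th (l + K - N) * th (K - N) / (th l * th l * th (l + e)) * fay_sum (z - w - e) (- z + l + K - N + e) (w - l - K + N - e) (w - K + N)).
- fay_case [:: z; w; l; K; N; e] ltac:(move: n0 n1 n2 n3)
    (0 : F).
Qed.

(** The two components in which the spins differ are single Fay identities; in
    the two others the terms on the left cancel. *)
Lemma eval_entry_det (N K w l : F) (t : bool * bool)
    (D := th (l - N + e + (K + K)) / th l * (th w * th (w + N))) :
  th l != 0 -> th (l - e) != 0 -> th (l + e) != 0 ->
  eval_entry N true t.1 (raised false t.2 K) l (w + e) * eval_entry N false t.2 K (dyn_shift t.1 l) w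
  - eval_entry N false t.1 (raised true t.2 K) l (w + e) * eval_entry N true t.2 K (dyn_shift t.1 l) w
  = D * ((t == (true, false))%:R - (t == (false, true))%:R).
Proof.
rewrite /D {D}; case: t => [[] []]; rewrite /= ?(subr0, sub0r, mulr1, mulr0, mulrN1) => n0 n1 n2.
- fay_case [:: w; l; K; N; e] ltac:(move: n0 n1 n2) (0 : F).
- fay_case [:: w; l; K; N; e] ltac:(move: n0 n1 n2) (1 / (th l * th (l - e))
    * fay_sum (w - K + N - e) (- w) (l + K - N) (l + K + K - N + e)).
- fay_case [:: w; l; K; N; e] ltac:(move: n0 n1 n2) (1 / (th l * th (l + e))
    * fay_sum (w + l + K + e) (- l - K - K + N - e) (K - N) (- l - e)).
- fay_case [:: w; l; K; N; e] ltac:(move: n0 n1 n2) (0 : F).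
Qed.

End FormalRLL.
End FormalTheta.

(** * Exchange relations in tensor products *)

Section TensorRLL.
Variables (F : fieldType) (th : F -> F) (e : F).
Local Notation dyn := (dyn_shift e).
Local Notation Rhat := (Rhat th e).

(** On this set the denominators in l do not vanish, and it is stable under
    the dynamical shifts. *)
Definition dom (l : F) := forall k : int, th (l + e * k%:~R) != 0.

Lemma dom_shift l (k : int) : dom l -> dom (l + e * k%:~R).
Proof. by move=> dl j; rewrite -addrA -mulrDr -intrD. Qed.

Lemma dom_shiftN l (k : int) : dom l -> dom (l - e * k%:~R).
Proof. by rewrite -mulrN -intrN; exact: dom_shift. Qed.

Lemma dom_neq0 l : dom l -> th l != 0.
Proof. by move=> /(_ 0); rewrite mulr0 addr0. Qed.

Definition spinz (v : bool) : int := if v then 1 else -1.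

Lemma dynE u l : dyn u l = l - e * (spinz u)%:~R.
Proof. by case: u; rewrite /dyn_shift ?mulr1 // mulrN1z mulrN mulr1 opprK. Qed.

Section Kernels.
Variable I : finType.
Implicit Types A B : I -> I -> F.

Definition kcomp A B k m := \sum_j A k j * B j m.

Lemma sum_neq0 (J : finType) (f : J -> F) : \sum_j f j != 0 -> exists j, f j != 0.
Proof.
move=> n0; apply/existsP; apply: contraNT n0 => /existsPn f0.
by rewrite big1 // => j _; apply/eqP; have := f0 j; rewrite negbK.
Qed.

Lemma kcompA A B C : kcomp A (kcomp B C) = kcomp (kcomp A B) C.
Proof.
apply/funext => k; apply/funext => m; rewrite /kcomp.
under eq_bigr do rewrite mulr_sumr; rewrite exchange_big /=.
by apply: eq_bigr => j _; rewrite mulr_suml; apply: eq_bigr => i _; rewrite mulrA.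
Qed.

(** The four blocks, indexed by row and column, of an operator depending on z
    and l. *)
Definition entries := bool -> bool -> F -> F -> I -> I -> F.
Implicit Types X Y : entries.

Definition conserves (wt : I -> int) X := forall v u z l k m,
  X v u z l k m != 0 -> spinz v + wt k = spinz u + wt m.

(** The product of L13(z, l) and L23(w, l - e h1). The spin in the shift is
    that of the vector acted on, hence t.1. *)
Definition comp2 X (s t : bool * bool) z w l :=
  kcomp (X s.1 t.1 z l) (X s.2 t.2 w (dyn t.1 l)).

Definition swap (s : bool * bool) := (s.2, s.1).

(** The R-matrix on the left is applied last, to vectors of weight wt k.
    Exchanging the two spins expresses the product of L23(w) and L13(z) by
    comp2 as well. *)
Definition RLL (wt : I -> int) X := forall z w l s t k m, dom l ->
  \sum_r Rhat (z - w) (l - e * (wt k)%:~R) s r * comp2 X r t z w l k m =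
  \sum_r comp2 X (swap s) (swap r) w z l k m * Rhat (z - w) l r t.

Definition minor (t : bool * bool) : F := (t == (true, false))%:R - (t == (false, true))%:R.

(** Antisymmetrization of the two spins, in which minor t are the coordinates
    of the antisymmetric covector. The scalar is the quantum determinant. *)
Definition qdet (wt : I -> int) (d : F -> F) X := forall w l t k m, dom l ->
  comp2 X (true, false) t (w + e) w l k m - comp2 X (false, true) t (w + e) w l k m =
  (k == m)%:R * (th (l - e * (wt k)%:~R) / th l * d w) * minor t.

Lemma qdet_minor wt d X w l t k m : qdet wt d X -> dom l ->
  \sum_s minor s * comp2 X s t (w + e) w l k m =
  (k == m)%:R * (th (l - e * (wt k)%:~R) / th l * d w) * minor t.
Proof.
move=> dX /(dX w l t k m) <-; rewrite sum_bool2 /minor /=.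
by rewrite !(subr0, sub0r, mul0r, add0r, addr0, mul1r, mulN1r).
Qed.

Section Step.
Variables (wX wY : I -> int) (X Y : entries).
Hypotheses (cX : conserves wX X) (cY : conserves wY Y).
Hypothesis fX : forall v u z l k m, X v u z l k m != 0 -> wY k = wY m.
Hypothesis fY : forall v u z l k m, Y v u z l k m != 0 -> wX k = wX m.
Hypothesis XY : forall v u z l v' u' z' l' k m,
  kcomp (X v u z l) (Y v' u' z' l') k m = kcomp (Y v' u' z' l') (X v u z l) k m.

Definition shifted l j := l - e * (wY j)%:~R.

(** X and Y act on the same index set, but change complementary parts of an
    index, as required by the hypotheses fX, fY and XY. The factor X sees l
    shifted by the weight of Y. *)
Definition tensor2 : entries := fun v u z l k m =>
  \sum_q \sum_j X v q z (shifted l j) k j * Y q u z l j m.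

(** The factors of the two operators can be regrouped, Y past X, and the
    shifts then are those required by comp2 for X and for Y separately. *)
Lemma comp2_tensor2 s t z w l k m : comp2 tensor2 s t z w l k m =
  \sum_q \sum_j comp2 X s q z w (shifted l j) k j * comp2 Y q t z w l j m.
Proof.
pose x q k j := X s.1 q z (shifted l j) k j; pose y q := Y q t.1 z l.
pose x' q k j := X s.2 q w (shifted (dyn t.1 l) j) k j; pose y' q := Y q t.2 w (dyn t.1 l).
pose xx (q : bool * bool) k j := comp2 X s q z w (shifted l j) k j.
(* y commutes with x'; the weight that y adds turns the shift of x' into the
   one prescribed by the composition of x and x' *)
have yx q q' : kcomp (x q) (kcomp (y q) (x' q')) = kcomp (xx (q, q')) (y q).
  apply/funext => i; apply/funext => m'; rewrite /kcomp.
  under eq_bigr => j _.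
    rewrite -[\sum_j0 _]/(kcomp (y q) (X s.2 q' w (shifted (dyn t.1 l) m')) j m') -XY mulr_sumr.
    over.
  rewrite exchange_big /=; apply: eq_bigr => j _; rewrite /xx /comp2 /kcomp /= mulr_suml.
  apply: eq_bigr => p _; rewrite /x /y mulrA.
  have [->|/cY yc] := eqVneq (Y q t.1 z l j m') 0; first by rewrite !mulr0.
  congr (_ * _); rewrite (_ : shifted (dyn t.1 l) m' = dyn q (shifted l j)).
    have [->|/fX pj] := eqVneq (X s.2 q' w (dyn q (shifted l j)) p j) 0; first by rewrite !mulr0.
    by rewrite /shifted pj.
  rewrite /shifted !dynE -!addrA -!opprD -!mulrDr -!intrD -yc.
  by rewrite (addrC (wY j)).
have sep q q' : kcomp (kcomp (x q) (y q)) (kcomp (x' q') (y' q')) =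
    kcomp (xx (q, q')) (comp2 Y (q, q') t z w l).
  by rewrite kcompA -(kcompA (x q)) yx -kcompA.
transitivity (\sum_q \sum_q' kcomp (kcomp (x q) (y q)) (kcomp (x' q') (y' q')) k m).
  rewrite /comp2 {1}/kcomp; under eq_bigr do rewrite big_distrlr.
  by rewrite exchange_big; apply: eq_bigr => q _; rewrite exchange_big.
rewrite (pair_bigA _ (fun q q' => kcomp (kcomp (x q) (y q)) (kcomp (x' q') (y' q')) k m)) /=.
by apply: eq_bigr => -[q q'] _; rewrite sep.
Qed.

Lemma conserves_tensor2 : conserves (fun k => wX k + wY k) tensor2.
Proof.
move=> v u z l k m /sum_neq0[q /sum_neq0[j]].
rewrite mulf_eq0 negb_or => /andP[xn yn].
by rewrite (fX xn) addrA (cX xn) -addrA [_ + wY j]addrC addrA (cY yn) (fY yn) -addrA [wX m + _]addrC.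
Qed.

Lemma comp2_X0 s q z w l k j : wY k != wY j -> comp2 X s q z w l k j = 0.
Proof.
move=> kj; apply: big1 => i _.
have [->|/fX ki] := eqVneq (X s.1 q.1 z l k i) 0; first by rewrite mul0r.
have [->|/fX ij] := eqVneq (X s.2 q.2 w (dyn q.1 l) i j) 0; first by rewrite mulr0.
by rewrite ki ij eqxx in kj.
Qed.

Lemma shiftD l k j : wY k = wY j ->
  l - e * (wX k + wY k)%:~R = shifted l j - e * (wX k)%:~R.
Proof. by move=> kj; rewrite intrD mulrDr opprD addrA addrAC kj. Qed.

(** The R-matrix is moved first through the X factors, with l shifted by the
    weight of Y, and then through the Y factors. *)
Lemma RLL_tensor2 : RLL wX X -> RLL wY Y -> RLL (fun k => wX k + wY k) tensor2.
Proof.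
move=> RX RY z w l s t k m dl.
transitivity (\sum_q \sum_j (\sum_r Rhat (z - w) (l - e * (wX k + wY k)%:~R) s r *
    comp2 X r q z w (shifted l j) k j) * comp2 Y q t z w l j m).
  under eq_bigr => r _ do (rewrite comp2_tensor2 mulr_sumr;
    under eq_bigr do (rewrite mulr_sumr; under eq_bigr do rewrite mulrA)).
  rewrite exchange_big; apply: eq_bigr => q _; rewrite exchange_big.
  by apply: eq_bigr => j _; rewrite mulr_suml.
transitivity (\sum_q \sum_j (\sum_r comp2 X (swap s) (swap r) w z (shifted l j) k j *
    Rhat (z - w) (shifted l j) r q) * comp2 Y q t z w l j m).
  apply: eq_bigr => q _; apply: eq_bigr => j _; congr (_ * _).
  have [kj|kj] := eqVneq (wY k) (wY j).
    by rewrite (shiftD _ kj) RX //; exact: dom_shiftN.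
  by rewrite !big1 // => r _; rewrite comp2_X0 ?mul0r ?mulr0.
transitivity (\sum_r \sum_j comp2 X (swap s) (swap r) w z (shifted l j) k j *
    \sum_q Rhat (z - w) (shifted l j) r q * comp2 Y q t z w l j m).
  rewrite exchange_big [RHS]exchange_big; apply: eq_bigr => j _ /=.
  under eq_bigr do rewrite mulr_suml.
  rewrite exchange_big; apply: eq_bigr => r _ /=.
  by rewrite mulr_sumr; apply: eq_bigr => q _; rewrite mulrA.
transitivity (\sum_r \sum_j comp2 X (swap s) (swap r) w z (shifted l j) k j *
    \sum_q comp2 Y (swap r) (swap q) w z l j m * Rhat (z - w) l q t).
  by apply: eq_bigr => r _; apply: eq_bigr => j _; rewrite RY.
have sum_swap (f : bool * bool -> F) : \sum_r f (swap r) = \sum_r f r.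
  by rewrite !sum_bool2 /swap /=; ring.
under [RHS]eq_bigr do rewrite comp2_tensor2 mulr_suml.
rewrite exchange_big [RHS]exchange_big /= -[RHS]sum_swap.
rewrite exchange_big; apply: eq_bigr => r _ /=.
under eq_bigr do rewrite mulr_sumr.
rewrite exchange_big; apply: eq_bigr => q _ /=.
by rewrite mulr_suml; apply: eq_bigr => j _; rewrite mulrA.
Qed.

(** The numerator of the scalar for Y at l is the denominator of the scalar
    for X at the shifted argument. *)
Lemma qdet_tensor2 dX dY : qdet wX dX X -> qdet wY dY Y ->
  qdet (fun k => wX k + wY k) (fun w => dX w * dY w) tensor2.
Proof.
move=> DX DY w l t k m dl; rewrite !comp2_tensor2 -sumrB.
transitivity (\sum_q \sum_j (k == j)%:R * (th (shifted l j - e * (wX k)%:~R) / th (shifted l j)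
    * dX w) * (minor q * comp2 Y q t (w + e) w l j m)).
  apply: eq_bigr => q _; rewrite -sumrB; apply: eq_bigr => j _.
  by rewrite -mulrBl DX ?mulrA //; exact: dom_shiftN.
rewrite exchange_big [LHS](bigD1 (k : I)) //= [X in _ + X]big1 ?addr0; last first.
  move=> j /negbTE; rewrite eq_sym => ->; apply: big1 => q _; by rewrite !mul0r.
rewrite -mulr_sumr eqxx mul1r (qdet_minor _ _ _ _ DY dl) (shiftD _ (erefl (wY k))).
by rewrite -/(shifted l k); field; rewrite !dom_neq0 //; exact: dom_shiftN.
Qed.

End Step.
End Kernels.
Section Embedding.
Variables (n : nat) (J : 'I_n -> finType).
Local Notation I := {dffun forall i, J i}.
Implicit Types (k m : I).

Definition same_off (i : 'I_n) k m := [forall j, (j != i) ==> (k j == m j)].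

Definition emb (i : 'I_n) (x : J i -> J i -> F) k m : F :=
  if same_off i k m then x (k i) (m i) else 0.

Definition upd k (i : 'I_n) (a : J i) : I := finfun (eqtype.dfwith k a).

Lemma upd_at k i a : @upd k i a i = a.
Proof. by rewrite ffunE eqtype.dfwith_in. Qed.

Lemma upd_off k i a j : j != i -> @upd k i a j = k j.
Proof. by move=> ji; rewrite ffunE eqtype.dfwith_out // eq_sym. Qed.

Lemma same_off_at i k m : same_off i k m -> k i = m i -> k = m.
Proof.
move=> /forallP km kmi; apply/ffunP => j; have [->//|ji] := eqVneq j i.
by have /implyP/(_ ji)/eqP := km j.
Qed.

Lemma same_off_out i j k m : same_off i k m -> j != i -> k j = m j.
Proof. by move=> /forallP/(_ j)/implyP km /km/eqP. Qed.

Lemma same_off_upd i k a : same_off i k (@upd k i a).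
Proof. by apply/forallP => j; apply/implyP => ji; rewrite upd_off. Qed.

Lemma sum_same_off i k (f : I -> F) :
  \sum_(m | same_off i k m) f m = \sum_a f (@upd k i a).
Proof.
rewrite (reindex_onto (@upd k i) (fun m => m i)) /=.
  by apply: eq_bigl => a; rewrite same_off_upd upd_at eqxx.
move=> m km; apply: (@same_off_at i); last by rewrite upd_at.
by apply/forallP => j; apply/implyP => ji; rewrite upd_off // (same_off_out km).
Qed.

Lemma kcomp_embl i x (B : I -> I -> F) k m :
  kcomp (@emb i x) B k m = \sum_a x (k i) a * B (upd k a) m.
Proof.
transitivity (\sum_(j | same_off i k j) x (k i) (j i) * B j m).
  by rewrite [RHS]big_mkcond; apply: eq_bigr => j _; rewrite /emb; case: ifP; rewrite ?mul0r.
by rewrite sum_same_off; apply: eq_bigr => a _; rewrite upd_at.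
Qed.

Lemma kcomp_emb i x y k m :
  kcomp (@emb i x) (@emb i y) k m = emb (kcomp x y) k m.
Proof.
rewrite kcomp_embl /emb.
have E (a : J i) : same_off i (upd k a) m = same_off i k m.
  apply: eq_forallb => j; case: (eqVneq j i) => //= ji.
  by rewrite upd_off.
under eq_bigr do rewrite E upd_at; case: ifP => _ //.
by apply: big1 => a _; rewrite mulr0.
Qed.

Lemma kcomp_emb2 i j x y k m : i != j -> kcomp (@emb i x) (@emb j y) k m =
  if [forall p, (p != i) && (p != j) ==> (k p == m p)]
  then x (k i) (m i) * y (k j) (m j) else 0.
Proof.
move=> ij; rewrite kcomp_embl (bigD1 (m i)) //= big1 ?addr0; last first.
  move=> a ai; rewrite /emb; case: ifP => [km|]; last by rewrite mulr0.
  by move: ai; rewrite -(same_off_out km ij) upd_at eqxx.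
have E : same_off j (upd k (m i)) m = [forall p, (p != i) && (p != j) ==> (k p == m p)].
  apply: eq_forallb => p; have [->|pi] := eqVneq p i; first by rewrite upd_at eqxx implybT.
  by rewrite upd_off.
by rewrite /emb E upd_off; [case: ifP; rewrite ?mulr0|rewrite eq_sym].
Qed.

Lemma emb_comm i j x y k m : i != j ->
  kcomp (@emb i x) (@emb j y) k m = kcomp (@emb j y) (@emb i x) k m.
Proof.
move=> ij; have ji : j != i by rewrite eq_sym.
rewrite (kcomp_emb2 _ _ _ _ ij) (kcomp_emb2 _ _ _ _ ji) [y _ _ * _]mulrC.
by congr (if _ then _ else _); apply: eq_forallb => p; rewrite andbC.
Qed.

Variables (wt : forall i, J i -> int) (X : forall i, entries (J i)) (d : 'I_n -> F -> F).

Definition wts (r : seq 'I_n) k : int := \sum_(i <- r) wt (k i).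

Definition emb_entries i : entries I := fun v u z l => emb (@X i v u z l).

(** Only the factors in r act. Keeping the full index set makes induction on r
    possible without dependent types of varying length. *)
Fixpoint tensors (r : seq 'I_n) : entries I := match r with
  | [::] => fun v u _ _ k m => ((v == u) && (k == m))%:R
  | i :: r' => tensor2 (wts r') (emb_entries i) (tensors r') end.

Hypothesis cX : forall i, conserves (@wt i) (@X i).

Lemma emb_neq0 i x k m : @emb i x k m != 0 -> same_off i k m.
Proof. by rewrite /emb; case: ifP; rewrite // eqxx. Qed.

Lemma conserves_emb i : conserves (fun k => wt (k i)) (emb_entries i).
Proof.
move=> v u z l k m; rewrite /emb_entries /emb; case: ifP => _; last by rewrite eqxx.
exact: cX.
Qed.

Lemma tensors_out r v u z l k m i : tensors r v u z l k m != 0 -> i \notin r -> k i = m i.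
Proof.
elim: r v u z l k m => [|j r IH] v u z l k m /=.
  by have [->//|km] := eqVneq k m; rewrite andbF eqxx.
move=> /sum_neq0[q /sum_neq0[p]]; rewrite mulf_eq0 negb_or inE negb_or.
move=> /andP[/emb_neq0 kp /IH pm] /andP[ij ir].
by rewrite (same_off_out kp ij) pm.
Qed.

Lemma wts_emb r i v u z l k m : emb_entries i v u z l k m != 0 -> i \notin r ->
  wts r k = wts r m.
Proof.
move=> /emb_neq0 km ir; rewrite /wts big_seq [RHS]big_seq; apply: eq_bigr => j jr.
by rewrite (same_off_out km) //; apply: contraNneq ir => <-.
Qed.

(** The shifts inside tensors r involve the weights of the factors in r only,
    which the i-th factor leaves unchanged. *)
Lemma tensors_comm r i v u z l v' u' z' l' k m : i \notin r ->
  kcomp (emb_entries i v u z l) (tensors r v' u' z' l') k m =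
  kcomp (tensors r v' u' z' l') (emb_entries i v u z l) k m.
Proof.
elim: r v' u' z' l' k m => [|j r IH] v' u' z' l' k m.
  move=> _; rewrite /kcomp /= (bigD1 m) //= big1 ?addr0; last first.
    by move=> p /negbTE ->; rewrite andbF mulr0.
  rewrite [RHS](bigD1 k) //= [X in _ = _ + X]big1 ?addr0; last first.
    by move=> p /negbTE; rewrite eq_sym => ->; rewrite andbF mul0r.
  by rewrite !eqxx mulrC.
rewrite inE negb_or => /andP[ij ir] /=.
pose A q p := emb_entries j v' q z' (shifted (wts r) l' p).
have AE q : kcomp (emb_entries i v u z l) (fun k m => A q m k m) =
            kcomp (fun k m => A q m k m) (emb_entries i v u z l).
  apply/funext => k'; apply/funext => m'; rewrite /kcomp.
  rewrite -[LHS]/(kcomp (emb_entries i v u z l) (A q m') k' m') emb_comm //.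
  apply: eq_bigr => p _; rewrite -/(emb_entries i v u z l).
  have [->|/wts_emb/(_ ir) pm] := eqVneq (emb_entries i v u z l p m') 0.
    by rewrite !mulr0.
  by rewrite /A /shifted pm.
have tE : tensor2 (wts r) (emb_entries j) (tensors r) v' u' z' l' =
    fun k m => \sum_q kcomp (fun k m => A q m k m) (tensors r q u' z' l') k m by [].
rewrite tE; transitivity (\sum_q kcomp (emb_entries i v u z l)
    (kcomp (fun k m => A q m k m) (tensors r q u' z' l')) k m).
  by rewrite /kcomp exchange_big; apply: eq_bigr => p _; rewrite mulr_sumr.
transitivity (\sum_q kcomp (kcomp (fun k m => A q m k m) (tensors r q u' z' l'))
    (emb_entries i v u z l) k m); last first.
  by rewrite /kcomp exchange_big; apply: eq_bigr => p _; rewrite mulr_suml.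
apply: eq_bigr => q _; rewrite kcompA AE -!kcompA; congr (kcomp _ _ k m).
by apply/funext => k'; apply/funext => m'; exact: IH.
Qed.

Lemma conserves_tensors r : uniq r -> conserves (wts r) (tensors r).
Proof.
elim: r => [_|i r IH] /=.
  move=> v u z l k m; rewrite /wts !big_nil; by have [->|_] := eqVneq v u; rewrite ?eqxx.
move=> /andP[ir ur]; have -> : wts (i :: r) = fun k => wt (k i) + wts r k.
  by apply/funext => k; rewrite /wts big_cons.
apply: conserves_tensor2 (IH ur) _ _.
- exact: conserves_emb.
- by move=> v u z l k m /wts_emb; apply.
- by move=> v u z l k m /tensors_out/(_ ir) ->.
Qed.

Hypothesis RX : forall i, RLL (@wt i) (@X i).
Hypothesis DX : forall i, qdet (@wt i) (d i) (@X i).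

Lemma comp2_emb i s t z w l k m : comp2 (emb_entries i) s t z w l k m =
  if same_off i k m then comp2 (@X i) s t z w l (k i) (m i) else 0.
Proof. exact: kcomp_emb. Qed.

Lemma RLL_emb i : RLL (fun k => wt (k i)) (emb_entries i).
Proof.
move=> z w l s t k m dl; under eq_bigr do rewrite comp2_emb.
under [RHS]eq_bigr do rewrite comp2_emb.
case: (same_off i k m); first exact: RX.
by rewrite !big1 // => r _; rewrite ?mulr0 ?mul0r.
Qed.

Lemma qdet_emb i : qdet (fun k => wt (k i)) (d i) (emb_entries i).
Proof.
move=> w l t k m dl; rewrite !comp2_emb; case: ifP => km.
  rewrite DX //; congr (_%:R * _ * _).
  by congr nat_of_bool; apply/eqP/eqP => [/(same_off_at km)|->].
rewrite subr0 (_ : k == m = false) ?mul0r //; apply: contraFF km => /eqP ->.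
by apply/forallP => j; rewrite eqxx implybT.
Qed.

Lemma comp2_id s t z w l k m : comp2 (tensors [::]) s t z w l k m = ((s == t) && (k == m))%:R.
Proof.
rewrite /comp2 /kcomp /= (bigD1 k) //= big1 ?addr0; last first.
  by move=> p /negbTE; rewrite eq_sym => ->; rewrite andbF mul0r.
rewrite eqxx andbT -natrM mulnb; case: s t => [s1 s2] [t1 t2] /=.
by rewrite -andbA.
Qed.

Lemma RLL_tensors r : uniq r -> RLL (wts r) (tensors r).
Proof.
elim: r => [_|i r IH] /=.
  move=> z w l s t k m dl; rewrite /wts big_nil mulr0 subr0.
  under eq_bigr do rewrite comp2_id; under [RHS]eq_bigr do rewrite comp2_id.
  rewrite (bigD1 t) //= big1 ?addr0; last by move=> r /negbTE ->; rewrite mulr0.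
  rewrite [RHS](bigD1 s) //= [X in _ = _ + X]big1 ?addr0; last first.
    move=> r; rewrite (_ : (swap s == swap r) = (r == s)); first by move=> /negbTE ->; rewrite mul0r.
    by case: s r => [[] []] [[] []].
  by rewrite !eqxx mulrC.
move=> /andP[ir ur]; have -> : wts (i :: r) = fun k => wt (k i) + wts r k.
  by apply/funext => k; rewrite /wts big_cons.
apply: RLL_tensor2 (IH ur).
- exact: conserves_tensors.
- by move=> v u z l k m /wts_emb; apply.
- by move=> *; exact: tensors_comm.
- exact: RLL_emb.
Qed.

Lemma qdet_tensors r : uniq r -> qdet (wts r) (fun w => \prod_(i <- r) d i w) (tensors r).
Proof.
elim: r => [_|i r IH] /=.
  move=> w l t k m dl; rewrite !comp2_id /wts !big_nil mulr0 subr0 divff ?dom_neq0 //.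
  rewrite /minor !mulr1; case: (k == m); rewrite ?andbF ?subrr ?mul0r ?mul1r ?andbT //.
  by rewrite eq_sym [(_, true) == t]eq_sym.
move=> /andP[ir ur]; have -> : wts (i :: r) = fun k => wt (k i) + wts r k.
  by apply/funext => k; rewrite /wts big_cons.
have -> : (fun w => \prod_(j <- i :: r) d j w) = fun w => d i w * \prod_(j <- r) d j w.
  by apply/funext => w; rewrite big_cons.
apply: qdet_tensor2 (IH ur).
- exact: conserves_tensors.
- by move=> v u z l k m /wts_emb; apply.
- by move=> *; exact: tensors_comm.
- exact: qdet_emb.
Qed.

End Embedding.
Section EvaluationEntries.
Hypothesis thN : forall z, th (- z) = - th z.
Hypothesis fay : forall a b c d, fay_sum th a b c d = 0.
Hypothesis th00 : th 0 = 0.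
Variables (Lam : nat) (Y : F).
Local Notation N := (e * Lam.+1%:R).
Implicit Types (k m : 'I_Lam.+1) (s t r : bool * bool).

(** The evaluation module L_Lam(p) with p = Y - (Lam + 1) eta, multiplied by
    theta(z - Y). *)
Definition hat_eval : entries 'I_Lam.+1 := fun v u z l k m =>
  (k + ~~ v == m + ~~ u)%N%:R * eval_entry th e N v u (e * m%:R) l (z - Y).

Definition hat_wt k : int := Lam%:Z - (k + k)%N%:Z.

Lemma conserves_hat_eval : conserves hat_wt hat_eval.
Proof.
move=> v u z l k m; rewrite /hat_eval; have [km _|_] := eqVneq (k + ~~ v)%N (m + ~~ u)%N.
  by rewrite /hat_wt; case: v u km => [] []; rewrite ?addn0 ?addn1 /spinz; lia.
by rewrite mul0r eqxx.
Qed.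

Definition entry2 s t K z w l :=
  eval_entry th e N s.1 t.1 (raised e s.2 t.2 K) l (z - Y) *
  eval_entry th e N s.2 t.2 K (dyn t.1 l) (w - Y).

(** The free parameters of eval_entry account for the truncation of the basis
    at 0 and Lam because the entries that would leave the range vanish. *)
Lemma comp2_hat_eval s t z w l k m : comp2 hat_eval s t z w l k m =
  (k + ~~ s.1 + ~~ s.2 == m + ~~ t.1 + ~~ t.2)%N%:R * entry2 s t (e * m%:R) z w l.
Proof.
rewrite /comp2 /kcomp /hat_eval /entry2.
have [j jm|no] := pickP (fun j : 'I_Lam.+1 => j + ~~ s.2 == m + ~~ t.2)%N.
  rewrite (bigD1 j) //= big1 ?addr0 => [|i]; last first.
    move=> ij; rewrite (_ : (i + ~~ s.2 == m + ~~ t.2)%N = false) ?mul0r ?mulr0 //.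
    by apply: contraNF ij; rewrite -(eqP jm) eqn_add2r.
  rewrite jm mul1r mulrA; congr (_ * _ * _).
    by rewrite -(eqn_add2r (~~ s.2)) [(j + _ + _)%N]addnAC (eqP jm) [(m + _ + _)%N]addnAC.
  congr (eval_entry _ _ _ _ _ _ _ _); rewrite /raised; case: s.2 t.2 jm => [] []; rewrite ?addn0 ?addn1.
  - by move=> /eqP ->.
  - by move=> /eqP ->; rewrite -natr1 mulrDr mulr1.
  - by move=> /eqP <-; rewrite -natr1 mulrDr mulr1 addrK.
  - by rewrite eqSS => /eqP ->.
rewrite big1 => [|j _]; last by have := no j; move=> /= ->; rewrite mul0r mulr0.
(* an intermediate index outside of the range is killed by the coefficient
   that leads back into the range *)
have [km|_] := eqVneq; last by rewrite mul0r.
have mL := ltn_ord m; have kL := ltn_ord k; rewrite mul1r; apply/esym.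
have up : s.2 = true -> t.2 = false -> m = Lam :> nat.
  move=> s2 t2; apply/eqP; apply: contraT => mn.
  have m1 : (m.+1 < Lam.+1)%N by move/eqP: mn => mn; lia.
  by have := no (Ordinal m1); rewrite s2 t2 /= addn0 addn1 eqxx.
have down : s.2 = false -> t.2 = true -> m = 0%N :> nat.
  move=> s2 t2; apply/eqP; apply: contraT => mn.
  have m1 : (m.-1 < Lam.+1)%N by lia.
  by have := no (Ordinal m1); rewrite s2 t2 /= addn0 addn1 prednK ?eqxx // lt0n.
have same : s.2 <> t.2 by move=> s2; have := no m; rewrite s2 eqxx.
case: s t km up down same {no} => [s1 s2] [t1 t2] /=.
case: s2 t2 => [] [] //= km up down _.
- have m0 := up erefl erefl; case: s1 t1 km => [] [] /= km; try by exfalso; lia.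
  by rewrite m0 -natr1 mulrDr mulr1 subrr th00 mulr0 mul0r oppr0 mul0r.
- have m0 := down erefl erefl; case: s1 t1 km => [] [] /= km; try by exfalso; lia.
  by rewrite m0 mulr0 sub0r addNr th00 mulr0 !mul0r.
Qed.

Lemma Rhat_cons z l s r : Rhat z l s r != 0 -> (~~ s.1 + ~~ s.2 = ~~ r.1 + ~~ r.2)%N.
Proof. by case: s r => [[] []] [[] []]; rewrite //= eqxx. Qed.

Lemma hat_wt_raised k s t m : (k + (~~ s.1 + ~~ s.2) = m + (~~ t.1 + ~~ t.2))%N ->
  raised e s.1 t.1 (raised e s.2 t.2 (e * m%:R)) = e * k%:R.
Proof.
have step v u (i j : nat) : (i + ~~ v = j + ~~ u)%N -> raised e v u (e * j%:R) = e * i%:R.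
  case: v u => [] [] /=; rewrite ?addn0 ?addn1.
  - by move=> ->.
  - by move=> ->; rewrite -natr1 mulrDr mulr1.
  - by move=> <-; rewrite -natr1 mulrDr mulr1 addrK.
  - by move=> [->].
move=> kmE; case: s t kmE => [s1 s2] [t1 t2] /= kmE.
case: (leqP (~~ s2) (m + ~~ t2)) => h; last first.
  case: s2 t2 h kmE => [] [] /=; rewrite ?addn0 ?addn1 // ltnS leqn0 => /eqP ->.
  case: s1 t1 => [] [] /= kE; try (by exfalso; lia).
  have -> : k = 0%N :> nat by lia.
  by rewrite mulr0 sub0r addNr.
rewrite (step s2 t2 (m + ~~ t2 - ~~ s2)%N); last by rewrite subnK.
by apply: step; move: h kmE; lia.
Qed.

Lemma hat_wt_shift l k s t m : (k + (~~ s.1 + ~~ s.2) = m + (~~ t.1 + ~~ t.2))%N ->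
  l - e * (hat_wt k)%:~R = l - N + e +
    (raised e s.1 t.1 (raised e s.2 t.2 (e * m%:R)) + raised e s.1 t.1 (raised e s.2 t.2 (e * m%:R))).
Proof.
move=> /hat_wt_raised ->; by rewrite /hat_wt intrB -!pmulrn natrD -natr1; ring.
Qed.

Lemma domP l : dom l -> [/\ th l != 0, th (l - e) != 0 & th (l + e) != 0].
Proof.
move=> dl; rewrite dom_neq0 //; split => //.
  by have := dl (-1); rewrite mulrN1z mulrN mulr1.
by have := dl 1; rewrite mulr1z mulr1.
Qed.

(** A component is either excluded by weight, or an instance of
    eval_entry_RLL. *)
Lemma RLL_hat_eval : RLL hat_wt hat_eval.
Proof.
move=> z w l s t k m dl; have [l0 l1 l2] := domP dl.
under eq_bigr do rewrite comp2_hat_eval; under [RHS]eq_bigr do rewrite comp2_hat_eval.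
have [km|km] := eqVneq (k + (~~ s.1 + ~~ s.2))%N (m + (~~ t.1 + ~~ t.2))%N; last first.
  rewrite !big1 // => r _.
    have [->|/Rhat_cons rt] := eqVneq (Rhat (z - w) l r t) 0; first by rewrite mulr0.
    rewrite -!addnA /= [(~~ s.2 + _)%N]addnC [(~~ r.2 + _)%N]addnC rt (negbTE km).
    by rewrite !mul0r.
  have [->|/Rhat_cons sr] := eqVneq (Rhat (z - w) (l - e * (hat_wt k)%:~R) s r) 0.
    by rewrite mul0r.
  by rewrite -!addnA -sr (negbTE km) !mul0r mulr0.
have dl' := dom_neq0 (dom_shiftN (hat_wt k) dl); rewrite (hat_wt_shift l km) in dl' *.
set l' := (l - N + e + _) in dl' *.
transitivity (\sum_r Rhat (z - w) l' s r * entry2 r t (e * m%:R) z w l).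
  apply: eq_bigr => r _; have [->|/Rhat_cons sr] := eqVneq (Rhat (z - w) l' s r) 0.
    by rewrite !mul0r.
  by rewrite -!addnA -sr km eqxx mul1r.
have := @eval_entry_RLL _ th thN fay e N (e * m%:R) (z - Y) (w - Y) l s t l0 l1 l2 dl'.
rewrite (_ : z - Y - (w - Y) = z - w); last by ring.
move=> ->; apply: eq_bigr => r _.
have [->|/Rhat_cons rt] := eqVneq (Rhat (z - w) l r t) 0; first by rewrite !mulr0.
by rewrite -!addnA /= [(~~ s.2 + _)%N]addnC [(~~ r.2 + _)%N]addnC rt km eqxx mul1r.
Qed.

Lemma qdet_hat_eval : qdet hat_wt (fun w => th (w - Y) * th (w - Y + N)) hat_eval.
Proof.
move=> w l t k m dl; have [l0 l1 l2] := domP dl; rewrite !comp2_hat_eval /= !addn0.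
rewrite -mulrBr -addnA /entry2 /=.
rewrite (_ : w + e - Y = w - Y + e); last by ring.
rewrite (eval_entry_det thN fay N _ (w - Y) t l0 l1 l2) -/(minor t).
have [->|tn] := eqVneq (minor t) 0; first by rewrite !mulr0.
have t1 : (~~ t.1 + ~~ t.2 = 1)%N by case: t tn => [[] []]; rewrite /minor //= subrr eqxx.
rewrite t1 eqn_add2r; have [km|km] := eqVneq (k : nat) m; last first.
  by rewrite (_ : k == m = false) ?mul0r //; apply: contraNF km => /eqP ->.
have -> : k = m by apply/val_inj.
rewrite eqxx !mul1r (hat_wt_shift (k := m) (s := (true, true)) (t := (true, true)) (m := m) l erefl).
by [].
Qed.

End EvaluationEntries.
End TensorRLL.

(** * Eigenvectors of a(z) *)

Section Eigenbasis.
Variables (F : fieldType) (th : F -> F) (e : F).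
Hypothesis thN : forall z, th (- z) = - th z.
Hypothesis th00 : th 0 = 0.
Local Notation dyn := (dyn_shift e).
Local Notation Rhat := (Rhat th e).
Local Notation dom := (dom th e).

Variables (n : nat) (Lam : 'I_n -> nat) (Y : 'I_n -> F).
Local Notation I := {dffun forall i, 'I_(Lam i).+1}.
Implicit Types (k : I) (l z w : F) (m : 'I_n -> nat).

Hypothesis gen_e : forall j : int, j != 0 -> th (e * j%:~R) != 0.
Hypothesis gen_Y : forall i i' (j : int), i != i' -> th (Y i - Y i' + e * j%:~R) != 0.

(** An abstract solution of the RLL and determinant relations with a highest
    weight vector. It will be the tensor product of evaluation modules,
    multiplied by its denominator in z. *)
Variables (T : entries F I) (wt : I -> int).

Definition delta w := \prod_i (th (w - Y i) * th (w - Y i + e * (Lam i).+1%:R)).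
Definition vacuum : I := [ffun => ord0].

Hypothesis cT : conserves wt T.
Hypothesis RT : RLL th e wt T.
Hypothesis DT : qdet th e wt delta T.
Hypothesis T_vac : forall z l k, dom l ->
  T true true z l k vacuum = (k == vacuum)%:R * \prod_i th (z - Y i).

(** Functions of z whose vanishing off the zeros of theta(z - c) implies that
    they vanish everywhere; entire functions in the application. They allow
    division by theta(z - c) in relations that depend on z. *)
Variable reg : (F -> F) -> Prop.
Hypothesis reg_cst : forall c, reg (fun=> c).
Hypothesis regM : forall f g, reg f -> reg g -> reg (fun z => f z * g z).
Hypothesis regD : forall f g, reg f -> reg g -> reg (fun z => f z + g z).
Hypothesis reg_th : forall c, reg (fun z => th (z - c)).
Hypothesis reg_T : forall v u l k k', dom l -> reg (fun z => T v u z l k k').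
Hypothesis reg_eq0 : forall f c, reg f -> (forall z, th (z - c) != 0 -> f z = 0) ->
  forall z, f z = 0.

Lemma reg_sum (J : Type) (r : seq J) (f : J -> F -> F) :
  (forall j, reg (f j)) -> reg (fun z => \sum_(j <- r) f j z).
Proof. by move=> rf; apply: (big_closed (reg_cst 0) (@regD)) => j _. Qed.

Lemma reg_prod (J : Type) (r : seq J) (f : J -> F -> F) :
  (forall j, reg (f j)) -> reg (fun z => \prod_(j <- r) f j z).
Proof. by move=> rf; apply: (big_closed (reg_cst 1) (@regM)) => j _. Qed.

Lemma dom_dyn l u : dom l -> dom (dyn u l).
Proof. by rewrite dynE; exact: dom_shiftN. Qed.

Definition kapp (A : I -> I -> F) (f : I -> F) k := \sum_j A k j * f j.
(** The operators a, b, c, d of the operator algebra for (v, u) equal to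
    (true, true), (true, false), (false, true), (false, false). *)
Definition op (v u : bool) z (phi : F -> I -> F) l := kapp (T v u z l) (phi (dyn u l)).
Implicit Types phi psi : F -> I -> F.

Lemma kapp_comp A B f : kapp A (kapp B f) = kapp (kcomp A B) f.
Proof.
apply/funext => k; rewrite /kapp /kcomp; under eq_bigr do rewrite mulr_sumr.
rewrite exchange_big; apply: eq_bigr => j _ /=; rewrite mulr_suml.
by apply: eq_bigr => i _; rewrite mulrA.
Qed.

Lemma op_op s t z w phi l : op s.1 t.1 z (op s.2 t.2 w phi) l =
  kapp (comp2 e T s t z w l) (phi (dyn t.2 (dyn t.1 l))).
Proof. by rewrite /op kapp_comp. Qed.

(** In terms of operators on functions of l the shifts are implicit. Both
    sides apply to the same translate of phi since the R-matrix preserves the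
    total spin. *)
Lemma op_RLL s t z w phi l k : dom l ->
  \sum_r Rhat (z - w) (l - e * (wt k)%:~R) s r * op r.1 t.1 z (op r.2 t.2 w phi) l k =
  \sum_r Rhat (z - w) l r t * op s.2 r.2 w (op s.1 r.1 z phi) l k.
Proof.
move=> dl; set f := phi (dyn t.2 (dyn t.1 l)).
transitivity (\sum_j (\sum_r Rhat (z - w) (l - e * (wt k)%:~R) s r *
    comp2 e T r t z w l k j) * f j).
  under eq_bigr do rewrite op_op /kapp mulr_sumr.
  rewrite exchange_big; apply: eq_bigr => j _ /=; rewrite mulr_suml.
  by apply: eq_bigr => r _; rewrite mulrA.
transitivity (\sum_r Rhat (z - w) l r t * kapp (comp2 e T (swap s) (swap r) w z l) f k).
  under eq_bigr do rewrite RT // mulr_suml.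
  rewrite exchange_big; apply: eq_bigr => r _ /=; rewrite /kapp mulr_sumr.
  by apply: eq_bigr => j _; rewrite mulrCA mulrA.
apply: eq_bigr => r _.
have [->|/Rhat_cons rt] := eqVneq (Rhat (z - w) l r t) 0; first by rewrite !mul0r.
rewrite -[op s.2 r.2 w _]/(op (swap s).1 (swap r).1 w (op (swap s).2 (swap r).2 z phi)) op_op.
rewrite /f; congr (_ * kapp _ (phi _) k).
rewrite !dynE -!addrA -!opprD -!mulrDr -!intrD; congr (l - e * _%:~R).
by clear f; case: r t rt => [[] []] [[] []].
Qed.

Lemma op_ext v u z phi psi l : dom l -> (forall l', dom l' -> phi l' = psi l') ->
  op v u z phi l = op v u z psi l.
Proof. by move=> dl E; rewrite /op E //; exact: dom_dyn. Qed.

Lemma op_scale v u z phi psi (c : F -> F) l k : dom l ->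
  (forall l', dom l' -> forall k, psi l' k = c l' * phi l' k) ->
  op v u z psi l k = c (dyn u l) * op v u z phi l k.
Proof.
move=> dl E; rewrite /op /kapp mulr_sumr; apply: eq_bigr => j _.
by rewrite E; [rewrite mulrCA|exact: dom_dyn].
Qed.

(** The RLL relation gives this up to the factor theta(z - w - e). *)
Lemma op_BB z w phi l : dom l -> op true false z (op true false w phi) l =
  op true false w (op true false z phi) l.
Proof.
move=> dl; apply/funext => k; apply/eqP; rewrite -subr_eq0; apply/eqP; move: z.
apply: (reg_eq0 (c := w + e)).
  apply: regD.
    by apply: reg_sum => j; apply: regM; [exact: reg_T|exact: reg_cst].
  have -> : (fun z => - op true false w (op true false z phi) l k) =
      (fun z => \sum_j (- T true false w l k j) * op true false z phi (dyn false l) j).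
    apply/funext => z; rewrite {1}/op /kapp -sumrN; by apply: eq_bigr => j _; rewrite mulNr.
  apply: reg_sum => j; apply: regM; first exact: reg_cst.
  apply: reg_sum => i; apply: regM; last exact: reg_cst.
  by apply: reg_T; exact: dom_dyn.
move=> z zw; have := op_RLL (true, true) (false, false) z w phi k dl.
rewrite !sum_bool2 /= !(mul0r, addr0, add0r) opprD addrA in zw * => /(mulfI zw) ->.
by rewrite subrr.
Qed.

(** Used at points z where the eigenvalue of a vanishes, so that the first
    term on the right drops out. *)
Lemma op_BA z w phi l k : dom l ->
  th (z - w - e) * op true false z (op true true w phi) l k =
  - (th (l + (z - w)) * th e / th l) * op true false w (op true true z phi) l k
  + th (l - e) * th (z - w) / th l * op true true w (op true false z phi) l k.
Proof.
move=> dl; have := op_RLL (true, true) (false, true) z w phi k dl.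
by rewrite !sum_bool2 /= !(mul0r, addr0, add0r).
Qed.

Lemma op_AC z w phi l k (l' := l - e * (wt k)%:~R) : dom l ->
  th (l' + e) * th (z - w) * op true true z (op false true w phi) l k =
  th (l' + (z - w)) * th e * op false true z (op true true w phi) l k
  + th l' * th (z - w - e) * op false true w (op true true z phi) l k.
Proof.
move=> dl; have := op_RLL (true, false) (true, true) z w phi k dl.
have l0 : th l' != 0 by apply: dom_neq0; exact: dom_shiftN dl.
rewrite !sum_bool2 /= !(mul0r, addr0, add0r) -/l' => E.
rewrite -[th l' * _ * _]mulrA -E; field; exact: l0.
Qed.

(** At z - w = e the RLL relation expresses the determinant a d - c b by
    products in the opposite order. *)
Lemma op_det w phi l k (l' := l - e * (wt k)%:~R) : dom l ->
  th (l' + e) * delta w * phi l k =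
  th (l + e) * op false false w (op true true (w + e) phi) l k
  - th (l - e) * op false true w (op true false (w + e) phi) l k.
Proof.
move=> dl; have := op_RLL (true, false) (true, false) (w + e) w phi k dl.
have l0 : th l' != 0 by apply: dom_neq0; exact: dom_shiftN dl.
have l1 : th l != 0 by exact: dom_neq0 dl.
have e0 : th e != 0 by have := gen_e (oner_neq0 _); rewrite mulr1.
have det : op true true (w + e) (op false false w phi) l k
    - op false true (w + e) (op true false w phi) l k = th l' / th l * delta w * phi l k.
  rewrite (op_op (true, false) (true, false)) (op_op (false, true) (true, false)) /kapp -sumrB.
  under eq_bigr do rewrite -mulrBl DT //.
  rewrite (bigD1 k) //= big1 => [|j /negbTE]; last by rewrite eq_sym => ->; rewrite !mul0r.
  by rewrite eqxx /minor /= subr0 mulr1 mul1r addr0 subrK.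
rewrite !sum_bool2 /= !(mul0r, addr0, add0r) -/l' (_ : w + e - w = e); last by ring.
rewrite mulNr -mulrBr det -opprB thN => E.
apply: (mulfI (mulf_neq0 e0 (invr_neq0 l1))).
transitivity (th (l' + e) * th e / th l' * (th l' / th l * delta w * phi l k)).
  by field; rewrite l0 l1.
by rewrite E; field.
Qed.
(** The zeros of the eigenvalue of a(z) on the vector of index m; on S_0 they
    are the - x_i. *)
Definition ypt m i := Y i - e * (m i)%:R.
Definition acoef m z := \prod_i th (z - ypt m i).
Definition up m j : 'I_n -> nat := fun i => (m i + (i == j))%N.

Lemma ypt_up m j i : ypt (up m j) i = if i == j then ypt m i - e else ypt m i.
Proof.
rewrite /ypt /up; case: eqP => _; rewrite ?addn0 // addn1 -natr1; ring.
Qed.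

Lemma acoef_zero m i : acoef m (ypt m i) = 0.
Proof. by rewrite /acoef (bigD1 i) //= subrr th00 mul0r. Qed.

Lemma acoef_D1 m i z : acoef m z = th (z - ypt m i) * \prod_(j | j != i) th (z - ypt m j).
Proof. by rewrite /acoef (bigD1 i). Qed.

Lemma acoef_up m i z :
  acoef (up m i) z = th (z - ypt m i + e) * \prod_(j | j != i) th (z - ypt m j).
Proof.
rewrite (acoef_D1 _ i) ypt_up eqxx opprB addrA; congr (th _ * _); first by ring.
by apply: eq_bigr => j /negbTE ji; rewrite ypt_up ji.
Qed.

Lemma th_gen i i' (j j' : nat) : (i = i' -> j <> j') ->
  th (Y i - e * j%:R - (Y i' - e * j'%:R)) != 0.
Proof.
have E : Y i - e * j%:R - (Y i' - e * j'%:R) = Y i - Y i' + e * (j'%:Z - j%:Z)%:~R.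
  by rewrite intrB -!pmulrn; ring.
rewrite E; have [<- /(_ erefl) jj|ii _] := eqVneq i i'; last exact: gen_Y.
by rewrite subrr add0r; apply: gen_e; rewrite subr_eq0; apply/eqP => -[] /esym.
Qed.

Lemma acoef_neq0 m i (j : nat) : j <> m i -> acoef m (Y i - e * j%:R) != 0.
Proof.
move=> jm; apply/prodf_neq0 => i' _; apply: th_gen => ii'; by rewrite -ii'.
Qed.

Definition raise y phi l k := th l * op true false y phi l k.
Definition vac : F -> I -> F := fun _ k => (k == vacuum)%:R.
Definition words m (r : seq 'I_n) :=
  flatten [seq [seq Y i - e * j%:R | j <- iota 0 (m i)] | i <- r].
(** Since the raising operators commute, increasing m_j by one amounts to
    applying the one at ypt m j (vec_up). *)
Definition vec m := foldr raise vac (words m (enum 'I_n)).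

Lemma raise_ext y phi psi l : dom l -> (forall l', dom l' -> phi l' = psi l') ->
  raise y phi l = raise y psi l.
Proof. by move=> dl E; apply/funext => k; rewrite /raise (op_ext _ _ _ dl E). Qed.

Lemma raiseC y y' phi l : dom l -> raise y (raise y' phi) l = raise y' (raise y phi) l.
Proof.
have R y1 y2 l' k : dom l' -> raise y1 (raise y2 phi) l' k =
    th l' * (th (dyn false l') * op true false y1 (op true false y2 phi) l' k).
  by move=> dl; rewrite {1}/raise (@op_scale _ _ _ (op true false y2 phi) _ th).
by move=> dl; apply/funext => k; rewrite !R // op_BB.
Qed.

Lemma foldr_raise_move s1 y s2 l : dom l ->
  foldr raise vac (s1 ++ y :: s2) l = foldr raise vac (y :: s1 ++ s2) l.
Proof.
elim: s1 l => [|x s1 IH] l dl //=.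
by rewrite (raise_ext x dl IH) /= raiseC.
Qed.

Lemma vec_up m j l : dom l -> vec (up m j) l = raise (ypt m j) (vec m) l.
Proof.
move=> dl; rewrite /vec; have := enum_uniq 'I_n.
have : j \in enum 'I_n by rewrite mem_enum.
case/splitPr => p1 p2; rewrite cat_uniq /= negb_or -!andbA => /and5P[_ j1 _ j2 _].
have W r : j \notin r -> words (up m j) r = words m r.
  move=> jr; congr flatten; apply/eq_in_map => i ir; rewrite /up (_ : i == j = false) ?addn0 //.
  by apply: contraNF jr => /eqP <-.
have wc m' r r' : words m' (r ++ r') = words m' r ++ words m' r'.
  by rewrite /words map_cat flatten_cat.
have wj m' r : words m' (j :: r) = [seq Y j - e * i%:R | i <- iota 0 (m' j)] ++ words m' r by [].
rewrite !wc !wj (W _ j1) (W _ j2) {1}/up eqxx addn1 -addn1 iotaD map_cat /= add0n -catA.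
by rewrite catA foldr_raise_move // /= -catA.
Qed.

Definition size_of m := (\sum_i m i)%N.

Lemma size_up m j : size_of (up m j) = (size_of m).+1.
Proof.
rewrite /size_of /up big_split /= -addn1; congr (_ + _)%N.
by rewrite (bigD1 j) //= eqxx big1 // => i /negbTE ->.
Qed.

Lemma multi_ind (P : ('I_n -> nat) -> Prop) : P (fun=> 0%N) ->
  (forall m j, P m -> P (up m j)) -> forall m, P m.
Proof.
move=> P0 PS m; move: {2}(size_of m) (erefl (size_of m)) => s; elim: s m => [|s IH] m sm.
  suff -> : m = fun=> 0%N by [].
  apply/funext => i; apply/eqP; rewrite -leqn0 -sm /size_of (bigD1 i) //; exact: leq_addr.
have [j mj|m0] := pickP (fun j => (0 < m j)%N); last first.
  by move: sm; rewrite /size_of big1 // => i _; have := m0 i; case: (m i).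
have mE : m = up (fun i => m i - (i == j))%N j.
  by apply/funext => i; rewrite /up; case: eqP => [->|_]; rewrite ?subn0 ?addn0 // subnK.
by rewrite mE; apply/PS/IH; move: sm; rewrite {1}mE size_up => -[].
Qed.

Lemma vec0 l k : vec (fun=> 0%N) l k = (k == vacuum)%:R.
Proof.
rewrite /vec; suff -> : words (fun=> 0%N) (enum 'I_n) = [::] by [].
by rewrite /words; elim: (enum _).
Qed.

(** For v_m of eigenvalue vanishing at y = ypt m j, the relation of b(y) and
    a(w) loses the term with a(y), and reads: a(w) acts on b(y) v_m by the
    eigenvalue for m times th (w - y + e) / th (w - y). This is the eigenvalue
    for up m j. *)
Lemma op_a_vec m z l k : dom l -> op true true z (vec m) l k = acoef m z * vec m l k.
Proof.
move: l k z; elim/multi_ind: m => [|m j IH] l k z dl.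
  rewrite /op /kapp (bigD1 vacuum) //= big1 => [|k' /negbTE kv]; last by rewrite vec0 kv mulr0.
  rewrite !vec0 eqxx mulr1 addr0 T_vac // mulrC; congr (_ * _).
  by rewrite /acoef; apply: eq_bigr => i _; rewrite /ypt mulr0 subr0.
apply/eqP; rewrite -subr_eq0; apply/eqP; move: z.
apply: (reg_eq0 (c := ypt m j)).
  apply: regD; first by apply: reg_sum => i; apply: regM; [exact: reg_T|exact: reg_cst].
  have -> : (fun z => - (acoef (up m j) z * vec (up m j) l k)) =
      (fun z => acoef (up m j) z * - vec (up m j) l k) by apply/funext => z; rewrite mulrN.
  by apply: regM; [apply: reg_prod => i; exact: reg_th|exact: reg_cst].
move=> w yw; set y := ypt m j in yw *.
have l0 : th l != 0 by exact: dom_neq0 dl.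
have -> : op true true w (vec (up m j)) l k = th (l - e) * op true true w (op true false y (vec m)) l k.
  rewrite (@op_scale _ _ _ (op true false y (vec m)) _ th) // => l' dl' k'.
  by rewrite vec_up.
have := op_BA y w (vec m) k dl.
rewrite (@op_scale _ _ _ (vec m) _ (fun=> acoef m w)) //; last by move=> *; exact: IH.
rewrite (@op_scale _ _ w (vec m) _ (fun=> acoef m y)) //; last by move=> *; exact: IH.
rewrite acoef_zero mul0r mulr0 add0r vec_up // /raise -/y => E.
apply: (mulfI yw); rewrite mulr0 acoef_up -/y.
have -> : th (w - y + e) = - th (y - w - e) by rewrite -thN; congr th; ring.
move: E; rewrite (acoef_D1 m j) -/y; set P := \prod_(_ | _) _.
set X := op _ _ _ (op _ _ _ _) _ _; set B := op _ _ _ _ _ _ => E.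
have {}E : th (y - w) * (th (l - e) * X) = th l * (th (y - w - e) * (th (w - y) * P * B)).
  by rewrite E; field.
have yN : th (w - y) = - th (y - w) by rewrite -thN; congr th; ring.
by rewrite yN mulNr mulrBr E yN; ring.
Qed.
Lemma domD l : dom l -> dom (l + e).
Proof. by move=> /(dom_shift 1); rewrite mulr1. Qed.

Definition bounded m := forall i, (m i <= Lam i)%N.

Lemma delta_neq0 m i : (m i < Lam i)%N -> delta (ypt m i - e) != 0.
Proof.
move=> mi; apply/prodf_neq0 => j _.
have E : ypt m i - e = Y i - e * (m i).+1%:R by rewrite /ypt -natr1; ring.
rewrite E mulf_neq0 //.
  by have := @th_gen i j (m i).+1 0; rewrite mulr0 subr0; apply.
have E2 : Y i - e * (m i).+1%:R - Y j + e * (Lam j).+1%:R =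
    Y i - Y j + e * ((Lam j).+1%:Z - (m i).+1%:Z)%:~R by rewrite intrB -!pmulrn; ring.
rewrite E2; have [<-|ij] := eqVneq i j; last exact: gen_Y.
by rewrite subrr add0r; apply: gen_e; lia.
Qed.

(** Lowering undoes raising: in op_det at w = ypt m j - e the term with a(w +
    e) vanishes on v_m. *)
Lemma op_c_vec m j l k (l' := l - e * (wt k)%:~R) : dom l ->
  op false true (ypt m j - e) (vec (up m j)) l k =
  - (th (l' + e) * delta (ypt m j - e)) * vec m l k.
Proof.
move=> dl; rewrite (@op_scale _ _ _ (op true false (ypt m j) (vec m)) _ th) //; last first.
  by move=> l1 dl1 k'; rewrite vec_up.
have := op_det (ypt m j - e) (vec m) k dl; rewrite subrK -/l' mulNr => ->.
rewrite (@op_scale false false _ (vec m) (op true true (ypt m j) (vec m)) (fun=> 0)) //; last first.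
  by move=> l1 dl1 k'; rewrite op_a_vec // acoef_zero.
by rewrite mul0r mulr0 sub0r opprK.
Qed.

(** Lowering step by step leads from v_m back to a nonzero multiple of v_0. *)
Lemma vec_neq0 m l : bounded m -> dom l -> exists k, vec m l k != 0.
Proof.
move: l; elim/multi_ind: m => [|m j IH] l bm dl.
  by exists vacuum; rewrite vec0 eqxx oner_neq0.
have bm' : bounded m by move=> i; apply: leq_trans (bm i); exact: leq_addr.
have mj : (m j < Lam j)%N by have := bm j; rewrite /up eqxx addn1.
have [k vk] := IH (l + e) bm' (domD dl).
have := op_c_vec m j k (domD dl); set c := op _ _ _ _ _ _ => cE.
have : c != 0.
  rewrite cE mulf_neq0 // oppr_eq0 mulf_neq0 ?delta_neq0 //.
  exact: dom_neq0 (domD (dom_shiftN (wt k) (domD dl))).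
rewrite /c /op /kapp => /sum_neq0[k']; rewrite mulf_eq0 negb_or => /andP[_].
by rewrite /dyn_shift addrK => vk'; exists k'.
Qed.

Lemma wt_vec m l k : dom l -> vec m l k != 0 -> wt k = wt vacuum - (size_of m + size_of m)%N%:Z.
Proof.
move: l k; elim/multi_ind: m => [|m j IH] l k dl.
  rewrite vec0; have [->|_] := eqVneq k vacuum; last by rewrite eqxx.
  by move=> _; rewrite /size_of big1 // subr0.
rewrite vec_up // /raise mulf_eq0 negb_or => /andP[_].
rewrite /op /kapp => /sum_neq0[k']; rewrite mulf_eq0 negb_or.
move=> /andP[/cT] /= h /(IH _ _ (dom_dyn false dl)) h'; rewrite size_up.
by move: h h'; rewrite /spinz; lia.
Qed.

Implicit Types (c : I -> F) (p q : I).

Definition vecs p := vec (fun i => p i).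

Lemma bounded_index p : bounded (fun i => p i).
Proof. by move=> i; rewrite -ltnS. Qed.

Lemma index_neq p q : p != q -> exists i, p i != q i :> nat.
Proof.
move=> pq; apply/existsP; apply: contraNT pq => /existsPn pq.
by apply/eqP/ffunP => i; apply/val_inj/eqP; have := pq i; rewrite negbK.
Qed.

(** Eigenvectors with distinct eigenvalues. As a(z) shifts l, it turns a
    relation at l into a relation at l + e; for z a zero of one of the
    eigenvalues involved, this relation has fewer terms. *)
Lemma vec_free c l : dom l -> (forall k, \sum_p c p * vecs p l k = 0) -> forall p, c p = 0.
Proof.
move: {2}(#|[pred p | c p != 0]|) (leqnn #|[pred p | c p != 0]|) => s.
elim: s c l => [|s IH] c l.
  rewrite leqn0 => /eqP/card0_eq c0 _ _ p; apply/eqP; apply: contraT => cp.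
  by have := c0 p; rewrite !inE cp.
move=> cs dl rel; suff : forall p, ~~ (c p != 0) by move=> h p; apply/eqP; rewrite -[_ == _]negbK h.
move=> p; apply/negP => cp.
have [q /andP[qp cq]|no] := pickP (fun q => (q != p) && (c q != 0)); last first.
  have [k vk] := vec_neq0 (bounded_index p) dl.
  have := rel k; rewrite (bigD1 p) //= big1 ?addr0 => [/eqP|q qp].
    by rewrite mulf_eq0 (negbTE cp) (negbTE vk).
  by have := no q; rewrite qp /= => /negbT; rewrite negbK => /eqP ->; rewrite mul0r.
have [i pq] := index_neq qp; pose y := Y i - e * (p i)%:R.
have dl' := domD dl.
suff /eqP : c q * acoef (fun i => q i) y = 0.
  rewrite mulf_eq0 (negbTE cq) /=; apply/negP; apply: acoef_neq0.
  by move=> pqi; rewrite pqi eqxx in pq.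
apply: (IH (fun r => c r * acoef (fun i => r i) y) _ _ dl'); last first.
- move=> k; transitivity (op true true y (fun _ k' => \sum_r c r * vecs r l k') (l + e) k).
    transitivity (\sum_r c r * op true true y (vecs r) (l + e) k).
      by apply: eq_bigr => r _; rewrite op_a_vec // mulrA.
    rewrite /op /kapp; under eq_bigr do rewrite mulr_sumr.
    rewrite exchange_big; apply: eq_bigr => j _ /=; rewrite mulr_sumr.
    by apply: eq_bigr => r _; rewrite /dyn_shift addrK mulrCA.
  by rewrite /op /kapp big1 // => j _; rewrite rel mulr0.
- rewrite -ltnS; apply: leq_trans cs; apply: proper_card; apply/properP; split.
    by apply/fintype.subsetP => r; rewrite !inE; apply: contraNneq => ->; rewrite mul0r.
  by exists p; rewrite !inE ?cp //  negbK (acoef_zero (fun i => p i)) mulr0.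
Qed.

Lemma vec_inj c c' l : dom l ->
  (forall k, \sum_p c p * vecs p l k = \sum_p c' p * vecs p l k) -> forall p, c p = c' p.
Proof.
move=> dl E p; apply/eqP; rewrite -subr_eq0; apply/eqP; move: p.
apply: (vec_free dl) => k; under eq_bigr do rewrite mulrBl.
by rewrite sumrB E subrr.
Qed.

Definition vecs_mx l : 'M[F]_#|I| := \matrix_(i, j) vecs (enum_val i) l (enum_val j).

Lemma vecs_mx_unit l : dom l -> vecs_mx l \in unitmx.
Proof.
move=> dl; rewrite -row_free_unit; apply/inj_row_free => v vM; apply/rowP => i; rewrite mxE.
have := vec_free (c := fun p => v 0 (enum_rank p)) dl.
move=> /(_ _ (enum_val i)); rewrite enum_valK; apply => k.
transitivity ((v *m vecs_mx l) 0 (enum_rank k)); last by rewrite vM mxE.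
rewrite mxE (reindex (@enum_val I xpredT)) /=; last by apply: onW_bij; exact: enum_val_bij.
by apply: eq_bigr => j _; rewrite mxE enum_valK enum_rankK.
Qed.

Definition coord l (f : I -> F) p := ((\row_j f (enum_val j)) *m invmx (vecs_mx l)) 0 (enum_rank p).

Lemma coordE l f k : dom l -> f k = \sum_p coord l f p * vecs p l k.
Proof.
move=> /vecs_mx_unit Mu.
have : (\row_j f (enum_val j) *m invmx (vecs_mx l) *m vecs_mx l) 0 (enum_rank k) = f k.
  by rewrite mulmxKV // mxE enum_rankK.
rewrite mxE => <-; rewrite [RHS](reindex (@enum_val I xpredT)) /=; last first.
  by apply: onW_bij; exact: enum_val_bij.
by apply: eq_bigr => j _; rewrite [X in _ * X]mxE /coord enum_valK enum_rankK.
Qed.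

(** The v_m are weight vectors, so the terms of another weight sum to zero. *)
Lemma coord_weight (s : int) f c l p : dom l -> (forall k, f k != 0 -> wt k = s) ->
  (forall k, f k = \sum_q c q * vecs q l k) -> c p != 0 ->
  wt vacuum - (size_of (fun i => p i) + size_of (fun i => p i))%N%:Z = s.
Proof.
move=> dl fs fc; pose w q := wt vacuum - (size_of (fun i => q i) + size_of (fun i => q i))%N%:Z.
have [//|ps] := eqVneq (w p) s.
have : (fun q => if w q == s then 0 else c q) p = 0.
  apply: (@vec_free (fun q => if w q == s then 0 else c q) l dl _ p) => k; have [ks|ks] := eqVneq (wt k) s.
    apply: big1 => q _; case: ifP => qs; first by rewrite mul0r.
    have [->|/(wt_vec dl) wk] := eqVneq (vecs q l k) 0; first by rewrite mulr0.
    by move: qs; rewrite /w -wk ks eqxx.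
  transitivity (f k); last by apply/eqP; apply: contraTT ks => /fs ->; rewrite negbK.
  rewrite fc; apply: eq_bigr => q _; case: ifP => qs //; rewrite mul0r.
  have [->|/(wt_vec dl) wk] := eqVneq (vecs q l k) 0; first by rewrite mulr0.
  by move: ks; rewrite wk -/(w q) qs.
by rewrite (negbTE ps) => ->; rewrite eqxx.
Qed.

(** * Matrix elements in the eigenbasis *)

Local Notation nv p := (fun i => nat_of_ord (p i)).
Definition is_up p q j := [forall i, q i == up (nv p) j i :> nat].

Lemma is_upP p q j : reflect (nv q = up (nv p) j) (is_up p q j).
Proof.
apply: (iffP forallP) => [pq|pq i]; first by apply/funext => i; apply/eqP.
by rewrite -[X in X == _]/(nv q i) pq.
Qed.

Lemma is_up_inj p q j j' : is_up p q j -> is_up p q j' -> j = j'.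
Proof.
move=> /forallP/(_ j) pj /forallP/(_ j); rewrite (eqP pj) /up eqxx addn1.
by have [//|_] := eqVneq j j'; rewrite addn0 eqn_leq ltnn.
Qed.

Lemma is_up_uniq p q q' j : is_up p q j -> is_up p q' j -> q = q'.
Proof.
move=> /forallP pq /forallP pq'; apply/ffunP => i; apply/val_inj.
by rewrite /= (eqP (pq i)) (eqP (pq' i)).
Qed.

Lemma is_down_uniq p q q' j : is_up q p j -> is_up q' p j -> q = q'.
Proof.
move=> /forallP pq /forallP pq'; apply/ffunP => i; apply/val_inj/eqP.
have := eqP (pq' i); rewrite (eqP (pq i)) /up => /eqP; by rewrite eqn_add2r.
Qed.

Lemma up_exists p j : (p j < Lam j)%N -> exists q, is_up p q j.
Proof.
move=> pj; exists [ffun i => inord (up (nv p) j i)]; apply/forallP => i.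
rewrite ffunE inordK // ltnS /up; have [->|_] := eqVneq i j; first by rewrite addn1.
by rewrite addn0 -ltnS.
Qed.

Lemma down_exists p j : (0 < p j)%N -> exists q, is_up q p j.
Proof.
move=> pj; exists [ffun i => inord (p i - (i == j))]; apply/forallP => i.
rewrite /up ffunE inordK; last by apply: leq_ltn_trans (leq_subr _ _) _.
by have [->|_] := eqVneq i j; rewrite ?subn0 ?addn0 // subnK.
Qed.

Lemma sum_up p q (j : 'I_n) (f : 'I_n -> F) : is_up p q j ->
  \sum_i (is_up p q i)%:R * f i = f j.
Proof.
move=> pq; rewrite (bigD1 j) //= pq mul1r big1 ?addr0 // => i ij.
case pqi : (is_up p q i); last by rewrite mul0r.
by rewrite (is_up_inj pq pqi) eqxx in ij.
Qed.

Lemma coords (f : F -> I -> F) : exists beta : F -> I -> F, forall l, dom l ->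
  forall k, f l k = \sum_q beta l q * vecs q l k.
Proof. by exists (fun l => coord l (f l)) => l dl k; exact: coordE. Qed.

Lemma op_weight v u z p l k : dom l -> op v u z (vecs p) l k != 0 ->
  spinz v + wt k = spinz u + (wt vacuum - (size_of (nv p) + size_of (nv p))%N%:Z).
Proof.
move=> dl; rewrite /op /kapp => /sum_neq0[k']; rewrite mulf_eq0 negb_or => /andP[/cT ->].
by move=> /wt_vec ->//; exact: dom_dyn.
Qed.

Lemma coords_size v u z p beta l q : dom l ->
  (forall k, op v u z (vecs p) l k = \sum_q beta q * vecs q l k) -> beta q != 0 ->
  (size_of (nv q) + ~~ v = size_of (nv p) + ~~ u)%N.
Proof.
move=> dl E bq; pose s := spinz u - spinz v + (wt vacuum - (size_of (nv p) + size_of (nv p))%N%:Z).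
have hs k : op v u z (vecs p) l k != 0 -> wt k = s.
  by move=> /(op_weight dl) h; rewrite /s -addrA [- _ + _]addrC addrA -h addrAC subrr add0r.
have := coord_weight dl hs E bq; rewrite /s => h.
by clear hs E; move: h; case: v u {s} => [] [] /=; rewrite /spinz; lia.
Qed.

Lemma op_a_coords (beta : F -> I -> F) f l z k : dom l ->
  (forall l, dom l -> forall k, f l k = \sum_q beta l q * vecs q l k) ->
  op true true z f l k = \sum_q (beta (l - e) q * acoef (nv q) z) * vecs q l k.
Proof.
move=> dl E; transitivity (\sum_q beta (l - e) q * op true true z (vecs q) l k).
  rewrite /op /kapp; under eq_bigr do (rewrite E; last exact: dom_dyn).
  under eq_bigr do rewrite mulr_sumr.
  rewrite exchange_big; apply: eq_bigr => q _ /=; rewrite mulr_sumr.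
  by apply: eq_bigr => j _; rewrite mulrCA.
by apply: eq_bigr => q _; rewrite op_a_vec // mulrA.
Qed.

Lemma th_ypt m i j : i != j -> th (ypt m i - ypt m j) != 0.
Proof. by move=> /eqP ij; apply: th_gen => /ij. Qed.

Lemma acoef_ypt_neq0 p q i : p i <> q i :> nat -> acoef (nv q) (ypt (nv p) i) != 0.
Proof. exact: acoef_neq0. Qed.

Section RaisingElements.
Variables (p : I) (z : F) (beta : F -> I -> F).
Hypothesis E : forall l, dom l -> forall k, op true false z (vecs p) l k = \sum_q beta l q * vecs q l k.

(** The relation op_BA at a zero y_j of the eigenvalue for p compares b(z) v_p
    with b(y_j) v_p, which is a basis vector unless p_j = Lam_j. *)
Lemma op_B_coords j l k : dom l ->
  \sum_q (th (l - e) * th (z - ypt (nv p) j) * beta (l - e) q * acoef (nv q) (ypt (nv p) j))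
      * vecs q l k =
  th (l + (z - ypt (nv p) j)) * th e * acoef (nv p) z * op true false (ypt (nv p) j) (vecs p) l k.
Proof.
move=> dl; set y := ypt _ j; have l0 := dom_neq0 dl.
have := op_BA z y (vecs p) k dl.
rewrite (@op_scale _ _ _ (vecs p) _ (fun=> acoef (nv p) y)) //; last by move=> *; exact: op_a_vec.
rewrite (@op_scale _ _ y (vecs p) _ (fun=> acoef (nv p) z)) //; last by move=> *; exact: op_a_vec.
rewrite acoef_zero mul0r mulr0 (op_a_coords _ _ dl E) => h.
transitivity (th l * (th (l - e) * th (z - y) / th l *
   \sum_q (beta (l - e) q * acoef (nv q) y) * vecs q l k)).
  transitivity (th (l - e) * th (z - y) * \sum_q (beta (l - e) q * acoef (nv q) y) * vecs q l k).
    by rewrite mulr_sumr; apply: eq_bigr => q _; rewrite !mulrA.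
  by field.
move/eqP: h; rewrite eq_sym addrC addr_eq0 => /eqP ->.
by field.
Qed.
End RaisingElements.

(** An index q occurring in b(y_j) v_p has total size one more than p, and by
    op_B_coords at the other zeros it agrees with p off j. Hence q_j = Lam_j +
    1, which is out of range. *)
Lemma op_B_top p j l k : p j = Lam j :> nat -> dom l ->
  op true false (ypt (nv p) j) (vecs p) l k = 0.
Proof.
move=> pj dl; have [beta E] := coords (op true false (ypt (nv p) j) (vecs p)).
rewrite E // big1 // => q _; suff -> : beta l q = 0 by rewrite mul0r.
apply/eqP; apply: contraT => bq; have := coords_size dl (E l dl) bq; rewrite addn0 addn1 => sq.
have same i : i != j -> q i = p i :> nat.
  move=> ij; have ji : j != i by rewrite eq_sym.
  apply/eqP; apply: contraT => /eqP qp.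
  have /eqP : th l * th (ypt (nv p) j - ypt (nv p) i) * beta l q * acoef (nv q) (ypt (nv p) i) = 0.
    apply: (@vec_free (fun q => th l * th (ypt (nv p) j - ypt (nv p) i) * beta l q *
      acoef (nv q) (ypt (nv p) i)) _ (domD dl) _ q) => k'.
    by have := op_B_coords E i k' (domD dl); rewrite addrK acoef_zero mulr0 mul0r.
  rewrite !mulf_eq0 (negbTE bq) (negbTE (dom_neq0 dl)) (negbTE (th_ypt _ ji)) /=.
  by rewrite (negbTE (acoef_ypt_neq0 (nesym qp))).
have := sq; rewrite /size_of (bigD1 j) //= [in RHS](bigD1 j) //= -addSn.
rewrite (eq_bigr (nv p)) => [|i /same->//] /eqP; rewrite eqn_add2r pj => /eqP qj.
by have := ltn_ord (q j); rewrite qj ltnn.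
Qed.

Lemma op_B_at p j l k : dom l ->
  op true false (ypt (nv p) j) (vecs p) l k = (th l)^-1 * \sum_q (is_up p q j)%:R * vecs q l k.
Proof.
move=> dl; have l0 := dom_neq0 dl; have := ltn_ord (p j); rewrite ltnS leq_eqVlt.
case/predU1P => [pj|/up_exists[q pq]].
  rewrite op_B_top // big1 ?mulr0 // => q _; case pq : (is_up p q j); last by rewrite mul0r.
  move/forallP: pq => /(_ j); rewrite /up eqxx addn1 pj => /eqP qj.
  by have := ltn_ord (q j); rewrite qj ltnn.
rewrite (bigD1 q) //= pq mul1r big1 ?addr0 => [|q' qq]; last first.
  case pq' : (is_up p q' j); last by rewrite mul0r.
  by rewrite (is_up_uniq pq pq') eqxx in qq.
by rewrite /vecs (is_upP _ _ _ pq) vec_up // /raise mulKf.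
Qed.

Definition raising_elt p j z l := th (l + e + z - ypt (nv p) j) / (th l * th (l + e)) *
  \prod_(i | i != j) (th (z - ypt (nv p) i) / th (ypt (nv p) j - ypt (nv p) i)).

(** If q is not a neighbour of p, some zero y_j of the eigenvalue for p is not
    a zero of the one for q, and op_B_coords at y_j shows that q does not
    occur. For a neighbour, op_B_coords at the zero that has moved gives the
    coefficient. *)
Lemma op_B_vec p z l k : (forall i, th (z - ypt (nv p) i) != 0) -> dom l ->
  op true false z (vecs p) l k =
  \sum_q (\sum_j (is_up p q j)%:R * raising_elt p j z l) * vecs q l k.
Proof.
move=> gz dl; have [beta E] := coords (op true false z (vecs p)).
rewrite E //; apply: eq_bigr => q _; congr (_ * _).
have dl' := domD dl; have l0 := dom_neq0 dl; have l1 := dom_neq0 dl'.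
have key j q' : th l * th (z - ypt (nv p) j) * beta l q' * acoef (nv q') (ypt (nv p) j) =
    th (l + e + (z - ypt (nv p) j)) * th e * acoef (nv p) z * ((th (l + e))^-1 * (is_up p q' j)%:R).
  move: q'; apply: (vec_inj dl') => k'; have := op_B_coords E j k' dl'; rewrite addrK => ->.
  rewrite op_B_at // mulr_sumr mulr_sumr; apply: eq_bigr => i _; by rewrite !mulrA.
have [j pq|no] := pickP (is_up p q).
  rewrite (sum_up _ pq); have := key j q; rewrite pq mulr1 (is_upP _ _ _ pq) acoef_up subrr add0r.
  rewrite (acoef_D1 _ j) /raising_elt prodf_div; have := gz j.
  have : \prod_(i | i != j) th (ypt (nv p) j - ypt (nv p) i) != 0.
    by apply/prodf_neq0 => i ij; apply: th_ypt; rewrite eq_sym.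
  have : th e != 0 by have := gen_e (oner_neq0 _); rewrite mulr1.
  rewrite -[l + e + z - _]addrA; move: (th (l + e + _)) (\prod_(i | _) _) (\prod_(i | _) _).
  move: (th (z - _)) => zy; move=> a P Q e0 Q0 zy0 h.
  apply: (mulfI (_ : th l * zy * (th e * Q) != 0)); first by rewrite !mulf_neq0.
  by rewrite mulrAC h; field; rewrite l0 l1 Q0.
rewrite big1 => [|j _]; last by rewrite no mul0r.
apply/eqP; apply: contraT => bq; have := coords_size dl (E l dl) bq; rewrite addn0 addn1 => sq.
have [j pqj] : exists j, p j != q j :> nat.
  by apply: index_neq; apply/eqP => pq; move: sq; rewrite pq => h; lia.
have /eqP := key j q; rewrite no !mulr0 !mulf_eq0 (negbTE bq) (negbTE l0) (negbTE (gz j)) /=.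
by rewrite (negbTE (acoef_ypt_neq0 (elimN eqP pqj))).
Qed.
(** The argument l shifted by the weight of c(w) v_p. *)
Definition dyn_lower p l := l - e * (wt vacuum - (size_of (nv p) + size_of (nv p))%N%:Z + 2)%:~R.

Lemma dom_lower p l : dom l -> dom (dyn_lower p l).
Proof. exact: dom_shiftN. Qed.

Section LoweringElements.
Variables (p : I) (w : F) (gam : F -> I -> F).
Hypothesis E : forall l, dom l -> forall k, op false true w (vecs p) l k = \sum_q gam l q * vecs q l k.

(** The analogue of op_B_coords, from the relation between a(y_j) and c(w). As
    this relation involves the weight of the component k, the components of
    other weights are dealt with separately. *)
Lemma op_C_coords j l k : dom l ->
  \sum_q (th (dyn_lower p l + e) * th (ypt (nv p) j - w) * gam (l - e) q
      * acoef (nv q) (ypt (nv p) j)) * vecs q l k =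
  th (dyn_lower p l + (ypt (nv p) j - w)) * th e * acoef (nv p) w
    * op false true (ypt (nv p) j) (vecs p) l k.
Proof.
move=> dl; set y := ypt _ j.
have [kw|kw] := eqVneq (wt k) (wt vacuum - (size_of (nv p) + size_of (nv p))%N%:Z + 2).
  have := op_AC y w (vecs p) k dl; rewrite kw -/(dyn_lower p l).
  rewrite (@op_scale false true y (vecs p) (op true true w (vecs p)) (fun=> acoef (nv p) w)) //; last by move=> *; exact: op_a_vec.
  rewrite (@op_scale false true w (vecs p) (op true true y (vecs p)) (fun=> acoef (nv p) y)) //; last by move=> *; exact: op_a_vec.
  rewrite acoef_zero mul0r mulr0 addr0 (op_a_coords _ _ dl E) mulrA => <-.
  by rewrite mulr_sumr; apply: eq_bigr => q _; rewrite !mulrA.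
have -> : op false true y (vecs p) l k = 0.
  apply/eqP; apply: contraNT kw => /(op_weight dl); rewrite /spinz => h; apply/eqP; lia.
rewrite mulr0 big1 // => q _.
have [->|vq] := eqVneq (vecs q l k) 0; first by rewrite mulr0.
have dl' : dom (l - e) by have := dom_dyn true dl.
have [->|gq] := eqVneq (gam (l - e) q) 0; first by rewrite mulr0 !mul0r.
have := coords_size dl' (E dl') gq; have := wt_vec dl vq.
by move=> h1 h2; case/eqP: kw; rewrite h1; move: h2; rewrite addn1 addn0; lia.
Qed.
End LoweringElements.

Lemma op_C_bottom p j l k : p j = 0%N :> nat -> dom l ->
  op false true (ypt (nv p) j) (vecs p) l k = 0.
Proof.
move=> pj dl; have [gam E] := coords (op false true (ypt (nv p) j) (vecs p)).
rewrite E // big1 // => q _; suff -> : gam l q = 0 by rewrite mul0r.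
apply/eqP; apply: contraT => bq; have := coords_size dl (E l dl) bq; rewrite addn0 addn1 => sq.
have same i : i != j -> q i = p i :> nat.
  move=> ij; apply/eqP; apply: contraT => /eqP qp.
  have L0 := dom_neq0 (domD (dom_lower p (domD dl))).
  have /eqP : th (dyn_lower p (l + e) + e) * th (ypt (nv p) i - ypt (nv p) j) * gam l q
      * acoef (nv q) (ypt (nv p) i) = 0.
    apply: (@vec_free (fun q => th (dyn_lower p (l + e) + e) * th (ypt (nv p) i - ypt (nv p) j)
      * gam l q * acoef (nv q) (ypt (nv p) i)) _ (domD dl) _ q) => k'.
    by have := op_C_coords E i k' (domD dl); rewrite addrK acoef_zero mulr0 mul0r.
  rewrite !mulf_eq0 (negbTE bq) (negbTE L0) (negbTE (th_ypt _ ij)) /=.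
  by rewrite (negbTE (acoef_ypt_neq0 (nesym qp))).
have := sq; rewrite /size_of (bigD1 j) //= [in RHS](bigD1 j) //= -addSn.
by rewrite (eq_bigr (nv p)) => [|i /same->//] /eqP; rewrite eqn_add2r pj.
Qed.

Lemma op_C_at p j l k : dom l -> op false true (ypt (nv p) j) (vecs p) l k =
  - (th (dyn_lower p l + e) * delta (ypt (nv p) j)) * \sum_q (is_up q p j)%:R * vecs q l k.
Proof.
move=> dl; have [pj|/down_exists[q qp]] := posnP (p j).
  rewrite op_C_bottom // big1 ?mulr0 // => q _; case qp : (is_up q p j); last by rewrite mul0r.
  by move/forallP: qp => /(_ j); rewrite /up eqxx addn1 pj.
rewrite (bigD1 q) //= qp mul1r big1 ?addr0 => [|q' qq]; last first.
  case qp' : (is_up q' p j); last by rewrite mul0r.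
  by rewrite (is_down_uniq qp qp') eqxx in qq.
have yE : ypt (nv p) j = ypt (nv q) j - e by rewrite (is_upP _ _ _ qp) ypt_up eqxx.
rewrite {1}/vecs yE (is_upP _ _ _ qp) op_c_vec // -/(vecs q).
have [->|vk] := eqVneq (vecs q l k) 0; first by rewrite !mulr0.
congr (- (th (l - e * _%:~R + e) * _) * _).
by rewrite (wt_vec dl vk) (is_upP _ _ _ qp) size_up; lia.
Qed.

(** Expressed through the index q of the lowered vector; the corresponding
    zero for p is ypt (nv q) j - e. *)
Definition lowering_elt q j z l :=
  - th (l - e * (wt vacuum - (size_of (nv q) + size_of (nv q))%N%:Z)%:~R + ypt (nv q) j - z) *
  \prod_(i | i != j) (th (z - ypt (nv q) i) / th (ypt (nv q) j - e - ypt (nv q) i))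
  * delta (ypt (nv q) j - e).

Lemma op_C_vec p w l k : (forall i, th (w - ypt (nv p) i) != 0) -> dom l ->
  op false true w (vecs p) l k =
  \sum_q (\sum_j (is_up q p j)%:R * lowering_elt q j w l) * vecs q l k.
Proof.
move=> gw dl; have [gam E] := coords (op false true w (vecs p)).
rewrite E //; apply: eq_bigr => q _; congr (_ * _).
have dl' := domD dl; have L0 := dom_neq0 (domD (dom_lower p dl')).
have gw' i : th (ypt (nv p) i - w) != 0 by rewrite -opprB thN oppr_eq0.
have key j q' : th (dyn_lower p (l + e) + e) * th (ypt (nv p) j - w) * gam l q'
     * acoef (nv q') (ypt (nv p) j) =
    th (dyn_lower p (l + e) + (ypt (nv p) j - w)) * th e * acoef (nv p) w
    * (- (th (dyn_lower p (l + e) + e) * delta (ypt (nv p) j)) * (is_up q' p j)%:R).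
  move: q'; apply: (vec_inj dl') => k'; have := op_C_coords E j k' dl'; rewrite addrK => ->.
  rewrite op_C_at // mulr_sumr mulr_sumr; apply: eq_bigr => i _; by rewrite !mulrA.
have [j qp|no] := pickP (is_up q p); last first.
  rewrite big1 => [|j _]; last by rewrite no mul0r.
  apply/eqP; apply: contraT => bq; have := coords_size dl (E l dl) bq; rewrite addn0 addn1 => sq.
  have [j pqj] : exists j, p j != q j :> nat.
    by apply: index_neq; apply/eqP => pq; move: sq; rewrite pq => h; lia.
  have /eqP := key j q; rewrite no !mulr0 !mulf_eq0 (negbTE bq) (negbTE L0) (negbTE (gw' j)) /=.
  by rewrite (negbTE (acoef_ypt_neq0 (elimN eqP pqj))).
have sum1 (f : 'I_n -> F) : \sum_i (is_up q p i)%:R * f i = f j by exact: sum_up.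
have nqp := is_upP _ _ _ qp; have yp i : ypt (nv p) i = if i == j then ypt (nv q) i - e else ypt (nv q) i.
  by rewrite nqp ypt_up.
rewrite sum1; have := key j q; rewrite qp mulr1 nqp acoef_up (acoef_D1 (nv q) j) ypt_up eqxx.
have -> : dyn_lower p (l + e) + (ypt (nv q) j - e - w) =
   l - e * (wt vacuum - (size_of (nv q) + size_of (nv q))%N%:Z)%:~R + ypt (nv q) j - w.
  rewrite /dyn_lower nqp size_up.
  have -> : wt vacuum - ((size_of (nv q)).+1 + (size_of (nv q)).+1)%N%:Z + 2 =
     wt vacuum - (size_of (nv q) + size_of (nv q))%N%:Z by lia.
  by ring.
rewrite /lowering_elt prodf_div; have := gw' j; rewrite yp eqxx.
have : \prod_(i | i != j) th (ypt (nv q) j - e - ypt (nv q) i) != 0.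
  apply/prodf_neq0 => i ij; rewrite (_ : ypt (nv q) j - e = Y j - e * (q j).+1%:R).
    by apply: th_gen => ji; rewrite ji eqxx in ij.
  by rewrite /ypt -natr1; ring.
have e0 : th e != 0 by have := gen_e (oner_neq0 _); rewrite mulr1.
have -> : th (ypt (nv q) j - e - ypt (nv q) j) = - th e by rewrite -thN; congr th; ring.
have -> : th (w - ypt (nv q) j + e) = - th (ypt (nv q) j - e - w) by rewrite -thN; congr th; ring.
move: (th (ypt (nv q) j - e - w)) (th (l - _ + _ - w)) (delta _) L0 => yw a d L0.
move: (\prod_(i | _) _) => Q; move: (\prod_(i | _) _) => P Q0 yw0 h.
move: h; move: (th (dyn_lower _ _ + e)) L0 => D D0 h.
apply: (mulfI (_ : D * yw * (- th e * Q) != 0)); first by rewrite !mulf_neq0 ?oppr_eq0.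
by rewrite mulrAC h; field.
Qed.

(** * Rescaling of the eigenbasis *)

Definition Delta_p y := \prod_i th (y - Y i).
Definition Delta_m y := \prod_i th (y - Y i + e * (Lam i)%:R).

Definition vandermonde m := \prod_(a < n) \prod_(b < n | (a < b)%N) th (ypt m b - ypt m a).
Definition gauge_num m := (-1) ^+ (n * size_of m) * vandermonde m
  / \prod_i \prod_(r < m i) Delta_p (Y i - e * r.+1%:R).
(** A solution of the two recursions gauge_shift and gauge_up, which say that
    rescaling by it takes the matrix elements of a(z) and b(z) to the
    coefficients of the difference operators. *)
Definition gauge m l := gauge_num m / \prod_(r < size_of m) th (l + e * r.+1%:R).

Lemma dom_nat l (r : nat) : dom l -> th (l + e * r%:R) != 0.
Proof. by move=> /(_ r%:Z); rewrite -pmulrn. Qed.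

Lemma Delta_p_neq0 i (r : nat) : Delta_p (Y i - e * r.+1%:R) != 0.
Proof.
apply/prodf_neq0 => j _; have := @th_gen i j r.+1 0; rewrite mulr0 subr0; exact.
Qed.

Lemma ypt_sub m i : ypt m i - e = Y i - e * (m i).+1%:R.
Proof. by rewrite /ypt -natr1; ring. Qed.

Lemma vandermonde_neq0 m : vandermonde m != 0.
Proof.
apply/prodf_neq0 => a _; apply/prodf_neq0 => b ab; apply: th_ypt.
by rewrite neq_ltn ab orbT.
Qed.

Lemma gauge_num_neq0 m : gauge_num m != 0.
Proof.
rewrite /gauge_num !mulf_neq0 ?vandermonde_neq0 ?signr_eq0 // invr_neq0 //.
apply/prodf_neq0 => i _; apply/prodf_neq0 => r _; exact: Delta_p_neq0.
Qed.

Lemma gauge_neq0 m l : dom l -> gauge m l != 0.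
Proof.
move=> dl; rewrite mulf_neq0 ?gauge_num_neq0 // invr_neq0 //.
by apply/prodf_neq0 => r _; exact: dom_nat.
Qed.

Lemma gauge_shift m l : dom l ->
  gauge m (l - e) * th l = gauge m l * th (l + e * (size_of m)%:R).
Proof.
move=> dl; rewrite /gauge; move: (gauge_num m) (size_of m) => N s.
suff : th l * \prod_(r < s) th (l + e * r.+1%:R) =
       th (l + e * s%:R) * \prod_(r < s) th (l - e + e * r.+1%:R).
  have P0 : \prod_(r < s) th (l + e * r.+1%:R) != 0.
    by apply/prodf_neq0 => r _; exact: dom_nat.
  have Q0 : \prod_(r < s) th (l - e + e * r.+1%:R) != 0.
    apply/prodf_neq0 => r _; rewrite -natr1 mulrDr mulr1 addrACA addNr addr0; exact: dom_nat.
  move: (\prod_(r < s) _) (\prod_(r < s) _) P0 Q0 => P Q Q0 P0 h.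
  by transitivity (N * (th l * Q) / (Q * P)); [|rewrite h]; field; rewrite P0 Q0.
transitivity (\prod_(r < s.+1) th (l + e * r%:R)).
  by rewrite big_ord_recl mulr0 addr0.
rewrite big_ord_recr /= mulrC; congr (_ * _); apply: eq_bigr => r _; congr th.
by rewrite -natr1; ring.
Qed.

(** Only the factors of the Vandermonde product that involve j change. *)
Lemma vandermonde_up m j : vandermonde (up m j) =
  vandermonde m * \prod_(i | i != j) (th (ypt m i - ypt m j + e) / th (ypt m i - ypt m j)).
Proof.
pose rho i := th (ypt m i - ypt m j + e) / th (ypt m i - ypt m j).
have step (a b : 'I_n) : (a < b)%N -> th (ypt (up m j) b - ypt (up m j) a) =
    th (ypt m b - ypt m a) * ((if a == j then rho b else 1) * (if b == j then rho a else 1)).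
  move=> ab; rewrite !ypt_up; have [aj|aj] := eqVneq a j.
    rewrite aj in ab *; have bj : b != j by rewrite neq_ltn ab orbT.
    rewrite (negbTE bj) mulr1 /rho mulrCA divff ?mulr1 ?th_ypt //.
    by rewrite opprB addrA addrAC.
  have [bj|bj] := eqVneq b j; last by rewrite !mulr1.
  rewrite bj mul1r /rho; have aj0 := th_ypt m aj.
  have -> : th (ypt m j - ypt m a) = - th (ypt m a - ypt m j) by rewrite -[RHS]thN; congr th; ring.
  have -> : th (ypt m j - e - ypt m a) = - th (ypt m a - ypt m j + e).
    by rewrite -[RHS]thN; congr th; ring.
  by field.
rewrite /vandermonde (eq_bigr (fun a : 'I_n => (\prod_(b < n | (a < b)%N) th (ypt m b - ypt m a)) *
   ((\prod_(b < n | (a < b)%N) (if a == j then rho b else 1)) *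
    (\prod_(b < n | (a < b)%N) (if b == j then rho a else 1))))) => [|a _]; last first.
  by rewrite -!big_split; apply: eq_bigr => b; exact: step.
rewrite big_split; congr (_ * _); rewrite big_split /=.
have -> : \prod_(a < n) \prod_(b < n | (a < b)%N) (if a == j then rho b else 1) =
    \prod_(b < n | (j < b)%N) rho b.
  rewrite (bigD1 j) //= eqxx [X in _ * X]big1 ?mulr1 // => a /negbTE ->; exact: big1.
have -> : \prod_(a < n) \prod_(b < n | (a < b)%N) (if b == j then rho a else 1) =
    \prod_(a < n | (a < j)%N) rho a.
  rewrite [RHS]big_mkcond; apply: eq_bigr => a _; case: ifP => aj.
    by rewrite (bigD1 j) //= eqxx big1 ?mulr1 // => b /andP[_ /negbTE ->].
  by apply: big1 => b ab; case: eqP => // bj; rewrite -bj ab in aj.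
rewrite [RHS](bigID (fun i : 'I_n => (j < i)%N)) /=; congr (_ * _); apply: eq_bigl => i.
  by case: ltnP => h; rewrite ?andbF ?andbT // neq_ltn h orbT.
by rewrite -leqNgt ltn_neqAle.
Qed.

Lemma sign_pred (s : nat) : (0 < s)%N -> (-1) ^+ s.-1 = - (-1) ^+ s :> F.
Proof. by case: s => // s _; rewrite exprS mulN1r opprK. Qed.

Lemma gauge_num_up m j : gauge_num (up m j) = - gauge_num m *
  \prod_(i | i != j) (th (ypt m i - ypt m j + e) / th (ypt m j - ypt m i))
  / Delta_p (ypt m j - e).
Proof.
rewrite /gauge_num size_up vandermonde_up mulnS exprD.
pose pD i s := \prod_(r < s) Delta_p (Y i - e * r.+1%:R).
have pDE : \prod_i pD i (up m j i) = Delta_p (ypt m j - e) * \prod_i pD i (m i).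
  rewrite (bigD1 j) //= [X in _ = _ * X](bigD1 j) //= mulrA.
  have -> : up m j j = (m j).+1 by rewrite /up eqxx addn1.
  rewrite {1}/pD big_ord_recr /= -ypt_sub -/(pD j (m j)) [X in X * _]mulrC; congr (_ * _).
  by apply: eq_bigr => i /negbTE ij; rewrite /up ij addn0.
rewrite -[\prod_i \prod_(r < up m j i) _]/(\prod_i pD i (up m j i)) pDE {pDE}.
have -> : \prod_(i | i != j) (th (ypt m i - ypt m j + e) / th (ypt m j - ypt m i)) =
   - (-1) ^+ n * \prod_(i | i != j) (th (ypt m i - ypt m j + e) / th (ypt m i - ypt m j)).
  rewrite (eq_bigr (fun i => -1 * (th (ypt m i - ypt m j + e) / th (ypt m i - ypt m j)))).
    rewrite big_split /=; congr (_ * _).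
    rewrite prodr_const (_ : #|[pred i | i != j]| = n.-1); last first.
      by rewrite (cardC1 j) card_ord.
    by rewrite sign_pred // (leq_ltn_trans _ (ltn_ord j)).
  move=> i _; rewrite -[ypt m j - _]opprB thN invrN; ring.
rewrite -[\prod_i \prod_(r < m i) _]/(\prod_i pD i (m i)) invfM; set D := Delta_p _; set P := \prod_(i | _) _; set Q := \prod_i _; ring.
Qed.

Lemma gauge_up m j l : dom l -> gauge (up m j) l = - gauge m (l + e) / th (l + e) *
  \prod_(i | i != j) (th (ypt m i - ypt m j + e) / th (ypt m j - ypt m i))
  / Delta_p (ypt m j - e).
Proof.
move=> dl; rewrite /gauge gauge_num_up size_up big_ord_recl mulr1 !invfM.
have -> : \prod_(i < size_of m) th (l + e * (lift ord0 i).+1%:R) =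
    \prod_(r < size_of m) th (l + e + e * r.+1%:R).
  by apply: eq_bigr => r _; congr th; rewrite /= /bump /= add1n -[r.+2%:R]natr1; ring.
set D := Delta_p _; set P := \prod_(i | _) _; set Q := \prod_(i < _) _; ring.
Qed.

(** The weight of v_p. *)
Definition wtI p : int := wt vacuum - (size_of (nv p) + size_of (nv p))%N%:Z.

Definition Wa : F -> F -> I -> I -> F := fun z l q p =>
  (q == p)%:R * (acoef (nv p) z * th (l + e * (size_of (nv p))%:R) / th l).

Definition Wb : F -> F -> I -> I -> F := fun z l q p => \sum_j (is_up p q j)%:R *
  (- (th (l + z - ypt (nv q) j) / th l
     * \prod_(i | i != j) (th (z - ypt (nv q) i) / th (ypt (nv q) i - ypt (nv q) j))
     * Delta_p (ypt (nv q) j))).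

Definition Wc : F -> F -> I -> I -> F := fun z l q p => \sum_j (is_up q p j)%:R *
  (- (th (- l + z - ypt (nv q) j + e * (wtI q)%:~R) / th l
     * \prod_(i | i != j) (th (z - ypt (nv q) i) / th (ypt (nv q) i - ypt (nv q) j))
     * Delta_m (ypt (nv q) j))).

Definition det_elt z l q := th (l - e * (wtI q)%:~R) / th l * delta z.

(** The kernels Wa, Wb, Wc are those of the difference operators restricted to
    S_0; here the determinant relation is solved for d(z). *)
Definition Wd : F -> F -> I -> I -> F := fun z l q p =>
  (det_elt z (l + e) q * (q == p)%:R + kcomp (Wc (z + e) (l + e)) (Wb z l) q p)
  / (acoef (nv q) (z + e) * th (l + e + e * (size_of (nv q))%:R) / th (l + e)).

Definition W : entries F I := fun v u => match v, u with
  | true, true => Wa | true, false => Wb | false, true => Wc | false, false => Wd end.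

Definition Mx l k p := gauge (nv p) l * vecs p l k.

Definition regular_at z := forall p i, th (z - ypt (nv p) i) != 0.

Lemma T_Mx v u z l k p : kcomp (T v u z l) (Mx (dyn u l)) k p =
  gauge (nv p) (dyn u l) * op v u z (vecs p) l k.
Proof. by rewrite /kcomp /op /kapp mulr_sumr; apply: eq_bigr => j _; rewrite mulrCA. Qed.

Lemma delta_Delta y : delta (y - e) = Delta_p (y - e) * Delta_m y.
Proof.
rewrite /delta /Delta_p /Delta_m -big_split; apply: eq_bigr => i _.
by congr (_ * th _); rewrite -natr1; ring.
Qed.

Lemma Mx_Wa z l k p : dom l ->
  kcomp (Mx l) (Wa z l) k p = kcomp (T true true z l) (Mx (l - e)) k p.
Proof.
move=> dl; rewrite (T_Mx true true) op_a_vec // /kcomp (bigD1 p) //= big1 => [|q qp]; last first.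
  by rewrite /Wa (negbTE qp) mul0r mulr0.
rewrite addr0 /Wa eqxx mul1r /Mx -/(vecs p); have l0 := dom_neq0 dl.
have g : gauge (nv p) (l - e) = gauge (nv p) l * th (l + e * (size_of (nv p))%:R) / th l.
  by rewrite -gauge_shift // mulfK.
by rewrite g; ring.
Qed.

Lemma Mx_Wb z l k p : regular_at z -> dom l ->
  kcomp (Mx l) (Wb z l) k p = kcomp (T true false z l) (Mx (l + e)) k p.
Proof.
move=> rz dl; rewrite (T_Mx true false) (op_B_vec _ (rz p)) // /kcomp mulr_sumr.
apply: eq_bigr => q _; rewrite /Mx /Wb [RHS]mulrA mulrAC; congr (_ * _).
have [j pq|no] := pickP (is_up p q); last by rewrite !big1 ?mulr0 // => j _; rewrite no mul0r.
rewrite !(sum_up _ pq) (is_upP _ _ _ pq) gauge_up // ypt_up eqxx /raising_elt !prodf_div.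
have -> : \prod_(i | i != j) th (z - ypt (up (nv p) j) i) = \prod_(i | i != j) th (z - ypt (nv p) i).
  by apply: eq_bigr => i /negbTE ij; rewrite ypt_up ij.
have -> : \prod_(i | i != j) th (ypt (up (nv p) j) i - (ypt (nv p) j - e)) =
    \prod_(i | i != j) th (ypt (nv p) i - ypt (nv p) j + e).
  by apply: eq_bigr => i /negbTE ij; rewrite ypt_up ij; congr th; ring.
have -> : l + z - (ypt (nv p) j - e) = l + e + z - ypt (nv p) j by ring.
have D0 : Delta_p (ypt (nv p) j - e) != 0 by rewrite ypt_sub Delta_p_neq0.
have P0 : \prod_(i | i != j) th (ypt (nv p) i - ypt (nv p) j + e) != 0.
  apply/prodf_neq0 => i ij.
  have -> : ypt (nv p) i - ypt (nv p) j + e = ypt (nv p) i - (ypt (nv p) j - e) by ring.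
  by rewrite ypt_sub; apply: th_gen => h; rewrite h eqxx in ij.
have Q0 : \prod_(i | i != j) th (ypt (nv p) j - ypt (nv p) i) != 0.
  by apply/prodf_neq0 => i ij; rewrite th_ypt // eq_sym.
move: (\prod_(i | i != j) th (_ + e)) P0 => P P0; move: (\prod_(i | i != j) th (z - _)) => Z.
move: (\prod_(i | i != j) _) Q0 => Q Q0; move: (Delta_p _) D0 => D D0.
move: (gauge _ _) (th (l + e + z - _)) => g t.
have l0 := dom_neq0 dl; have l1 := dom_neq0 (domD dl).
by field; rewrite ?l0 ?l1 ?P0 ?Q0 ?D0.
Qed.

Lemma Mx_Wc z l k p : regular_at z -> dom l ->
  kcomp (Mx l) (Wc z l) k p = kcomp (T false true z l) (Mx (l - e)) k p.
Proof.
move=> rz dl; rewrite (T_Mx false true) (op_C_vec _ (rz p)) // /kcomp mulr_sumr.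
apply: eq_bigr => q _; rewrite /Mx /Wc [RHS]mulrA mulrAC; congr (_ * _).
have [j qp|no] := pickP (is_up q p); last by rewrite !big1 ?mulr0 // => j _; rewrite no mul0r.
rewrite !(sum_up _ qp) (is_upP _ _ _ qp) gauge_up; last exact: dom_dyn true dl.
rewrite /dyn_shift subrK /lowering_elt delta_Delta !prodf_div -/(wtI q).
have -> : th (l - e * (wtI q)%:~R + ypt (nv q) j - z) =
   - th (- l + z - ypt (nv q) j + e * (wtI q)%:~R) by rewrite -[RHS]thN; congr th; ring.
rewrite opprK.
have -> : \prod_(i | i != j) th (ypt (nv q) j - e - ypt (nv q) i) =
   (-1) ^+ n.-1 * \prod_(i | i != j) th (ypt (nv q) i - ypt (nv q) j + e).
  rewrite -[n in n.-1]card_ord -(cardC1 j) -prodr_const -big_split /=; apply: eq_bigr => i _.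
  by rewrite mulN1r -[RHS]thN; congr th; ring.
have -> : \prod_(i | i != j) th (ypt (nv q) j - ypt (nv q) i) =
   (-1) ^+ n.-1 * \prod_(i | i != j) th (ypt (nv q) i - ypt (nv q) j).
  rewrite -[n in n.-1]card_ord -(cardC1 j) -prodr_const -big_split /=; apply: eq_bigr => i _.
  by rewrite mulN1r -[RHS]thN; congr th; ring.
have D0 : Delta_p (ypt (nv q) j - e) != 0 by rewrite ypt_sub Delta_p_neq0.
have P0 : \prod_(i | i != j) th (ypt (nv q) i - ypt (nv q) j + e) != 0.
  apply/prodf_neq0 => i ij.
  have -> : ypt (nv q) i - ypt (nv q) j + e = ypt (nv q) i - (ypt (nv q) j - e) by ring.
  by rewrite ypt_sub; apply: th_gen => h; rewrite h eqxx in ij.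
have Q0 : \prod_(i | i != j) th (ypt (nv q) i - ypt (nv q) j) != 0.
  by apply/prodf_neq0 => i ij; rewrite th_ypt.
move: (\prod_(i | i != j) th (_ + e)) P0 => P P0; move: (\prod_(i | i != j) th (z - _)) => Z.
move: (\prod_(i | i != j) _) Q0 => Q Q0; move: (Delta_p _) D0 => D D0.
move: (gauge _ _) (th (- l + z - _ + _)) (Delta_m _) => g t d.
have : ((-1) ^+ n.-1 : F) != 0 by rewrite signr_eq0.
have : ((-1) ^+ n.-1 : F) * (-1) ^+ n.-1 = 1 by rewrite -expr2 sqrr_sign.
move: ((-1) ^+ n.-1) => s ss s0.
have l0 := dom_neq0 dl.
transitivity (- (g * t * Z * d / th l / Q)); first by field; rewrite ?l0 ?Q0.
transitivity (- (g * t * Z * d / th l / Q) / (s * s)); first by rewrite ss divr1.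
by field; rewrite ?l0 ?P0 ?Q0 ?D0 ?s0.
Qed.
Lemma Mx_inj (A B : I -> F) l : dom l ->
  (forall k, \sum_q Mx l k q * A q = \sum_q Mx l k q * B q) -> forall q, A q = B q.
Proof.
move=> dl E q; apply: (mulfI (gauge_neq0 (nv q) dl)); move: q; apply: (vec_inj dl) => k.
transitivity (\sum_q Mx l k q * A q); last rewrite E.
  by apply: eq_bigr => q _; rewrite mulrAC.
by apply: eq_bigr => q _; rewrite mulrAC.
Qed.

Lemma Mx_wt l k p : dom l -> Mx l k p != 0 -> wt k = wtI p.
Proof. by move=> dl; rewrite mulf_eq0 negb_or => /andP[_ /(wt_vec dl)]. Qed.

Lemma T_a_inj z (f g : I -> F) l : regular_at z -> dom l ->
  (forall k, kapp (T true true z (l + e)) f k = kapp (T true true z (l + e)) g k) -> f = g.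
Proof.
move=> rz dl E; have dl' := domD dl; apply/funext => k.
have TE h k' : kapp (T true true z (l + e)) h k' =
    \sum_q (coord l h q * acoef (nv q) z) * vecs q (l + e) k'.
  transitivity (\sum_q coord l h q * op true true z (vecs q) (l + e) k').
    rewrite /op /kapp /dyn_shift addrK; under eq_bigr => j _ do rewrite (coordE h j dl) mulr_sumr.
    rewrite exchange_big; apply: eq_bigr => q _ /=; rewrite mulr_sumr.
    by apply: eq_bigr => j _; rewrite mulrCA.
  by apply: eq_bigr => q _; rewrite op_a_vec // mulrA.
rewrite (coordE f k dl) (coordE g k dl); apply: eq_bigr => q _; congr (_ * _).
apply: (mulIf (_ : acoef (nv q) z != 0)); first by apply/prodf_neq0 => i _; exact: rz.
move: q; apply: (vec_inj dl') => k'; by rewrite -!TE.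
Qed.

Lemma Wa_Wd z l q p : regular_at (z + e) -> dom l ->
  kcomp (Wa (z + e) (l + e)) (Wd z l) q p =
  det_elt z (l + e) q * (q == p)%:R + kcomp (Wc (z + e) (l + e)) (Wb z l) q p.
Proof.
move=> rz dl; rewrite {1}/kcomp (bigD1 q) //= big1 ?addr0 => [|r rq]; last first.
  by rewrite /Wa eq_sym (negbTE rq) !mul0r.
rewrite /Wa eqxx mul1r /Wd mulrC divfK //.
have dl' := domD dl; rewrite !mulf_neq0 ?invr_neq0 ?dom_nat ?(dom_neq0 dl') //.
by apply/prodf_neq0 => i _; exact: rz.
Qed.

(** Both sides satisfy the determinant relation, in which d(z) is preceded by
    the injective operator a(z + e). *)
Lemma Mx_Wd z l k p : regular_at z -> regular_at (z + e) -> dom l ->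
  kcomp (Mx l) (Wd z l) k p = kcomp (T false false z l) (Mx (l + e)) k p.
Proof.
move=> rz rz' dl; have dl' := domD dl; pose l1 := l + e.
have l1e : l1 - e = l by rewrite /l1 addrK.
suff : (fun j => kcomp (Mx l) (Wd z l) j p) = (fun j => kcomp (T false false z l) (Mx l1) j p).
  by move=> /(congr1 (fun f => f k)).
apply: (T_a_inj rz' dl) => {}k.
rewrite -[LHS]/(kcomp (T true true (z + e) l1) (kcomp (Mx l) (Wd z l)) k p).
rewrite -[RHS]/(kcomp (T true true (z + e) l1) (kcomp (T false false z l) (Mx l1)) k p).
have Ma : kcomp (T true true (z + e) l1) (Mx l) = kcomp (Mx l1) (Wa (z + e) l1).
  by apply/funext => i; apply/funext => j; rewrite Mx_Wa // l1e.
have Mc : kcomp (T false true (z + e) l1) (Mx l) = kcomp (Mx l1) (Wc (z + e) l1).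
  by apply/funext => i; apply/funext => j; rewrite Mx_Wc // l1e.
have Mb : kcomp (T true false z l) (Mx l1) = kcomp (Mx l) (Wb z l).
  by apply/funext => i; apply/funext => j; rewrite Mx_Wb.
rewrite !kcompA Ma -kcompA.
transitivity (Mx l1 k p * det_elt z l1 p +
    kcomp (kcomp (T false true (z + e) l1) (T true false z l)) (Mx l1) k p).
  rewrite -kcompA Mb kcompA Mc -kcompA.
  rewrite {1}/kcomp; under eq_bigr do rewrite Wa_Wd // mulrDr.
  rewrite big_split; congr (_ + _) => /=; last by rewrite -kcompA.
  rewrite (bigD1 p) //= big1 ?addr0 => [|q /negbTE ->]; last by rewrite !mulr0.
  by rewrite eqxx mulr1.
have D j : kcomp (T true true (z + e) l1) (T false false z l) k j =
    kcomp (T false true (z + e) l1) (T true false z l) k j +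
    (k == j)%:R * (th (l1 - e * (wt k)%:~R) / th l1 * delta z).
  have := DT z (true, false) k j dl'; rewrite /comp2 /= -/l1 l1e /minor /= subr0 mulr1 => <-.
  by rewrite addrCA subrr addr0.
rewrite [in RHS]kcompA [RHS]/kcomp; under [RHS]eq_bigr do rewrite D mulrDl.
rewrite big_split addrC; congr (_ + _) => /=.
rewrite [RHS](bigD1 k) //= [X in _ = _ + X]big1 ?addr0 => [|j /negbTE]; last first.
  by rewrite eq_sym => ->; rewrite !mul0r.
rewrite eqxx mul1r mulrC; have [->|/(Mx_wt dl') kp] := eqVneq (Mx l1 k p) 0; first by rewrite !mulr0.
by rewrite /det_elt kp.
Qed.

Lemma Mx_W v u z l k p : regular_at z -> regular_at (z + e) -> dom l ->
  kcomp (Mx l) (W v u z l) k p = kcomp (T v u z l) (Mx (dyn u l)) k p.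
Proof.
move=> rz rz' dl; case: v u => [] [] /=.
- exact: Mx_Wa.
- exact: Mx_Wb.
- exact: Mx_Wc.
- exact: Mx_Wd.
Qed.

Lemma Mx_comp2 s t z w l : regular_at z -> regular_at (z + e) ->
  regular_at w -> regular_at (w + e) -> dom l ->
  kcomp (Mx l) (comp2 e W s t z w l) = kcomp (comp2 e T s t z w l) (Mx (dyn t.2 (dyn t.1 l))).
Proof.
move=> rz rz' rw rw' dl; rewrite /comp2 kcompA -[RHS]kcompA.
have -> : kcomp (T s.2 t.2 w (dyn t.1 l)) (Mx (dyn t.2 (dyn t.1 l))) =
    kcomp (Mx (dyn t.1 l)) (W s.2 t.2 w (dyn t.1 l)).
  by apply/funext => k; apply/funext => p; rewrite Mx_W //; exact: dom_dyn.
rewrite kcompA; congr (kcomp _ _).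
by apply/funext => k; apply/funext => p; rewrite Mx_W.
Qed.

(** The change of basis Mx is injective and carries products of entries of W
    to products of entries of T. *)
Lemma RLL_W z w l s t q p : regular_at z -> regular_at (z + e) ->
  regular_at w -> regular_at (w + e) -> dom l ->
  \sum_r Rhat (z - w) (l - e * (wtI q)%:~R) s r * comp2 e W r t z w l q p =
  \sum_r comp2 e W (swap s) (swap r) w z l q p * Rhat (z - w) l r t.
Proof.
move=> rz rz' rw rw' dl; move: q; apply: (Mx_inj dl) => k.
transitivity (\sum_r Rhat (z - w) (l - e * (wt k)%:~R) s r * kcomp (Mx l) (comp2 e W r t z w l) k p).
  under eq_bigr do rewrite mulr_sumr; rewrite exchange_big; apply: eq_bigr => r _ /=.
  rewrite /kcomp mulr_sumr; apply: eq_bigr => q _; rewrite mulrCA.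
  have [->|/(Mx_wt dl) ->//] := eqVneq (Mx l k q) 0; by rewrite !mul0r !mulr0.
pose l2 := dyn t.2 (dyn t.1 l).
transitivity (\sum_j (\sum_r Rhat (z - w) (l - e * (wt k)%:~R) s r * comp2 e T r t z w l k j) * Mx l2 j p).
  under eq_bigr do rewrite Mx_comp2 // /kcomp mulr_sumr.
  rewrite exchange_big; apply: eq_bigr => j _ /=; rewrite mulr_suml.
  by apply: eq_bigr => r _; rewrite mulrA.
transitivity (\sum_r kcomp (Mx l) (comp2 e W (swap s) (swap r) w z l) k p * Rhat (z - w) l r t).
  under eq_bigr do rewrite RT // mulr_suml.
  rewrite exchange_big; apply: eq_bigr => r _ /=.
  have [->|/Rhat_cons rt] := eqVneq (Rhat (z - w) l r t) 0.
    by rewrite mulr0 big1 // => j _; rewrite mulr0 mul0r.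
  rewrite Mx_comp2 // (_ : dyn (swap r).2 _ = l2).
    by rewrite /kcomp mulr_suml; apply: eq_bigr => j _; rewrite mulrAC.
  rewrite /l2 !dynE -!addrA -!opprD -!mulrDr -!intrD; congr (l - e * _%:~R).
  by case: r t rt {l2} => [[] []] [[] []].
rewrite /kcomp; under eq_bigr do rewrite mulr_suml.
rewrite exchange_big; apply: eq_bigr => q _ /=; rewrite mulr_sumr.
by apply: eq_bigr => r _; rewrite mulrA.
Qed.

Lemma is_up_wtI p q j : is_up p q j -> wtI p = wtI q + 2.
Proof. by move=> /is_upP qp; rewrite /wtI qp size_up; lia. Qed.

Lemma conserves_Wb z l q p : Wb z l q p != 0 -> wtI p = wtI q + 2.
Proof.
move=> /sum_neq0[j]; case pq : (is_up p q j); last by rewrite mul0r eqxx.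
by move=> _; exact: is_up_wtI pq.
Qed.

Lemma conserves_Wc z l q p : Wc z l q p != 0 -> wtI q = wtI p + 2.
Proof.
move=> /sum_neq0[j]; case pq : (is_up q p j); last by rewrite mul0r eqxx.
by move=> _; exact: is_up_wtI pq.
Qed.

Lemma conserves_W : conserves wtI W.
Proof.
move=> [] [] z l q p /=.
- by rewrite /Wa; have [->//|_] := eqVneq q p; rewrite mul0r eqxx.
- by move=> /conserves_Wb ->; rewrite /spinz; lia.
- by move=> /conserves_Wc ->; rewrite /spinz; lia.
- rewrite /Wd; have [->//|_] := eqVneq q p; rewrite mulr0 add0r mulf_eq0 negb_or => /andP[+ _].
  move=> /sum_neq0[r]; rewrite mulf_eq0 negb_or => /andP[/conserves_Wc -> /conserves_Wb ->].
  by [].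
Qed.
End Eigenbasis.

(** * Potentials of closed differential forms *)

Local Open Scope classical_set_scope.
Section RealPrimitives.
Context {R : realType}.
Implicit Types (f g : R -> R).

Lemma continuous_primitive f (a : R) : continuous f ->
  exists F : R -> R, forall t : R, a < t -> is_derive t 1 F (f t).
Proof.
move=> cf.
exists (fun x => (\int[lebesgue_measure]_(t in `[a, x]) (f t))%R) => t at_.
have [||||d1 d2] := @continuous_FTC1_closed R f a t (t + 1).
- by rewrite ltrDl.
- apply: continuous_compact_integrable; first exact: segment_compact.
  by apply: continuous_subspaceT.
- exact: at_.
- exact: cf.
exact: (DeriveDef d1 (etrans (esym (derive1E _ _)) d2)).
Qed.

Definition between (x y t : R) := Num.min x y <= t <= Num.max x y.

Lemma mean_value f df (a x y : R) :
  (forall t : R, a < t -> is_derive t 1 f (df t)) -> a < x -> a < y ->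
  exists2 t, between x y t & f y - f x = df t * (y - x).
Proof.
move=> dF; wlog xy : x y / x < y => [th ax ay|].
  have [xy|yx|<-] := ltgtP x y; first exact: th.
    have [t tb e] := th _ _ yx ay ax; exists t; last by lra.
    by rewrite /between minC maxC.
  by exists x; [rewrite /between minxx maxxx lexx | rewrite !subrr mulr0].
move=> ax ay.
have [||t txy e] := @MVT R f df x y xy.
- by move=> t; rewrite in_itv /= => /andP[xt _]; apply: dF; lra.
- apply: derivable_within_continuous => t; rewrite in_itv /= => /andP[xt _].
  by have [] := dF t (lt_le_trans ax xt).
exists t => //; move: txy; rewrite in_itv /= => /andP[xt ty].
by rewrite /between (min_idPl (ltW xy)) (max_idPr (ltW xy)) !ltW.
Qed.

Lemma is_derive_quadratic (x p q t : R) :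
  is_derive t 1 (p \*: (id - cst x : R -> R)
                 + (q / 2) \*: ((id - cst x : R -> R) ^+ 2) : R -> R)
    (p + q * (t - x)).
Proof.
have d1 : is_derive t (1 : R) (id - cst x : R -> R) 1.
  by have := is_deriveB (is_derive_id t 1) (is_derive_cst x t 1); rewrite subr0.
have d2 := is_deriveD (is_deriveZ p d1) (is_deriveZ (q / 2) (is_deriveX 2 d1)).
apply: (is_derive_eq d2).
by rewrite expr1 /GRing.scale /= !fctE /=; field.
Qed.

(** The mean value theorem for f minus its expansion of order two with
    coefficients p and q. *)
Lemma mean_value2 f df (a x y p q : R) :
  (forall t : R, a < t -> is_derive t 1 f (df t)) -> a < x -> a < y ->
  exists2 t, between x y t & f y - f x - p * (y - x) - q * (y - x) ^+ 2 / 2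
    = (df t - p - q * (t - x)) * (y - x).
Proof.
move=> dF ax ay.
pose g : R -> R := f - (p \*: (id - cst x : R -> R)
                        + (q / 2) \*: ((id - cst x : R -> R) ^+ 2)).
have [|||t tb e] := @mean_value g (fun t => df t - (p + q * (t - x))) a x y.
- by move=> t at_; apply: is_deriveB (dF t at_) (is_derive_quadratic x p q t).
- exact: ax.
- exact: ay.
exists t => //; move: e; rewrite /g !fctE /= /GRing.scale /= subrr expr0n /= => e.
lra.
Qed.

Lemma between_dist (x y t : R) : between x y t -> `|t - x| <= `|y - x|.
Proof.
rewrite /between ge_min le_max => /andP[/orP[A|A] /orP[B|B]];
  rewrite ler_norml; have := ler_norm (y - x); have := ler_norm (x - y); rewrite [`|x - y|]distrC => B1 B2; lra.
Qed.

End RealPrimitives.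

Section Goursat.
Context {R : realType}.
Variables (P Q : R -> R -> R) (r : R).
Hypothesis cP : forall y, continuous (P^~ y).
Hypothesis cQ : forall x, continuous (Q x).

(** First order expansions of P and Q at a point, with symmetric matrix of
    derivatives: the form P dx + Q dy is closed there. *)
Definition closed_jet (x y a b c : R) := forall e : R, 0 < e ->
  exists2 d : R, 0 < d & forall s t : R, `|s| < d -> `|t| < d ->
    `|P (x + s) (y + t) - P x y - (a * s + b * t)| <= e * (`|s| + `|t|) /\
    `|Q (x + s) (y + t) - Q x y - (b * s + c * t)| <= e * (`|s| + `|t|).

Hypothesis clPQ : forall x y : R, `|x| < r -> `|y| < r ->
  exists a b c, closed_jet x y a b c.

(** Antiderivatives of P along horizontal lines and of Q along vertical lines.
    *)
Variables (H V : R -> R -> R).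
Hypothesis dH : forall y t : R, - r < t -> is_derive t 1 (H y) (P t y).
Hypothesis dV : forall x t : R, - r < t -> is_derive t 1 (V x) (Q x t).

(** The integral of P dx + Q dy along the boundary of a rectangle. *)
Definition circulation (x1 x2 y1 y2 : R) :=
  (H y1 x2 - H y1 x1) + (V x2 y2 - V x2 y1)
  - (H y2 x2 - H y2 x1) - (V x1 y2 - V x1 y1).
Local Notation J := circulation.

Lemma circulation_mean (x1 x2 y1 y2 : R) :
  - r < x1 -> - r < x2 -> - r < y1 -> - r < y2 ->
  exists2 t, between x1 x2 t & exists2 u, between y1 y2 u &
    J x1 x2 y1 y2 = (x2 - x1) * (P t y1 - P t y2)
                    + (y2 - y1) * (Q x2 u - Q x1 u).
Proof.
move=> hx1 hx2 hy1 hy2.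
have [|||t tb e1] := @mean_value R (H y1 - H y2) (fun t => P t y1 - P t y2)
    (- r) x1 x2.
- by move=> t rt; apply: is_deriveB; apply: dH.
- by [].
- by [].
have [|||u ub e2] := @mean_value R (V x2 - V x1) (fun t => Q x2 t - Q x1 t)
    (- r) y1 y2.
- by move=> u ru; apply: is_deriveB; apply: dV.
- by [].
- by [].
exists t => //; exists u => //; move: e1 e2; rewrite /J /=.
rewrite !fctE => e1 e2.
lra.
Qed.

(** The linear parts of P and Q contribute nothing to the circulation, by
    symmetry of the derivatives. *)
Lemma circulation_small (x y a b c e : R) : closed_jet x y a b c -> 0 < e ->
  exists2 d : R, 0 < d & forall x1 y1 w h : R, 0 <= w -> 0 <= h -> w < d -> h < d ->
    - r < x1 -> - r < y1 -> x1 <= x <= x1 + w -> y1 <= y <= y1 + h ->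
    `|J x1 (x1 + w) y1 (y1 + h)| <= e * (w + h) ^+ 2.
Proof.
move=> cl e0; have e20 : 0 < e / 2 by lra.
have [d d0 dP] := cl _ e20.
exists d => // x1 y1 w h w0 h0 wd hd rx1 ry1 /andP[x1x xx1] /andP[y1y yy1].
have [|||| t tb [u ub ->]] :=
  @circulation_mean x1 (x1 + w) y1 (y1 + h); [lra|lra|lra|lra|].
move: tb ub; rewrite /between.
have lw : x1 <= x1 + w by rewrite lerDl.
have lh : y1 <= y1 + h by rewrite lerDl.
rewrite (min_idPl lw) (max_idPr lw) (min_idPl lh) (max_idPr lh).
move=> /andP[t1 t2] /andP[u1 u2].
have bd s1 s2 : x1 <= s1 <= x1 + w -> y1 <= s2 <= y1 + h ->
  `|P s1 s2 - P x y - (a * (s1 - x) + b * (s2 - y))| <= e / 2 * (w + h) /\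
  `|Q s1 s2 - Q x y - (b * (s1 - x) + c * (s2 - y))| <= e / 2 * (w + h).
  move=> /andP[? ?] /andP[? ?].
  have k1 : `|s1 - x| <= w by rewrite ler_norml; lra.
  have k2 : `|s2 - y| <= h by rewrite ler_norml; lra.
  have [|| A B] := dP (s1 - x) (s2 - y); [lra|lra|].
  rewrite ![_ + (_ - _)]addrC !subrK in A B.
  have k3 : e / 2 * (`|s1 - x| + `|s2 - y|) <= e / 2 * (w + h).
    by rewrite ler_pM2l; lra.
  by split; [apply: le_trans A k3 | apply: le_trans B k3].
have [|| A1 _] := bd t y1; [lra|lra|].
have [|| A2 _] := bd t (y1 + h); [lra|lra|].
have [|| _ A3] := bd (x1 + w) u; [lra|lra|].
have [|| _ A4] := bd x1 u; [lra|lra|].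
rewrite ![_ + _ - _]addrAC !subrr !add0r.
have -> : w * (P t y1 - P t (y1 + h)) + h * (Q (x1 + w) u - Q x1 u) =
  w * (P t y1 - P t (y1 + h) + b * h) + h * (Q (x1 + w) u - Q x1 u - b * w).
  by ring.
apply: le_trans (ler_normD _ _) _; rewrite !normrM (ger0_norm w0) (ger0_norm h0).
have k1 : `|P t y1 - P t (y1 + h) + b * h| <= e * (w + h).
  clear -A1 A2; move: A1 A2; rewrite !ler_norml => /andP[? ?] /andP[? ?].
  by apply/andP; split; lra.
have k2 : `|Q (x1 + w) u - Q x1 u - b * w| <= e * (w + h).
  clear -A3 A4; move: A3 A4; rewrite !ler_norml => /andP[? ?] /andP[? ?].
  by apply/andP; split; lra.
have -> : e * (w + h) ^+ 2 = w * (e * (w + h)) + h * (e * (w + h)) by ring.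
by apply: lerD; apply: ler_wpM2l.
Qed.

Lemma circulation_split (x1 x2 x3 y1 y2 y3 : R) : J x1 x3 y1 y3 =
  J x1 x2 y1 y2 + J x2 x3 y1 y2 + J x1 x2 y2 y3 + J x2 x3 y2 y3.
Proof. rewrite /J; ring. Qed.

Lemma half_lt_eventually (w d : R) : 0 < d -> exists n : nat, w * 2^-1 ^+ n < d.
Proof.
move=> d0.
have /cvgrPdist_lt /(_ _ d0) [N _ /(_ N (leqnn _))] :
    geometric w 2^-1 @ \oo --> 0.
  by apply: cvg_geometric; rewrite ger0_norm ?invf_lt1 ?ltr1n // invr_ge0.
by rewrite sub0r normrN => /(le_lt_trans (ler_norm _)); exists N.
Qed.

(** Bisection: if the circulation c is not zero, one of the four quarters of a
    rectangle carries at least a quarter of its circulation, and repeating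
    this gives rectangles shrinking to a point at which circulation_small
    fails. *)
Lemma goursat_le (x0 y0 w h : R) : 0 <= w -> 0 <= h ->
  - r < x0 -> x0 + w < r -> - r < y0 -> y0 + h < r ->
  J x0 (x0 + w) y0 (y0 + h) = 0.
Proof.
move=> w0 h0 rx xr ry yr; apply/eqP; apply: contraT => Jn0.
pose c := `|J x0 (x0 + w) y0 (y0 + h)|.
have c0 : 0 < c by rewrite normr_gt0.
pose k n : R := 2^-1 ^+ n.
have k0 n : 0 < k n by rewrite exprn_gt0 // invr_gt0.
have kS n : k n.+1 = k n / 2 by rewrite /k exprSr.
pose big n (p : R * R) := c * (k n) ^+ 2 <=
  `|J p.1 (p.1 + w * k n) p.2 (p.2 + h * k n)|.
have /choice[g gP] : forall np : nat * (R * R), exists q : R * R,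
    big np.1 np.2 -> [/\ big np.1.+1 q,
      np.2.1 <= q.1, q.1 + w * k np.1.+1 <= np.2.1 + w * k np.1,
      np.2.2 <= q.2 & q.2 + h * k np.1.+1 <= np.2.2 + h * k np.1].
  move=> [n [x y]] /=; set kn := k n.
  have [bg|] := pselect (big n (x, y)); last by exists 0.
  move: bg; rewrite /big /= kS -/kn => bg.
  have kn0 : 0 < kn := k0 n.
  have wk0 : 0 <= w * kn by rewrite mulr_ge0 // ltW.
  have hk0 : 0 <= h * kn by rewrite mulr_ge0 // ltW.
  move: bg; rewrite (@circulation_split _ (x + w * (kn / 2)) _ _ (y + h * (kn / 2))).
  have -> : x + w * kn = x + w * (kn / 2) + w * (kn / 2) by field.
  have -> : y + h * kn = y + h * (kn / 2) + h * (kn / 2) by field.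
  set J1 := J _ _ _ _; set J2 := J _ _ _ _; set J3 := J _ _ _ _.
  set J4 := J _ _ _ _ => bg.
  set q := c * (kn / 2) ^+ 2.
  have q4 : c * kn ^+ 2 = 4 * q by rewrite /q; field.
  have tri := ler_normD (J1 + J2 + J3) J4.
  have tri2 := ler_normD (J1 + J2) J3.
  have tri3 := ler_normD J1 J2.
  have [b1|b1] := leP q `|J1|.
    by exists (x, y) => _; split => //=; rewrite ?lexx //; lra.
  have [b2|b2] := leP q `|J2|.
    by exists (x + w * (kn / 2), y) => _; split => //=; lra.
  have [b3|b3] := leP q `|J3|.
    by exists (x, y + h * (kn / 2)) => _; split => //=; lra.
  exists (x + w * (kn / 2), y + h * (kn / 2)) => _; split => //=; lra.
pose p := fix p n := if n is n'.+1 then g (n', p n') else (x0, y0).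
have pbig n : big n (p n).
  elim: n => [|n IHn]; first by rewrite /big /= /k expr0 !mulr1 expr1n mulr1.
  by have [] := gP (n, p n) IHn.
have pS n : [/\ big n.+1 (p n.+1),
      (p n).1 <= (p n.+1).1, (p n.+1).1 + w * k n.+1 <= (p n).1 + w * k n,
      (p n).2 <= (p n.+1).2 & (p n.+1).2 + h * k n.+1 <= (p n).2 + h * k n].
  exact: (gP (n, p n) (pbig n)).
have mono n m : [/\ (p n).1 <= (p (n + m)%N).1,
    (p (n + m)%N).1 + w * k (n + m)%N <= (p n).1 + w * k n,
    (p n).2 <= (p (n + m)%N).2 &
    (p (n + m)%N).2 + h * k (n + m)%N <= (p n).2 + h * k n].
  elim: m => [|m [A1 A2 A3 A4]]; first by rewrite addn0.
  have [_ /= B1 B2 B3 B4] := pS (n + m)%N; rewrite addnS; split.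
  - exact: le_trans A1 B1.
  - exact: le_trans B2 A2.
  - exact: le_trans A3 B3.
  - exact: le_trans B4 A4.
have bnd n m : (p m).1 <= (p n).1 + w * k n /\ (p m).2 <= (p n).2 + h * k n.
  have wk l : 0 <= w * k l by rewrite mulr_ge0 // ltW.
  have hk l : 0 <= h * k l by rewrite mulr_ge0 // ltW.
  have [nm|/ltnW mn] := leqP n m.
    have [_ A _ B] := mono n (m - n)%N; move: A B; rewrite subnKC // => A B.
    by move: (wk m) (hk m); lra.
  have [A _ B _] := mono m (n - m)%N; move: A B; rewrite subnKC // => A B.
  by move: (wk n) (hk n); lra.
pose xs := sup (range (fun n => (p n).1)).
pose ys := sup (range (fun n => (p n).2)).
have xsP n : (p n).1 <= xs <= (p n).1 + w * k n.
  apply/andP; split.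
    apply: ub_le_sup; last by exists n.
    by exists ((p 0).1 + w * k 0) => _ [m _ <-]; have [] := bnd 0 m.
  apply: ge_sup; first by exists (p 0).1; exists 0.
  by move=> _ [m _ <-]; have [] := bnd n m.
have ysP n : (p n).2 <= ys <= (p n).2 + h * k n.
  apply/andP; split.
    apply: ub_le_sup; last by exists n.
    by exists ((p 0).2 + h * k 0) => _ [m _ <-]; have [] := bnd 0 m.
  apply: ge_sup; first by exists (p 0).2; exists 0.
  by move=> _ [m _ <-]; have [] := bnd n m.
have [a [b [cc cl]]] : exists a b c, closed_jet xs ys a b c.
  have := xsP 0; have := ysP 0; rewrite /= /k expr0 !mulr1 => ? ?.
  by apply: clPQ; rewrite ltr_norml; lra.
have e0 : 0 < c / (2 * ((w + h) ^+ 2 + 1)).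
  by rewrite divr_gt0 // mulr_gt0 // ltr_wpDl // sqr_ge0.
have [d d0 dP] := circulation_small cl e0.
have [n nd] := @half_lt_eventually (w + h) d d0.
have [_ ] := mono 0 n; rewrite !add0n => _ _ _.
have [M1 _ M3 _] := mono 0 n; rewrite add0n /= in M1 M3.
have kn := k0 n.
have wk : 0 <= w * k n by rewrite mulr_ge0 // ltW.
have hk : 0 <= h * k n by rewrite mulr_ge0 // ltW.
have nd' : w * k n + h * k n < d by rewrite -mulrDl.
have small := dP (p n).1 (p n).2 (w * k n) (h * k n).
have := pbig n; rewrite /big leNgt => /negP[]; apply: le_lt_trans.
  by apply: small => //; lra.
rewrite -mulrDl exprMn mulrA ltr_pM2r ?exprn_gt0 //.
rewrite mulrAC ltr_pdivrMr; last by rewrite mulr_gt0 // ltr_wpDl // sqr_ge0.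
by rewrite ltr_pM2l //; have := sqr_ge0 (w + h); lra.
Qed.

Lemma goursat (x1 x2 y1 y2 : R) : `|x1| < r -> `|x2| < r -> `|y1| < r -> `|y2| < r ->
  J x1 x2 y1 y2 = 0.
Proof.
rewrite !ltr_norml.
wlog x12 : x1 x2 / x1 <= x2 => [th|].
  move=> ? ? ? ?; have [/th->//|/ltW /th e] := leP x1 x2.
  suff : J x2 x1 y1 y2 = 0 by rewrite /J; lra.
  exact: e.
wlog y12 : y1 y2 / y1 <= y2 => [th|].
  move=> ? ? ? ?; have [/th->//|/ltW /th e] := leP y1 y2.
  suff : J x1 x2 y2 y1 = 0 by rewrite /J; lra.
  exact: e.
move=> /andP[? ?] /andP[? ?] /andP[? ?] /andP[? ?].
have := @goursat_le x1 y1 (x2 - x1) (y2 - y1).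
have -> : x1 + (x2 - x1) = x2 by ring.
have -> : y1 + (y2 - y1) = y2 by ring.
by apply; lra.
Qed.

Definition potential x y := (H 0 x - H 0 0) + (V x y - V x 0).

(** As circulations vanish, the increment of the potential is an integral over
    a horizontal and a vertical segment, to each of which mean_value2 applies.
    *)
Lemma potential_jet (x y a b c e : R) : `|x| < r -> `|y| < r ->
  closed_jet x y a b c -> 0 < e ->
  exists2 d : R, 0 < d & forall s t : R, `|s| < d -> `|t| < d ->
    `|potential (x + s) (y + t) - potential x y - (P x y * s + Q x y * t)
      - (a * s ^+ 2 / 2 + b * s * t + c * t ^+ 2 / 2)| <= e * (`|s| + `|t|) ^+ 2.
Proof.
move=> xr yr cl e0; have [d d0 dP] := cl _ e0.
have r0 : 0 < r by apply: le_lt_trans xr.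
pose m := Num.min d (Num.min (r - `|x|) (r - `|y|)).
have m0 : 0 < m by rewrite /m !lt_min d0 /=; lra.
exists m => // s t; rewrite !lt_min => /andP[sd /andP[sx _]] /andP[td /andP[_ ty]].
have xsr : `|x + s| < r by have := ler_normD x s; lra.
have ytr : `|y + t| < r by have := ler_normD y t; lra.
have g0 : `|0 : R| < r by rewrite normr0.
have G1 := goursat xr xsr g0 yr.
have rx : - r < x /\ - r < x + s by move: xr xsr; rewrite !ltr_norml; lra.
have ry : - r < y /\ - r < y + t by move: yr ytr; rewrite !ltr_norml; lra.
have [u ub e1] := mean_value2 (P x y) a (@dH y) rx.1 rx.2.
have [v vb e2] := mean_value2 (Q x y + b * s) c (@dV (x + s)) ry.1 ry.2.
have := between_dist ub; have := between_dist vb.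
have ex : x + s - x = s by ring.
have ey : y + t - y = t by ring.
rewrite ex in e1 *; rewrite ey in e2 * => vs us.
have [||A _] := dP (u - x) 0; [lra|by rewrite normr0|].
have [||_ B] := dP s (v - y); [lra|lra|].
rewrite [x + _]addrC subrK addr0 mulr0 addr0 normr0 addr0 in A.
rewrite [y + _]addrC subrK in B.
have -> : potential (x + s) (y + t) - potential x y - (P x y * s + Q x y * t)
      - (a * s ^+ 2 / 2 + b * s * t + c * t ^+ 2 / 2) =
  (P u y - P x y - a * (u - x)) * s +
  (Q (x + s) v - Q x y - (b * s + c * (v - y))) * t.
  move: G1 e1 e2; rewrite /circulation /potential => G1 e1 e2.
  lra.
apply: le_trans (ler_normD _ _) _; rewrite !normrM.
have A' : `|P u y - P x y - a * (u - x)| <= e * (`|s| + `|t|).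
  by apply: le_trans A _; rewrite ler_pM2l //; have := normr_ge0 t; lra.
have B' : `|Q (x + s) v - Q x y - (b * s + c * (v - y))| <= e * (`|s| + `|t|).
  by apply: le_trans B _; rewrite ler_pM2l //; lra.
have := ler_wpM2r (normr_ge0 s) A'; have := ler_wpM2r (normr_ge0 t) B'.
lra.
Qed.

End Goursat.

(** The last clause serves to transfer the vanishing of a function near a
    point to its primitive. *)
Theorem closed_field_potential {R : realType} (P Q : R -> R -> R) (r : R) :
  (forall y, continuous (P^~ y)) -> (forall x, continuous (Q x)) ->
  (forall x y : R, `|x| < r -> `|y| < r -> exists a b c, closed_jet P Q x y a b c) ->
  exists2 U : R -> R -> R, (forall x y a b c e : R, `|x| < r -> `|y| < r ->
    closed_jet P Q x y a b c -> 0 < e ->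
    exists2 d : R, 0 < d & forall s t : R, `|s| < d -> `|t| < d ->
      `|U (x + s) (y + t) - U x y - (P x y * s + Q x y * t)
        - (a * s ^+ 2 / 2 + b * s * t + c * t ^+ 2 / 2)| <= e * (`|s| + `|t|) ^+ 2)
    & forall s : R, s <= r ->
        (forall x y, `|x| < s -> `|y| < s -> P x y = 0 /\ Q x y = 0) ->
        forall x y, `|x| < s -> `|y| < s -> U x y = 0.
Proof.
move=> cP cQ cl.
have /choice[H dH] : forall y, exists F : R -> R, forall t : R, - r < t -> is_derive t 1 F (P t y).
  by move=> y; apply: continuous_primitive; exact: cP.
have /choice[V dV] : forall x, exists F : R -> R, forall t : R, - r < t -> is_derive t 1 F (Q x t).
  by move=> x; apply: continuous_primitive; exact: cQ.
exists (potential H V) => [x y a b c e xr yr clj e0|s sr vPQ x y xs ys].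
  exact: (potential_jet cl dH dV xr yr clj e0).
have s0 : 0 < s by apply: le_lt_trans xs.
have near0 z t : `|z| < s -> between 0 z t -> `|t| < s.
  by move=> zs /between_dist; rewrite !subr0 => /le_lt_trans; apply.
have gt_r z : `|z| < s -> - r < z.
  by rewrite ltr_norml => /andP[+ _]; apply: le_lt_trans; rewrite lerN2.
have g0 : `|0 : R| < s by rewrite normr0.
have [t /(near0 _ _ xs) ts e1] := mean_value (@dH 0) (gt_r _ g0) (gt_r _ xs).
have [u /(near0 _ _ ys) us e2] := mean_value (@dV x) (gt_r _ g0) (gt_r _ ys).
rewrite /potential e1 e2 (vPQ _ _ ts g0).1 (vPQ _ _ xs us).2 !mul0r.
exact: addr0.
Qed.

Local Open Scope ring_scope.

(** * Moduli and complex derivatives *)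

Section ComplexNorm.
Context {R : realType}.
Local Notation C := (Cplx R).
Local Notation Re := complex.Re.
Local Notation Im := complex.Im.
Implicit Types (z w p q h : C).

(** The modulus as a real number; the norm on C takes its values in C. *)
Definition nm z : R := Normc.normc z.

Lemma normE z : `|z| = (nm z)%:C%C.
Proof. by []. Qed.

Lemma nm_ge0 z : 0 <= nm z.
Proof. by rewrite -ler0c -normE. Qed.

Lemma nm0 : nm 0 = 0. Proof. exact: Normc.normc0. Qed.
Lemma nm1 : nm 1 = 1. Proof. exact: Normc.normc1. Qed.

Lemma nm_eq0 z : (nm z == 0) = (z == 0).
Proof. by apply/eqP/eqP => [/Normc.eq0_normc//|->]; exact: nm0. Qed.

Lemma nm_gt0 z : (0 < nm z) = (z != 0).
Proof. by rewrite lt_def nm_eq0 nm_ge0 andbT. Qed.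

Lemma nmD z w : nm (z + w) <= nm z + nm w.
Proof. exact: le_normcD. Qed.

Lemma nmM z w : nm (z * w) = nm z * nm w.
Proof. exact: Normc.normcM. Qed.

Lemma nmN z : nm (- z) = nm z.
Proof. exact: normcN. Qed.

Lemma nmB z w : nm (z - w) <= nm z + nm w.
Proof. by rewrite -(nmN w) nmD. Qed.

Lemma nmC z w : nm (z - w) = nm (w - z).
Proof. by rewrite -nmN opprB. Qed.

Lemma nmV z : nm z^-1 = (nm z)^-1.
Proof. exact: Normc.normcV. Qed.

Lemma nmX z n : nm (z ^+ n) = nm z ^+ n.
Proof. by elim: n => [|n IH]; rewrite ?expr0 ?nm1 // !exprS nmM IH. Qed.

Lemma nm_def z : nm z = Num.sqrt (Re z ^+ 2 + Im z ^+ 2).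
Proof. by case: z. Qed.

Lemma sqr_nm z : nm z ^+ 2 = Re z ^+ 2 + Im z ^+ 2.
Proof. by rewrite nm_def sqr_sqrtr // addr_ge0 // sqr_ge0. Qed.

Lemma nm_real (x : R) : nm x%:C%C = `|x|.
Proof. by rewrite nm_def /= expr0n addr0 sqrtr_sqr. Qed.

Lemma nmI : nm 'i%C = 1.
Proof. by rewrite nm_def /= expr0n expr1n add0r sqrtr1. Qed.

Lemma Re_le_nm z : `|Re z| <= nm z.
Proof.
by rewrite nm_def -sqrtr_sqr ler_wsqrtr // lerDl sqr_ge0.
Qed.

Lemma Im_le_nm z : `|Im z| <= nm z.
Proof.
by rewrite nm_def -sqrtr_sqr ler_wsqrtr // lerDr sqr_ge0.
Qed.

Lemma nm_le_ReIm z : nm z <= `|Re z| + `|Im z|.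
Proof.
rewrite -ler_sqr ?nnegrE ?nm_ge0 ?addr_ge0 // sqr_nm.
rewrite -(real_normK (num_real (Re z))) -(real_normK (num_real (Im z))).
have := normr_ge0 (Re z); have := normr_ge0 (Im z); nra.
Qed.

Lemma cReD z w : Re (z + w) = Re z + Re w. Proof. by case: z; case: w. Qed.
Lemma cImD z w : Im (z + w) = Im z + Im w. Proof. by case: z; case: w. Qed.
Lemma cReN z : Re (- z) = - Re z. Proof. by case: z. Qed.
Lemma cImN z : Im (- z) = - Im z. Proof. by case: z. Qed.
Lemma cReM z w : Re (z * w) = Re z * Re w - Im z * Im w.
Proof. by case: z; case: w. Qed.
Lemma cImM z w : Im (z * w) = Re z * Im w + Im z * Re w.
Proof. by case: z; case: w. Qed.
Lemma Cplx_eq z w : Re z = Re w -> Im z = Im w -> z = w.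
Proof. by case: z => a b; case: w => c d /= -> ->. Qed.

Lemma nearC p (P : C -> Prop) : (\forall q \near p, P q) <->
  exists2 d : R, 0 < d & forall q, nm (q - p) < d -> P q.
Proof.
split=> [/nbhs_normP[e /= e0 eP]|[d d0 dP]].
  have eE : e = (Re e)%:C%C by rewrite RRe_real // gtr0_real.
  have re0 : 0 < Re e by rewrite -ltcR -eE.
  exists (Re e) => // q qd; apply: eP => /=.
  by rewrite normE eE ltcR nmC.
apply/nbhs_normP; exists d%:C%C => /=; first by rewrite ltcR.
by move=> q /=; rewrite normE ltcR nmC => /dP.
Qed.

Definition has_deriv (f : C -> C) p l := forall e : R, 0 < e ->
  exists2 d : R, 0 < d & forall h, nm h < d ->
    nm (f (p + h) - f p - l * h) <= e * nm h.

Lemma has_derivP (f : C -> C) p : differentiable f p <-> exists l, has_deriv f p l.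
Proof.
split=> [df|[l dl]].
  exists ('d f p 1) => e e0.
  have /diff_locally/eqaddoP /(_ e%:C%C) := df.
  rewrite /= ltcR => /(_ e0) /nearC[d d0 dP]; exists d => // h hd.
  have := dP h; rewrite subr0 => /(_ hd) /=.
  rewrite !fctE /= !normE -rmorphM /= lecR [h + p]addrC; congr (nm _ <= _).
  by rewrite opprD addrA -[in 'd f p h](mulr1 h) [in LHS]linearZ /= [h *: _]mulrC.
have lin_scal : linear (fun h : C => l * h : C).
  by move=> a x y; rewrite /GRing.scale /=; ring.
pose scallM := GRing.isLinear.Build _ _ _ _ _ lin_scal.
pose scalL : {linear C -> C} := HB.pack (fun h : C => l * h : C) scallM.
have cL : continuous scalL.
  by move=> x; exact: mulrl_continuous.
have fl : f \o shift p = cst (f p) + scalL +o_ 0 id.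
  apply/eqaddoP => e; move=> e0.
  have eE : e = (Re e)%:C%C by rewrite RRe_real // gtr0_real.
  have re0 : 0 < Re e by rewrite -ltcR -eE.
  have [d d0 dP] := dl _ re0; apply/nearC; exists d => // h; rewrite subr0 => hd.
  rewrite eE !fctE /= !normE -rmorphM /= lecR [h + p]addrC opprD addrA.
  exact: dP.
apply/diff_locallyP; rewrite (diff_unique cL fl); split => //.
Qed.

End ComplexNorm.
Section Primitive.
Context {R : realType}.
Local Notation C := (Cplx R).
Local Notation Re := complex.Re.
Local Notation Im := complex.Im.
Variables (f : C -> C) (r : R).
Hypothesis r0 : 0 < r.
Hypothesis df : forall z : C, `|Re z| <= r -> `|Im z| <= r ->
  exists l, has_deriv f z l.

Let clamp (t : R) : R := Num.max (- r) (Num.min r t).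

Lemma clamp_norm t : `|clamp t| <= r.
Proof.
rewrite ler_norml /clamp le_max lexx /= ge_max ge_min lexx /=.
by rewrite (le_trans _ (ltW r0)) // oppr_le0 ltW.
Qed.

Lemma clamp_id t : `|t| < r -> clamp t = t.
Proof.
rewrite ltr_norml => /andP[a b].
by rewrite /clamp (min_idPr (ltW b)) (max_idPr (ltW a)).
Qed.

Lemma clamp_dist s t : `|clamp s - clamp t| <= `|s - t|.
Proof.
wlog st : s t / s <= t => [th|].
  have [/th//|/ltW/th] := leP s t.
  by rewrite distrC [`|t - s|]distrC.
rewrite distrC [`|s - t|]distrC.
have [A B] : clamp s <= clamp t /\ clamp t - clamp s <= t - s; last first.
  by rewrite !ger0_norm // subr_ge0.
rewrite /clamp; case: (leP r s) => a; case: (leP r t) => b;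
  try (case: (leP (- r) r) => c); try (case: (leP (- r) s) => d);
  try (case: (leP (- r) t) => e); split; lra.
Qed.

(** The extension of f from the square by projection makes its restrictions to
    lines continuous everywhere. *)
Let ft (x y : R) : C := f (clamp x +i* clamp y)%C.

Lemma has_deriv_cvg (g : C -> C) z l : has_deriv g z l -> forall e : R, 0 < e ->
  exists2 d : R, 0 < d & forall h, nm h < d -> nm (g (z + h) - g z) < e.
Proof.
move=> dl e e0; have [d d0 dP] := dl 1 ltr01.
have k0 : 0 < nm l + 1 by have := nm_ge0 l; lra.
exists (Num.min d (e / (nm l + 1))); first by rewrite lt_min d0 divr_gt0.
move=> h; rewrite lt_min => /andP[/dP A]; rewrite ltr_pdivlMr // => B.
rewrite -(subrK (l * h) (_ - _)); apply: le_lt_trans (nmD _ _) _.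
by rewrite nmM; move: A; rewrite mul1r; lra.
Qed.

Lemma ft_continuous (x y e : R) : 0 < e -> exists2 d : R, 0 < d &
  forall s t, `|s - x| + `|t - y| < d -> nm (ft s t - ft x y) < e.
Proof.
move=> e0.
have [|| l /has_deriv_cvg/(_ _ e0)[d d0 dP]] := @df (clamp x +i* clamp y)%C.
- exact: clamp_norm.
- exact: clamp_norm.
exists d => // s t st.
have := dP ((clamp s - clamp x) +i* (clamp t - clamp y))%C.
have -> : (clamp x +i* clamp y + (clamp s - clamp x) +i* (clamp t - clamp y))%C
          = (clamp s +i* clamp t)%C :> C.
  by apply: Cplx_eq => /=; ring.
apply; apply: le_lt_trans (nm_le_ReIm _) _ => /=.
by apply: le_lt_trans st; rewrite lerD // clamp_dist.
Qed.

Lemma ft_cont1 (y : R) (g : C -> R) : (forall z w, `|g z - g w| <= nm (z - w)) ->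
  continuous (fun x => g (ft x y)).
Proof.
move=> gl x; apply/cvgrPdist_lt => e e0.
have [d d0 dP] := ft_continuous x y e0.
apply/nbhs_normP; exists d => //= t xt.
apply: le_lt_trans (gl _ _) _; rewrite nmC; apply: dP.
by rewrite subrr normr0 addr0 distrC.
Qed.

Lemma ft_cont2 (x : R) (g : C -> R) : (forall z w, `|g z - g w| <= nm (z - w)) ->
  continuous (fun y => g (ft x y)).
Proof.
move=> gl y; apply/cvgrPdist_lt => e e0.
have [d d0 dP] := ft_continuous x y e0.
apply/nbhs_normP; exists d => //= t xt.
apply: le_lt_trans (gl _ _) _; rewrite nmC; apply: dP.
by rewrite subrr normr0 add0r distrC.
Qed.

Lemma Re_lip (z w : C) : `|Re z - Re w| <= nm (z - w).
Proof. by rewrite -cReN -cReD Re_le_nm. Qed.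
Lemma Im_lip (z w : C) : `|Im z - Im w| <= nm (z - w).
Proof. by rewrite -cImN -cImD Im_le_nm. Qed.
Lemma ImN_lip (z w : C) : `|- Im z - - Im w| <= nm (z - w).
Proof. by rewrite -opprD normrN Im_lip. Qed.

Lemma ft_jet (x y : R) l : `|x| < r -> `|y| < r ->
  has_deriv f (x +i* y)%C l -> forall e : R, 0 < e ->
  exists2 d : R, 0 < d & forall s t : R, `|s| < d -> `|t| < d ->
    nm (ft (x + s) (y + t) - ft x y - l * (s +i* t)%C) <= e * (`|s| + `|t|).
Proof.
move=> xr yr dl e e0; have [d d0 dP] := dl e e0.
exists (Num.min (d / 2) (Num.min (r - `|x|) (r - `|y|))).
  by rewrite !lt_min divr_gt0 //= !subr_gt0 xr.
move=> s t; rewrite !lt_min => /andP[s1 /andP[s2 _]] /andP[t1 /andP[_ t2]].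
have n1 : nm (s +i* t)%C <= `|s| + `|t| by have := nm_le_ReIm (s +i* t)%C.
rewrite /ft !clamp_id //; last 2 first.
- by apply: le_lt_trans (ler_normD _ _) _; rewrite -ltrBrDl.
- by apply: le_lt_trans (ler_normD _ _) _; rewrite -ltrBrDl.
have -> : ((x + s) +i* (y + t))%C = (x +i* y)%C + (s +i* t)%C :> C by [].
apply: le_trans (dP _ _) _; last by rewrite ler_pM2l.
by apply: le_lt_trans n1 _; lra.
Qed.

(** By the Cauchy-Riemann equations the real part of f dz is closed; so is the
    imaginary part (ft_jetIm). *)
Lemma ft_jetRe (x y : R) l : `|x| < r -> `|y| < r ->
  has_deriv f (x +i* y)%C l ->
  closed_jet (fun s t => Re (ft s t)) (fun s t => - Im (ft s t)) x y
    (Re l) (- Im l) (- Re l).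
Proof.
move=> xr yr dl e e0; have [d d0 dP] := ft_jet xr yr dl e0.
exists d => // s t /dP + /[dup] => /[apply] A _; split; apply: le_trans A.
  apply: le_trans (Re_le_nm _); rewrite !cReD !cReN cReM /= le_eqVlt.
  by apply/orP; left; apply/eqP; congr `| _ |; ring.
apply: le_trans (Im_le_nm _); rewrite -normrN !cImD !cImN cImM /= le_eqVlt.
by apply/orP; left; apply/eqP; congr `| _ |; ring.
Qed.

Lemma ft_jetIm (x y : R) l : `|x| < r -> `|y| < r ->
  has_deriv f (x +i* y)%C l ->
  closed_jet (fun s t => Im (ft s t)) (fun s t => Re (ft s t)) x y
    (Im l) (Re l) (- Im l).
Proof.
move=> xr yr dl e e0; have [d d0 dP] := ft_jet xr yr dl e0.
exists d => // s t /dP + /[dup] => /[apply] A _; split; apply: le_trans A.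
  apply: le_trans (Im_le_nm _); rewrite !cImD !cImN cImM /= le_eqVlt.
  by apply/orP; left; apply/eqP; congr `| _ |; ring.
apply: le_trans (Re_le_nm _); rewrite !cReD !cReN cReM /= le_eqVlt.
by apply/orP; left; apply/eqP; congr `| _ |; ring.
Qed.

(** The primitive has an expansion of order two, one order more than is known
    of f. *)
Lemma complex_primitive : exists2 F : C -> C, (forall z l,
  `|Re z| < r -> `|Im z| < r -> has_deriv f z l -> forall e : R, 0 < e ->
  exists2 d : R, 0 < d & forall h, nm h < d ->
    nm (F (z + h) - F z - f z * h - l * h ^+ 2 / 2) <= e * nm h ^+ 2)
  & forall s : R, s <= r ->
      (forall z, `|Re z| < s -> `|Im z| < s -> f z = 0) ->
      forall z, `|Re z| < s -> `|Im z| < s -> F z = 0.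
Proof.
have dj (x y : R) : `|x| < r -> `|y| < r -> exists l, has_deriv f (x +i* y)%C l.
  by move=> xr yr; apply: df => /=; apply: ltW.
have [||x y xr yr|U UP U0] := @closed_field_potential R (fun s t => Re (ft s t))
    (fun s t => - Im (ft s t)) r.
- by move=> y; exact: (@ft_cont1 y (fun z => Re z) Re_lip).
- by move=> x; exact: (@ft_cont2 x (fun z => - Im z) ImN_lip).
- have [l dl] := dj x y xr yr.
  by exists (Re l), (- Im l), (- Re l); exact: ft_jetRe.
have [||x y xr yr|V VP V0] := @closed_field_potential R (fun s t => Im (ft s t))
    (fun s t => Re (ft s t)) r.
- by move=> y; exact: (@ft_cont1 y (fun z => Im z) Im_lip).
- by move=> x; exact: (@ft_cont2 x (fun z => Re z) Re_lip).
- have [l dl] := dj x y xr yr.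
  by exists (Im l), (Re l), (- Im l); exact: ft_jetIm.
exists (fun z => U (Re z) (Im z) +i* V (Re z) (Im z))%C; last first.
  move=> s sr vf z xs ys.
  have ft0 x y : `|x| < s -> `|y| < s -> ft x y = 0.
    move=> xs' ys'; rewrite /ft !clamp_id; last 2 first.
    - exact: lt_le_trans sr.
    - exact: lt_le_trans sr.
    exact: vf.
  rewrite (U0 _ sr _ _ _ xs ys) ?(V0 _ sr _ _ _ xs ys) // => x y xs' ys';
    by rewrite ft0 //= oppr0.
move=> z l; case: z => x y /= xr yr dl e e0.
have e8 : 0 < e / 8 by lra.
have [d1 d10 D1] := UP _ _ _ _ _ _ xr yr (ft_jetRe xr yr dl) e8.
have [d2 d20 D2] := VP _ _ _ _ _ _ xr yr (ft_jetIm xr yr dl) e8.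
exists (Num.min d1 d2); first by rewrite lt_min d10.
move=> h hd.
have [sd1 sd2] : `|Re h| < d1 /\ `|Re h| < d2.
  by apply/andP; rewrite -lt_min; apply: le_lt_trans hd; exact: Re_le_nm.
have [td1 td2] : `|Im h| < d1 /\ `|Im h| < d2.
  by apply/andP; rewrite -lt_min; apply: le_lt_trans hd; exact: Im_le_nm.
have := D1 _ _ sd1 td1; have := D2 _ _ sd2 td2.
have -> : ft x y = f (x +i* y)%C by rewrite /ft !clamp_id.
case: h {hd} sd1 sd2 td1 td2 => s t /= sd1 sd2 td1 td2.
set A := (X in `|X|) => Ab; set B := (X in `|X|) => Bb.
apply: le_trans (nm_le_ReIm _) _.
set q := (X in `|Re X| + _).
have hf : Re (l * (s +i* t)%C ^+ 2 / 2) =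
    (Re l * s ^+ 2 - 2 * Im l * s * t - Re l * t ^+ 2) / 2 /\
    Im (l * (s +i* t)%C ^+ 2 / 2) =
    (Im l * s ^+ 2 + 2 * Re l * s * t - Im l * t ^+ 2) / 2.
  have -> : l * (s +i* t)%C ^+ 2 / 2 = l * (s +i* t)%C ^+ 2 * (2^-1 : R)%:C%C :> C.
    by rewrite fmorphV /= rmorph_nat.
  by rewrite expr2 !(cReM, cImM) /=; split; field.
have -> : Re q = B.
  by rewrite /q /B !(cReD, cReN) hf.1 cReM /=; field.
have -> : Im q = A.
  by rewrite /q /A !(cImD, cImN) hf.2 cImM /=; field.
have st : (`|s| + `|t|) ^+ 2 <= 4 * nm (s +i* t)%C ^+ 2.
  rewrite sqr_nm /= -(real_normK (num_real s)) -(real_normK (num_real t)).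
  have := sqr_ge0 (`|s| - `|t|); set a := `|s|; set b := `|t|; nra.
apply: le_trans (lerD Bb Ab) _.
have -> : nm (s +i* t)%C ^+ 2 = nm (s +i* t)%C ^+ 2 by [].
have := ler_wpM2l (ltW e8) st; lra.
Qed.
End Primitive.

(** * Maximum principle and identity theorem *)

Section Identity.
Context {R : realType}.
Local Notation C := (Cplx R).
Local Notation Re := complex.Re.
Local Notation Im := complex.Im.

Definition has_jet2 (H : C -> C) z a b := forall e : R, 0 < e ->
  exists2 d : R, 0 < d & forall h, nm h < d ->
    nm (H (z + h) - H z - a * h - b * h ^+ 2) <= e * nm h ^+ 2.

Lemma has_jet2_divX (H : C -> C) z a b : z != 0 -> has_jet2 H z a b ->
  exists a' b', has_jet2 (fun w => H w / w) z a' b'.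
Proof.
move=> z0 Hj; pose c0 := H z / z; pose c1 := (a - c0) / z; pose c2 := (b - c1) / z.
exists c1, c2 => e e0; have nz : 0 < nm z by rewrite nm_gt0.
have [|d d0 dP] := Hj (e * nm z / 4); first by rewrite divr_gt0 ?mulr_gt0.
have k0 : 0 < nm c2 + 1 by have := nm_ge0 c2; lra.
exists (Num.min d (Num.min (nm z / 2) (e * nm z / (4 * (nm c2 + 1))))).
  by rewrite !lt_min d0 /= !divr_gt0 ?mulr_gt0.
move=> h; rewrite !lt_min => /andP[/dP hd /andP[h1 h2]].
have nzh : nm z / 2 <= nm (z + h).
  by have := nmB (z + h) h; rewrite addrK; lra.
have zh0 : z + h != 0 by rewrite -nm_gt0; lra.
have -> : H (z + h) / (z + h) - H z / z - c1 * h - c2 * h ^+ 2 =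
  (H (z + h) - H z - a * h - b * h ^+ 2 - c2 * h ^+ 3) / (z + h).
  by rewrite /c2 /c1 /c0; field; rewrite z0 zh0.
rewrite nmM nmV ler_pdivrMr; last by rewrite nm_gt0.
apply: le_trans (nmB _ _) _; rewrite nmM nmX.
have nh := nm_ge0 h; have nc := nm_ge0 c2.
move: h2; rewrite ltr_pdivlMr ?mulr_gt0 // => h2.
have A : nm c2 * nm h ^+ 3 <= e * nm z / 4 * nm h ^+ 2.
  by rewrite exprSr mulrA mulrAC ler_wpM2r ?sqr_ge0 //; nra.
have B : e * (nm z / 2) * nm h ^+ 2 <= e * nm h ^+ 2 * nm (z + h).
  by rewrite mulrAC ler_wpM2l // mulr_ge0 ?sqr_ge0 // ltW.
lra.
Qed.

Lemma has_jet2_near (H G : C -> C) z a b (s : R) : 0 < s ->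
  (forall w, nm (w - z) < s -> H w = G w) -> has_jet2 H z a b -> has_jet2 G z a b.
Proof.
move=> s0 HG Hj e /Hj[d d0 dP]; exists (Num.min s d); first by rewrite lt_min s0.
move=> h; rewrite lt_min => /andP[hs /dP]; rewrite !HG //.
  by rewrite subrr nm0.
by rewrite [z + h]addrC addrK.
Qed.

Lemma has_jet2_cvg (H : C -> C) z a b : has_jet2 H z a b -> forall e : R, 0 < e ->
  exists2 d : R, 0 < d & forall h, nm h < d -> nm (H (z + h) - H z) < e.
Proof.
move=> Hj e e0; have [d d0 dP] := Hj 1 ltr01.
have k0 : 0 < 1 + nm a + nm b + 1 by have := nm_ge0 a; have := nm_ge0 b; lra.
exists (Num.min d (Num.min 1 (e / (1 + nm a + nm b + 1)))).
  by rewrite !lt_min d0 ltr01 divr_gt0.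
move=> h; rewrite !lt_min ltr_pdivlMr // => /andP[/dP hd /andP[h1 h2]].
have -> : H (z + h) - H z = H (z + h) - H z - a * h - b * h ^+ 2
    + (a * h + b * h ^+ 2) by ring.
apply: le_lt_trans (nmD _ _) _.
have A : nm (a * h + b * h ^+ 2) <= nm a * nm h + nm b * nm h ^+ 2.
  by rewrite -nmX -!nmM nmD.
rewrite mul1r in hd.
have B : nm h ^+ 2 <= nm h by rewrite expr2; have := nm_ge0 h; nra.
have D := ler_wpM2l (nm_ge0 b) B.
by move: (nm_ge0 h); lra.
Qed.

Lemma has_jet2_continuous (H : C -> C) (p : R * R) a b :
  has_jet2 H (p.1 +i* p.2)%C a b ->
  forall g : C -> R, (forall z w, `|g z - g w| <= nm (z - w)) ->
  {for p, continuous (fun p : R * R => g (H (p.1 +i* p.2)%C))}.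
Proof.
move=> Hab g gl; apply/cvgrPdist_lt => e' e'0.
have [d d0 dP] := has_jet2_cvg Hab e'0.
have d2 : 0 < d / 2 by rewrite divr_gt0.
exists (ball p.1 (d / 2), ball p.2 (d / 2)).
  by split; exact: nbhsx_ballx.
move=> q /= [q1 q2]; rewrite (le_lt_trans (gl _ _)) // nmC.
have := dP ((q.1 - p.1) +i* (q.2 - p.2))%C.
have -> : (p.1 +i* p.2 + (q.1 - p.1) +i* (q.2 - p.2))%C
    = (q.1 +i* q.2)%C :> C by apply: Cplx_eq => /=; ring.
apply; apply: le_lt_trans (nm_le_ReIm _) _ => /=.
move: q1 q2; rewrite /ball /= distrC [`|p.2 - _|]distrC => q1 q2.
lra.
Qed.

(** Otherwise Re (c H) + eps |z|^2 would have an interior maximum z0. Adding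
    the values at z0 + t, z0 - t, z0 + i t, z0 - i t cancels the terms of
    order one and two of H, but the second summand adds 4 eps t^2 to four
    times the value at z0. *)
Lemma max_principle (H : C -> C) (rho B : R) (c : C) : 0 < rho -> nm c = 1 ->
  (forall z, `|Re z| <= rho -> `|Im z| <= rho -> exists a b, has_jet2 H z a b) ->
  (forall z, `|Re z| <= rho -> `|Im z| <= rho ->
     (`|Re z| == rho) || (`|Im z| == rho) -> nm (H z) <= B) ->
  forall z, `|Re z| <= rho -> `|Im z| <= rho -> Re (c * H z) <= B.
Proof.
move=> rho0 c1 Hj HB z zx zy; apply/ler_addgt0Pr => e e0.
pose eps := e / (2 * rho ^+ 2).
have eps0 : 0 < eps by rewrite divr_gt0 // mulr_gt0 // exprn_gt0.
pose phi (p : R * R) := Re (c * H (p.1 +i* p.2)%C) + eps * (p.1 ^+ 2 + p.2 ^+ 2).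
pose A : set (R * R) := `[- rho, rho] `*` `[- rho, rho].
have AP (p : R * R) : A p <-> `|p.1| <= rho /\ `|p.2| <= rho.
  by rewrite /A /= !in_itv /= -!ler_norml.
have cH p : A p -> {for p, continuous (fun p : R * R => Re (c * H (p.1 +i* p.2)%C))}.
  move=> /AP[p1 p2]; have [a [b Hab]] := Hj (p.1 +i* p.2)%C p1 p2.
  apply: (@has_jet2_continuous H p a b Hab (fun w => Re (c * w))) => u w.
  by rewrite -cReN -cReD -mulrBr (le_trans (Re_le_nm _)) // nmM c1 mul1r.
have cphi : {within A, continuous phi}.
  apply: continuous_in_subspaceT => p; rewrite inE => /cH cp.
  apply: cvgD; first exact: cp.
  apply: cvgM; first exact: cvg_cst.
  by apply: cvgD; apply: cvgM; (exact: cvg_fst || exact: cvg_snd).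
have cA : compact A by apply: compact_setX; exact: segment_compact.
have A0 : A !=set0 by exists (0, 0); apply/AP; rewrite normr0 ltW.
have [[x0 y0] /set_mem/AP[/= xr yr] mx] := compact_EVT_max A0 cA cphi.
have bd : phi (x0, y0) <= B + e.
  pose z0 : C := (x0 +i* y0)%C.
  have [bd|] := boolP ((`|x0| == rho) || (`|y0| == rho)).
    have Hz : nm (H z0) <= B by apply: HB.
    have q1 : Re (c * H z0) <= B.
      apply: le_trans (ler_norm _) _; apply: le_trans (Re_le_nm _) _.
      by rewrite nmM c1 mul1r.
    have q2 : eps * (x0 ^+ 2 + y0 ^+ 2) <= e.
      have -> : e = eps * (2 * rho ^+ 2).
        by rewrite /eps mulfVK // mulf_neq0 // expf_neq0 // gt_eqF.
      rewrite ler_pM2l // mulr2n mulrDl mul1r.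
      by rewrite lerD // -real_normK ?num_real // lerXn2r // nnegrE // ltW.
    by rewrite /phi /= lerD.
  rewrite negb_or => /andP[xn yn].
  have xlt : `|x0| < rho by rewrite lt_neqAle xn.
  have ylt : `|y0| < rho by rewrite lt_neqAle yn.
  have [a [b Hab]] := Hj z0 xr yr.
  have [d d0 dP] := Hab (eps / 2) (divr_gt0 eps0 (ltr0Sn _ 1)).
  pose m := Num.min d (Num.min (rho - `|x0|) (rho - `|y0|)).
  have m0 : 0 < m by rewrite /m !lt_min d0 !subr_gt0 xlt.
  pose t := m / 2; have t0 : 0 < t by rewrite divr_gt0.
  have tm : t < m by rewrite /t; lra.
  move: tm; rewrite {1}/m !lt_min => /andP[td /andP[tx ty]].
  pose ti : C := (0 +i* t)%C; pose tr : C := (t +i* 0)%C.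
  have ntr : nm tr = t by rewrite nm_def /= expr0n addr0 sqrtr_sqr gtr0_norm.
  have nti : nm ti = t by rewrite nm_def /= expr0n add0r sqrtr_sqr gtr0_norm.
  have step (h : C) : nm h = t ->
      Re (c * (H z0 + a * h + b * h ^+ 2)) - eps / 2 * t ^+ 2
      + eps * ((x0 + Re h) ^+ 2 + (y0 + Im h) ^+ 2) <= phi (x0, y0).
    move=> ht.
    have hx := Re_le_nm h; have hy := Im_le_nm h; rewrite ht in hx hy.
    have iA : (x0 + Re h, y0 + Im h) \in A.
      rewrite inE; apply/AP => /=; split.
        by apply: le_trans (ler_normD _ _) _; lra.
      by apply: le_trans (ler_normD _ _) _; lra.
    apply: le_trans (mx _ iA); rewrite /phi /= lerD2r.
    have -> : ((x0 + Re h) +i* (y0 + Im h))%C = z0 + h :> C by case: (h).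
    have := dP h; rewrite ht => /(_ td) hd.
    have := Re_le_nm (c * (H (z0 + h) - H z0 - a * h - b * h ^+ 2)).
    rewrite nmM c1 mul1r => /le_trans/(_ hd); rewrite ler_norml => /andP[+ _].
    have -> : c * (H (z0 + h) - H z0 - a * h - b * h ^+ 2)
      = c * H (z0 + h) - c * (H z0 + a * h + b * h ^+ 2) by ring.
    by rewrite cReD cReN; lra.
  have := step tr ntr; have := step (- tr); rewrite nmN => /(_ ntr).
  have := step ti nti; have := step (- ti); rewrite nmN => /(_ nti).
  have e1 : ti ^+ 2 = - tr ^+ 2 by apply: Cplx_eq; rewrite !expr2 /=; ring.
  rewrite !sqrrN !(mulrN a) e1 !(mulrN b) /=.
  have sR : Re (c * (H z0 + a * ti - b * tr ^+ 2)) +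
    Re (c * (H z0 - a * ti - b * tr ^+ 2)) +
    Re (c * (H z0 + a * tr + b * tr ^+ 2)) +
    Re (c * (H z0 - a * tr + b * tr ^+ 2)) = 4 * Re (c * H z0).
    rewrite -!cReD.
    have -> : 4 * Re (c * H z0) = Re (((4 : R)%:C)%C * (c * H z0)) by rewrite [RHS]cReM /= mul0r subr0.
    have -> : ((4 : R)%:C)%C = 4 :> C by rewrite rmorph_nat.
    by congr Re; ring.
  have pos : 0 < eps * t ^+ 2 by rewrite mulr_gt0 ?exprn_gt0.
  rewrite /phi /= -/z0; nra.
have zA : (Re z, Im z) \in A by rewrite inE; apply/AP.
have := mx _ zA => /le_trans/(_ bd); rewrite /phi /=.
have -> : (Re z +i* Im z)%C = z :> C by case: (z).
by apply: le_trans; rewrite lerDl mulr_ge0 ?(ltW eps0) // addr_ge0 ?sqr_ge0.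
Qed.

Lemma max_modulus (H : C -> C) (rho B : R) : 0 < rho ->
  (forall z, `|Re z| <= rho -> `|Im z| <= rho -> exists a b, has_jet2 H z a b) ->
  (forall z, `|Re z| <= rho -> `|Im z| <= rho ->
     (`|Re z| == rho) || (`|Im z| == rho) -> nm (H z) <= B) ->
  forall z, `|Re z| <= rho -> `|Im z| <= rho -> nm (H z) <= B.
Proof.
move=> rho0 Hj HB z zx zy.
have [Hz0|Hz0] := eqVneq (H z) 0.
  rewrite Hz0 nm0.
  have : nm (H (rho +i* 0)%C) <= B.
    by apply: HB => /=; rewrite ?normr0 ?(gtr0_norm rho0) ?eqxx // ltW.
  exact: le_trans (nm_ge0 _).
pose c : C := (nm (H z))%:C%C / H z.
have c1 : nm c = 1.
  by rewrite nmM nmV nm_real ger0_norm ?nm_ge0 // divff // nm_eq0.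
have := max_principle rho0 c1 Hj HB zx zy.
by rewrite /c divfK.
Qed.

Lemma has_jet2_bounded (F : C -> C) (rho : R) : 0 < rho ->
  (forall z, `|Re z| <= rho -> `|Im z| <= rho -> exists a b, has_jet2 F z a b) ->
  exists2 M : R, 0 <= M & forall z, `|Re z| <= rho -> `|Im z| <= rho -> nm (F z) <= M.
Proof.
move=> rho0 Fj.
pose A : set (R * R) := `[- rho, rho] `*` `[- rho, rho].
have AP (p : R * R) : A p <-> `|p.1| <= rho /\ `|p.2| <= rho.
  by rewrite /A /= !in_itv /= -!ler_norml.
have cA : compact A by apply: compact_setX; exact: segment_compact.
have A0 : A !=set0 by exists (0, 0); apply/AP; rewrite normr0 ltW.
have cF : {within A, continuous (fun p : R * R => nm (F (p.1 +i* p.2)%C))}.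
  apply: continuous_in_subspaceT => p; rewrite inE => /AP[p1 p2].
  have [a [b ab]] := Fj (p.1 +i* p.2)%C p1 p2.
  apply: (has_jet2_continuous ab) => z w; rewrite ler_norml.
  have := nmD (z - w) w; have := nmD (w - z) z; rewrite !subrK nmC => ? ?.
  by apply/andP; split; lra.
have [p _ mx] := compact_EVT_max A0 cA cF.
exists (nm (F (p.1 +i* p.2)%C)) => [|z zx zy]; first exact: nm_ge0.
have zA : (Re z, Im z) \in A by rewrite inE; apply/AP.
by have := mx _ zA; case: (z).
Qed.

Lemma eq0_of_le_pow (x M : R) : 0 <= x -> (forall n, x <= M * 2^-1 ^+ n) -> x = 0.
Proof.
move=> x0 xM; apply/eqP; rewrite eq_le x0 andbT leNgt; apply/negP => x_gt0.
by have [n] := @half_lt_eventually R M x x_gt0; rewrite ltNge xM.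
Qed.

(** The primitive F vanishes near 0, so F / z^n has expansions of order two
    everywhere, and max_modulus bounds F(z) by M (|z| / rho)^n for all n. For
    |z| < rho / 2 this gives F(z) = 0, hence f = F' = 0. *)
Lemma vanish_near0 (f : C -> C) (r : R) : 0 < r ->
  (forall z : C, `|Re z| <= r -> `|Im z| <= r -> exists l, has_deriv f z l) ->
  (exists2 s : R, 0 < s & forall z, nm z < s -> f z = 0) ->
  forall z, nm z < r / 4 -> f z = 0.
Proof.
move=> r0 df [s0 s00 f0].
have [F FP F0] := complex_primitive r0 df.
pose s := Num.min r (s0 / 2).
have s_gt0 : 0 < s by rewrite lt_min r0 divr_gt0.
have sr : s <= r by rewrite ge_min lexx.
have Fs z : `|Re z| < s -> `|Im z| < s -> F z = 0.
  apply: F0 => // w wx wy; apply: f0; apply: le_lt_trans (nm_le_ReIm _) _.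
  move: wx wy; rewrite /s !lt_min => /andP[_ wx] /andP[_ wy]; lra.
have Fn z : nm z < s -> F z = 0.
  by move=> zs; apply: Fs; apply: le_lt_trans zs; [exact: Re_le_nm|exact: Im_le_nm].
pose rho := r / 2; have rho0 : 0 < rho by rewrite divr_gt0.
have rhor : rho < r by rewrite /rho; lra.
have Fj0 z : `|Re z| < r -> `|Im z| < r -> exists2 l, has_deriv f z l &
    has_jet2 F z (f z) (l / 2).
  move=> zx zy; have [l dl] := df z (ltW zx) (ltW zy); exists l => // e e0.
  have [d d0 dP] := FP z l zx zy dl e e0; exists d => // h /dP.
  by rewrite mulrAC.
have Fj z : `|Re z| <= rho -> `|Im z| <= rho -> exists a b, has_jet2 F z a b.
  move=> zx zy; have [||l _ j] := Fj0 z; [exact: le_lt_trans rhor..|].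
  by exists (f z), (l / 2).
have [M M0 FM] := has_jet2_bounded rho0 Fj.
have Hj n z : `|Re z| <= rho -> `|Im z| <= rho ->
    exists a b, has_jet2 (fun w => F w / w ^+ n) z a b.
  move=> zx zy; have [->|z0] := eqVneq z 0.
    exists 0, 0; apply: (@has_jet2_near (fun=> 0) _ _ _ _ s s_gt0).
      by move=> w; rewrite subr0 => /Fn ->; rewrite mul0r.
    move=> e e0; exists 1 => // h _; rewrite !mul0r !subr0 nm0.
    by rewrite mulr_ge0 ?sqr_ge0 // ltW.
  elim: n => [|n [a [b ab]]].
    have [a [b ab]] := Fj z zx zy; exists a, b.
    by apply: (has_jet2_near s_gt0 _ ab) => w _; rewrite expr0 divr1.
  have [a' [b' ab']] := has_jet2_divX z0 ab; exists a', b'.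
  by apply: (has_jet2_near s_gt0 _ ab') => w _; rewrite exprSr invfM mulrA.
have Fz0 z : nm z < r / 4 -> F z = 0.
  move=> zr; apply/eqP; rewrite -nm_eq0; apply/eqP.
  apply: (@eq0_of_le_pow _ M (nm_ge0 _)) => n.
  have zx : `|Re z| <= rho by have := Re_le_nm z; rewrite /rho; lra.
  have zy : `|Im z| <= rho by have := Im_le_nm z; rewrite /rho; lra.
  have [z0|z0] := eqVneq z 0.
    rewrite Fn ?nm0 ?z0 ?nm0 //.
    by rewrite mulr_ge0 // exprn_ge0 // invr_ge0.
  have Bd := @max_modulus (fun w => F w / w ^+ n) rho (M / rho ^+ n) rho0 (Hj n).
  have : nm (F z / z ^+ n) <= M / rho ^+ n.
    apply: Bd => // w wx wy wb; rewrite nmM nmV nmX.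
    have rw : rho <= nm w.
      have [/eqP <-|] := orP wb; first exact: Re_le_nm.
      by move=> /eqP <-; exact: Im_le_nm.
    apply: ler_pM; rewrite ?nm_ge0 ?invr_ge0 ?exprn_ge0 ?nm_ge0 ?FM //.
    rewrite lef_pV2 ?posrE ?exprn_gt0 ?(lt_le_trans rho0) //.
    by rewrite lerXn2r // nnegrE ?nm_ge0 // ltW.
  rewrite nmM nmV nmX ler_pdivrMr ?exprn_gt0 ?nm_gt0 //.
  move=> /le_trans; apply; rewrite -mulrA ler_wpM2l //.
  rewrite -exprVn -exprMn lerXn2r ?nnegrE ?mulr_ge0 ?invr_ge0 ?nm_ge0 ?(ltW rho0) //.
  by rewrite /rho mulrC ler_pdivrMr // ; lra.
move=> z zr; apply/eqP; rewrite -nm_eq0; apply/eqP.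
have [|| l _ j] := Fj0 z.
- by have := Re_le_nm z; lra.
- by have := Im_le_nm z; lra.
have [d d0 dP] := j 1 ltr01.
have m0 : 0 < Num.min d (r / 4 - nm z) by rewrite lt_min d0 subr_gt0.
apply: (@eq0_of_le_pow _ ((1 + nm (l / 2)) * (Num.min d (r / 4 - nm z)))) => [|n].
  exact: nm_ge0.
set m := Num.min _ _ in m0 *.
have k0 : 0 < 2^-1 ^+ n :> R by rewrite exprn_gt0 // invr_gt0.
have k1 : 2^-1 ^+ n <= 1 :> R by rewrite exprn_ile1 // ?invr_ge0 // invf_le1 // ler1n.
pose t : R := m * 2^-1 ^+ n / 2.
have t0 : 0 < t by rewrite divr_gt0 // mulr_gt0.
have tm : t < m.
  have : m * 2^-1 ^+ n <= m * 1 by rewrite ler_pM2l.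
  by rewrite /t mulr1; lra.
have nt : nm (t%:C)%C = t by rewrite nm_real gtr0_norm.
move: tm; rewrite /m lt_min -/m => /andP[td tr].
have := dP (t%:C)%C; rewrite nt => /(_ td).
rewrite (Fz0 z zr) Fz0; last first.
  by apply: le_lt_trans (nmD _ _) _; rewrite nt; lra.
rewrite subrr sub0r -opprD nmN mul1r => A.
have B : nm (f z) * t <= (1 + nm (l / 2)) * t ^+ 2.
  rewrite -{1}nt -nmM -(addrK (l / 2 * (t%:C)%C ^+ 2) (_ * _)).
  apply: le_trans (nmB _ _) _; rewrite mulrDl mul1r lerD //.
  by rewrite nmM nmX nt.
have : nm (f z) <= (1 + nm (l / 2)) * t.
  by move: B; rewrite expr2 mulrA ler_pM2r.
move=> /le_trans; apply; rewrite -mulrA ler_wpM2l //.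
  by have := nm_ge0 (l / 2); lra.
have := mulr_gt0 m0 k0; rewrite /t; move: (m * _) => q q0; lra.
Qed.

Lemma vanish_near (f : C -> C) (p : C) (r : R) : 0 < r ->
  (forall z, nm (z - p) < 3 * r -> differentiable f z) ->
  (\forall q \near p, f q = 0) -> forall z, nm (z - p) < r / 4 -> f z = 0.
Proof.
move=> r0 df /nearC[s s0 f0] z zp.
have := @vanish_near0 (fun w => f (w + p)) r r0 _ _ (z - p) zp.
rewrite subrK; apply.
  move=> w wx wy; have /has_derivP[l dl] : differentiable f (w + p).
    apply: df; rewrite addrK; apply: le_lt_trans (nm_le_ReIm _) _; lra.
  exists l => e /dl[d d0 dP]; exists d => // h /dP.
  by rewrite [w + h + p]addrAC.
by exists s => // w ws; apply: f0; rewrite addrK.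
Qed.

(** The radius of the disc of vanishing in vanish_near does not depend on how
    small the set of given zeros is. *)
Lemma nonzero_germ_near (f : C -> C) (p : C) : holomorphic_at f p ->
  nonzero_germ f p -> \forall q \near p, nonzero_germ f q.
Proof.
move=> /nearC[d d0 dP] nz; apply/nearC.
exists (d / 64); first by rewrite divr_gt0.
move=> q qp f0; apply: nz; apply/nearC.
exists (d / 64); first by rewrite divr_gt0.
move=> z zp; apply: (@vanish_near f q (d / 8)) => //.
- by rewrite divr_gt0.
- move=> w wq; apply: dP; have := nmD (w - q) (q - p).
  by rewrite addrA subrK; lra.
- have := nmD (z - p) (p - q); rewrite addrA subrK (nmC p); lra.
Qed.

Lemma differentiable_neq0 {V : normedModType C} (f : V -> C) q :
  differentiable f q -> f q != 0 -> \forall w \near q, f w != 0.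
Proof.
move=> /differentiable_continuous cf fq.
exact: (@cvgr_neq0 _ _ _ (nbhs q) _ f (f q) cf fq).
Qed.

(** Near a point where f is nonzero, f g = 0 implies that the germ of g
    vanishes. *)
Lemma nonzero_germM (f g : C -> C) (p : C) : holomorphic_at f p ->
  holomorphic_at g p -> nonzero_germ f p -> nonzero_germ g p ->
  nonzero_germ (fun q => f q * g q) p.
Proof.
move=> hf hg nf ng fg0; apply: nf.
have gg := nonzero_germ_near hg ng.
apply/nearC; have /nearC[d d0 dP] : \forall q \near p,
    [/\ differentiable f q, f q * g q = 0 & nonzero_germ g q].
  near=> q; split; [near: q; exact: hf|near: q; exact: fg0|near: q; exact: gg].
exists d => // q qp; apply: contrapT => /eqP fq.
have [df _ gq] := dP q qp; apply: gq.
have cf : \forall w \near q, f w != 0.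
  exact: differentiable_neq0 df fq.
apply/nearC; move: cf => /nearC[e e0 eP].
exists (Num.min e (d - nm (q - p))); first by rewrite lt_min e0 subr_gt0.
move=> w; rewrite lt_min => /andP[/eP fw wq].
have [|_ /eqP + _] := dP w.
  have := nmD (w - q) (q - p); rewrite addrA subrK; lra.
by rewrite mulf_eq0 (negbTE fw) => /eqP.
Unshelve. all: by end_near.
Qed.

Lemma entire_nonzero_germ (f : C -> C) (z0 : C) : (forall z, differentiable f z) ->
  f z0 != 0 -> forall p, nonzero_germ f p.
Proof.
move=> df /eqP f0 p fp; apply: f0.
apply: (@vanish_near f p (4 * nm (z0 - p) + 1)) => //.
  by have := nm_ge0 (z0 - p); lra.
by have := nm_ge0 (z0 - p); lra.
Qed.

End Identity.

(** * Exponential series *)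

Section Exponential.
Context {R : realType}.
Local Notation C := (Cplx R).
Local Notation Re := complex.Re.
Local Notation Im := complex.Im.
Implicit Types (z w p q h : C).

Lemma imagE : 'i = 'i%C :> C. Proof. by []. Qed.

Lemma cexpD z w : cexp (z + w) = cexp z * cexp w.
Proof.
by apply: Cplx_eq; rewrite /cexp ?cReM ?cImM /= !(cReD, cImD) expRD ?cosD ?sinD; ring.
Qed.

Lemma cexp0 : cexp (0 : C) = 1.
Proof. by rewrite /cexp /= expR0 cos0 sin0 mulr1 mulr0. Qed.

Lemma nm_cexp z : nm (cexp z) = expR (Re z).
Proof.
rewrite nm_def /= !exprMn -mulrDr cos2Dsin2 mulr1 sqrtr_sqr.
by rewrite gtr0_norm // expR_gt0.
Qed.

Lemma cexp_neq0 z : cexp z != 0.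
Proof. by rewrite -nm_gt0 nm_cexp expR_gt0. Qed.

Lemma cexpMn z n : cexp (z *+ n) = cexp z ^+ n.
Proof. by elim: n => [|n IH]; rewrite ?mulr0n ?cexp0 // mulrS cexpD exprS IH. Qed.

Lemma nm_cexp_le z : nm (cexp z) <= expR (nm z).
Proof. by rewrite nm_cexp ler_expR (le_trans (ler_norm _)) // Re_le_nm. Qed.

Lemma is_derive_cexp_line z h (t : R) :
  is_derive t (1 : R) (fun s : R => Re (z * cexp (s%:C%C * h)))
    (Re (z * h * cexp (t%:C%C * h))).
Proof.
case: h => x y; case: z => u v.
have dx (c : R) : is_derive t (1 : R) ( *%R^~ c) c.
  have := is_deriveZ c (is_derive_id t (1 : R)).
  rewrite /GRing.scale /= mulr1; congr is_derive.
  by apply/funext => s; rewrite mulrC.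
have de := @is_derive1_comp R expR ( *%R^~ x) t _ _ (is_derive_expR _) (dx x).
have dc := @is_derive1_comp R cos ( *%R^~ y) t _ _ (is_derive_cos _) (dx y).
have ds := @is_derive1_comp R sin ( *%R^~ y) t _ _ (is_derive_sin _) (dx y).
have d := is_deriveB (is_deriveZ u (is_deriveM de dc)) (is_deriveZ v (is_deriveM de ds)).
set D := (X in is_derive _ _ _ X).
rewrite (_ : (fun s : R => _) = u \*: ((expR \o *%R^~ x) * (cos \o *%R^~ y)) -
   v \*: ((expR \o *%R^~ x) * (sin \o *%R^~ y))).
  apply: (is_derive_eq d); rewrite /D /GRing.scale /= !mul0r !subr0 !addr0; ring.
apply/funext => s; rewrite /= !fctE /= /GRing.scale /= !mul0r subr0 addr0; ring.
Qed.

(** Two applications of the mean value theorem along the segment from 0 to h.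
    The factor z serves to extract the real part (z = 1) or the imaginary part
    (z = - i). *)
Lemma cexp_taylor1 (z h : C) : `|Re (z * (cexp h - 1 - h))| <= nm z * nm h ^+ 2 * expR (nm h).
Proof.
pose g (t : R) := Re (z * cexp (t%:C%C * h)).
have dg (t : R) : -1 < t -> is_derive t (1 : R) g (Re (z * h * cexp (t%:C%C * h))).
  by move=> _; exact: is_derive_cexp_line.
have N1 : -1 < 0 :> R by rewrite ltrN10.
have N2 : -1 < 1 :> R by rewrite (lt_trans N1).
have [t tb e1] := mean_value dg N1 N2.
have dg2 (s : R) : -1 < s -> is_derive s (1 : R) (fun t : R => Re (z * h * cexp (t%:C%C * h)))
    (Re (z * h * h * cexp (s%:C%C * h))).
  by move=> _; exact: is_derive_cexp_line.
have t01 : 0 <= t <= 1.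
  move: tb; rewrite /between (min_idPl _) ?(max_idPr _) //; exact: ler01.
have Nt : -1 < t by have := andP t01; lra.
have [u ub e2] := mean_value dg2 N1 Nt.
have u01 : 0 <= u <= 1.
  move: ub; rewrite /between; case/andP: t01 => ? ?.
  by rewrite (min_idPl _) ?(max_idPr _) // => /andP[? ?]; apply/andP; split; lra.
have -> : Re (z * (cexp h - 1 - h)) = Re (z * h * h * cexp (u%:C%C * h)) * t.
  move: e1 e2; rewrite /g !mul0r cexp0 !mul1r !mulr1 !subr0 mulr1 => e1 <-.
  by rewrite -e1 !mulrBr !(cReD, cReN) mulr1.
rewrite normrM; case/andP: t01 => t0 t1; case/andP: u01 => u0 u1.
rewrite (ger0_norm t0).
apply: le_trans (_ : nm (z * h * h * cexp (u%:C%C * h)) * 1 <= _).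
  by apply: ler_pM => //; exact: Re_le_nm.
rewrite mulr1 !nmM -(mulrA (nm z)) -expr2 ler_wpM2l ?mulr_ge0 ?nm_ge0 //.
apply: le_trans (nm_cexp_le _) _; rewrite ler_expR nmM nm_real ger0_norm //.
by rewrite ler_piMl ?nm_ge0.
Qed.

Lemma cexp_taylor (h : C) : nm (cexp h - 1 - h) <= 2 * (nm h ^+ 2 * expR (nm h)).
Proof.
apply: le_trans (nm_le_ReIm _) _; rewrite mulr2n mulrDl mul1r.
apply: lerD.
  by have := cexp_taylor1 1 h; rewrite mul1r nm1 mul1r.
have := cexp_taylor1 (- 'i%C) h; rewrite nmN nmI mul1r; congr (`| _ | <= _).
by rewrite cReM /=; ring.
Qed.

End Exponential.
Section ComplexSeries.
Context {R : realType}.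
Local Notation C := (Cplx R).
Local Notation Re := complex.Re.
Local Notation Im := complex.Im.
Implicit Types (u v : nat -> C) (l z w h : C).

Lemma cvgC u l : u @ \oo --> l <->
  forall e : R, 0 < e -> exists N, forall n, (N <= n)%N -> nm (u n - l) < e.
Proof.
split=> [/cvgrPdist_lt ul e e0|ul].
  have [|N _ NP] := ul e%:C%C; first by rewrite ltcR.
  by exists N => n /NP; rewrite normE ltcR nmC.
apply/cvgrPdist_lt => e e0.
have eE : e = (Re e)%:C%C by rewrite RRe_real // gtr0_real.
have re0 : 0 < Re e by rewrite -ltcR -eE.
have [N NP] := ul _ re0; exists N => // n /NP.
by rewrite eE normE ltcR nmC.
Qed.

Lemma cvgC_unique u l l' : u @ \oo --> l -> u @ \oo --> l' -> l = l'.
Proof. by move=> /cvg_lim <- //; move=> /cvg_lim <-. Qed.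

Lemma nm_sum (I : Type) (r : seq I) (P : pred I) (F : I -> C) :
  nm (\sum_(i <- r | P i) F i) <= \sum_(i <- r | P i) nm (F i).
Proof.
elim/big_ind2: _ => [|x a y b xa yb|//]; first by rewrite nm0.
exact: le_trans (nmD _ _) (lerD _ _).
Qed.

Lemma geometric_sum (M : R) n : \sum_(0 <= k < n) M * 2^-1 ^+ k = 2 * M * (1 - 2^-1 ^+ n).
Proof.
elim: n => [|n IH]; first by rewrite big_geq // expr0 subrr mulr0.
by rewrite big_nat_recr //= IH exprS; field.
Qed.

Lemma half_pow_gt0 n : 0 < 2^-1 ^+ n :> R.
Proof. by rewrite exprn_gt0 // invr_gt0. Qed.

Lemma geometric_sum_le (M : R) n : 0 <= M -> \sum_(0 <= k < n) M * 2^-1 ^+ k <= 2 * M.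
Proof.
move=> M0; by rewrite geometric_sum ler_piMr ?mulr_ge0 // gerBl ltW // half_pow_gt0.
Qed.

Lemma cvg_series_le_geometric (v : nat -> R) (M : R) :
  (forall k, `|v k| <= M * 2^-1 ^+ k) -> cvgn (series v).
Proof.
move=> vM; apply: normed_cvg.
apply: (@series_le_cvg _ _ (geometric M 2^-1)) => [n|n|n|].
- exact: normr_ge0.
- exact: le_trans (normr_ge0 _) (vM n).
- exact: vM.
- by apply: is_cvg_geometric_series; rewrite ger0_norm ?invr_ge0 // invf_lt1 // ltr1n.
Qed.

Lemma cseries_cvg u (M : R) : (forall k, nm (u k) <= M * 2^-1 ^+ k) ->
  exists2 l, series u @ \oo --> l & nm l <= 2 * M.
Proof.
move=> uM.
have M0 : 0 <= M by have := uM 0; rewrite expr0 mulr1; apply: le_trans; exact: nm_ge0.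
have /cvg_ex[/= a ca] := @cvg_series_le_geometric (fun k => Re (u k)) M
  (fun k => le_trans (Re_le_nm _) (uM k)).
have /cvg_ex[/= b cb] := @cvg_series_le_geometric (fun k => Im (u k)) M
  (fun k => le_trans (Im_le_nm _) (uM k)).
have Rs n : Re (series u n) = series (fun k => Re (u k)) n.
  rewrite /series /=; elim: n => [|n IH]; first by rewrite !big_geq.
  by rewrite !big_nat_recr //= cReD IH.
have Is n : Im (series u n) = series (fun k => Im (u k)) n.
  rewrite /series /=; elim: n => [|n IH]; first by rewrite !big_geq.
  by rewrite !big_nat_recr //= cImD IH.
pose l : C := (a +i* b)%C.
have cu : series u @ \oo --> l.
  apply/cvgC => e e0; have e2 : 0 < e / 2 by rewrite divr_gt0.
  move/cvgrPdist_lt: ca => /(_ _ e2)[N1 _ N1P].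
  move/cvgrPdist_lt: cb => /(_ _ e2)[N2 _ N2P].
  exists (maxn N1 N2) => n; rewrite geq_max => /andP[/N1P /= A /N2P /= B].
  apply: le_lt_trans (nm_le_ReIm _) _; rewrite cReD cImD cReN cImN Rs Is /=.
  by rewrite distrC in A; rewrite distrC in B; lra.
exists l => //; apply/ler_addgt0Pr => e e0.
move/cvgC: cu => /(_ e e0)[N /(_ N (leqnn _)) A].
rewrite -(subrK (series u N) l); apply: le_trans (nmD _ _) _.
rewrite addrC lerD //; last by rewrite nmC ltW.
apply: le_trans (nm_sum _ _ _) _; apply: le_trans (geometric_sum_le N M0).
by apply: ler_sum => k _.
Qed.

Lemma cvg_seriesD u v l l' : series u @ \oo --> l -> series v @ \oo --> l' ->
  series (fun k => u k + v k) @ \oo --> l + l'.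
Proof.
move=> cu cv.
have e : series (fun k => u k + v k) = (fun n => series u n + series v n).
  by apply/funext => n; rewrite /series /= big_split.
rewrite e; exact: (cvgD cu cv).
Qed.

Lemma cvg_seriesM u l w : series u @ \oo --> l ->
  series (fun k => w * u k) @ \oo --> w * l.
Proof.
move=> cu.
have e : series (fun k => w * u k) = (fun n => w * series u n).
  by apply/funext => n; rewrite /series /= big_distrr.
rewrite e; exact: (cvgM (cvg_cst w) cu).
Qed.

(** The coefficients c_k decay faster than any exponential in |a_k|, so that
    the series of the c_k exp(a_k z) and its formal derivative converge for
    all z. *)
Definition fast_decay (c a : nat -> C) := forall K : R, exists M : R, forall k,
  nm (c k) * expR (K * nm (a k)) <= M * 2^-1 ^+ k.

Definition exp_series (c a : nat -> C) z := limn (series (fun k => c k * cexp (a k * z))).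

Lemma fast_decay_cvg c a z : fast_decay c a ->
  series (fun k => c k * cexp (a k * z)) @ \oo --> exp_series c a z.
Proof.
move=> /(_ (nm z))[M MP].
have [|l cl _] := @cseries_cvg (fun k => c k * cexp (a k * z)) M.
  move=> k; apply: le_trans (MP k); rewrite nmM ler_wpM2l ?nm_ge0 //.
  by rewrite (le_trans (nm_cexp_le _)) // nmM mulrC.
by rewrite /exp_series; move/cvg_lim: (cl) => -> //.
Qed.

Lemma sqr_le_expR (x : R) : 0 <= x -> x ^+ 2 <= 2 * expR x.
Proof. by move=> x0; have := expR_ge1Dxn 1 x0; have -> : 2`! = 2%N by []; lra. Qed.

Lemma fast_decay_deriv c a : fast_decay c a -> fast_decay (fun k => c k * a k) a.
Proof.
move=> fd K; have [M MP] := fd (K + 1); exists M => k.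
apply: le_trans (MP k); rewrite nmM -mulrA ler_wpM2l ?nm_ge0 //.
rewrite mulrDl mul1r expRD mulrC ler_wpM2l ?expR_ge0 //.
by have := expR_ge1Dx (nm (a k)); lra.
Qed.

(** The bound of cexp_taylor for the remainder of each term can be summed. *)
Lemma exp_series_differentiable c a : fast_decay c a ->
  forall z, differentiable (exp_series c a) z.
Proof.
move=> fd z; apply/has_derivP; exists (exp_series (fun k => c k * a k) a z).
have [M MP] := fd (nm z + 2).
have M0 : 0 <= M.
  have := MP 0; rewrite expr0 mulr1; apply: le_trans.
  by rewrite mulr_ge0 ?nm_ge0 ?expR_ge0.
move=> e e0; have k0 : 0 < 8 * M + 1 by lra.
exists (Num.min 1 (e / (8 * M + 1))); first by rewrite lt_min ltr01 divr_gt0.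
move=> h; rewrite lt_min ltr_pdivlMr // => /andP[h1 h2].
have C1 := @fast_decay_cvg c a (z + h) fd.
have C2 := @cvg_seriesM _ _ (-1) (@fast_decay_cvg c a z fd).
have C3 := @cvg_seriesM _ _ (- h) (@fast_decay_cvg _ a z (fast_decay_deriv fd)).
have C4 := cvg_seriesD (cvg_seriesD C1 C2) C3.
have -> : exp_series c a (z + h) - exp_series c a z - exp_series (fun k => c k * a k) a z * h
  = exp_series c a (z + h) + -1 * exp_series c a z + - h * exp_series (fun k => c k * a k) a z.
  by ring.
have [|l cl] := @cseries_cvg (fun k => c k * cexp (a k * (z + h)) + -1 * (c k * cexp (a k * z)) +
   - h * (c k * a k * cexp (a k * z))) (4 * M * nm h ^+ 2).
  move=> k; set ak := a k; set ck := c k.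
  have -> : ck * cexp (ak * (z + h)) + -1 * (ck * cexp (ak * z)) + - h * (ck * ak * cexp (ak * z))
    = ck * cexp (ak * z) * (cexp (ak * h) - 1 - ak * h).
    by rewrite mulrDr cexpD; ring.
  rewrite nmM; apply: le_trans (ler_wpM2l (nm_ge0 _) (cexp_taylor _)) _.
  have A : expR (nm (ak * h)) <= expR (nm ak).
    by rewrite ler_expR nmM ler_piMr ?nm_ge0 // ltW.
  have B : nm (cexp (ak * z)) <= expR (nm z * nm ak).
    by apply: le_trans (nm_cexp_le _) _; rewrite nmM mulrC.
  have D := sqr_le_expR (nm_ge0 ak).
  have E : expR (nm z * nm ak) * expR (nm ak) * expR (nm ak) = expR ((nm z + 2) * nm ak).
    by rewrite -!expRD; congr expR; ring.
  have F := MP k; rewrite -/ak -/ck -E in F.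
  rewrite !nmM exprMn -(nmM ak h).
  have n1 := nm_ge0 ck; have n2 := nm_ge0 (cexp (ak * z)); have n3 := nm_ge0 ak.
  have n4 := nm_ge0 h; have n5 := expR_ge0 (nm (ak * h)); have n6 := expR_ge0 (nm ak).
  have -> : nm ck * nm (cexp (ak * z)) * (2 * (nm ak ^+ 2 * nm h ^+ 2 * expR (nm (ak * h))))
     = (2 * nm h ^+ 2) * (nm ck * (nm (cexp (ak * z)) * nm ak ^+ 2 * expR (nm (ak * h)))).
    by ring.
  have -> : 4 * M * nm h ^+ 2 * 2^-1 ^+ k = 2 * nm h ^+ 2 * (2 * (M * 2^-1 ^+ k)) by ring.
  apply: ler_wpM2l; first by rewrite mulr_ge0 ?sqr_ge0.
  apply: le_trans (_ : nm ck * (expR (nm z * nm ak) * (2 * expR (nm ak)) * expR (nm ak)) <= _).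
    apply: ler_wpM2l => //; apply: ler_pM => //; first by rewrite mulr_ge0 ?sqr_ge0.
    by apply: ler_pM => //; rewrite sqr_ge0.
  by lra.
rewrite (cvgC_unique C4 cl) => lb; apply: le_trans lb _.
have -> : 2 * (4 * M * nm h ^+ 2) = nm h * (8 * M) * nm h by ring.
by apply: ler_wpM2r; [exact: nm_ge0|have := nm_ge0 h; lra].
Qed.

End ComplexSeries.

(** * The theta function *)

#[global] Arguments nm {R} z : simpl never.
#[global] Arguments cexp {R} z : simpl never.
Section ThetaFunction.
Context {R : realType}.
Local Notation C := (Cplx R).
Local Notation Re := complex.Re.
Local Notation Im := complex.Im.
Implicit Types (x y z w l : C).

(** Completion of the square in - A s^2 + (B + 1) |s|. *)
Lemma gauss_bound (A B : R) : 0 < A -> exists2 M : R, 0 <= M & forall (k : nat) (s : R),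
  k%:R <= `|s| -> expR (- A * s ^+ 2 + B * `|s|) <= M * 2^-1 ^+ k.
Proof.
move=> A0; exists (expR ((B + 1) ^+ 2 / (4 * A))) => [|k s ks]; first exact: expR_ge0.
have h2 : expR (- k%:R : R) <= 2^-1 ^+ k.
  rewrite expRN exprVn lef_pV2 ?posrE ?exprn_gt0 ?expR_gt0 //.
  have -> : k%:R = 1 * k%:R :> R by rewrite mul1r.
  rewrite expRM_natr lerXn2r // ?nnegrE ?expR_ge0 //.
  by have := expR_ge1Dx (1 : R); lra.
apply: le_trans (_ : expR ((B + 1) ^+ 2 / (4 * A) + - k%:R) <= _); last first.
  by rewrite expRD ler_wpM2l ?expR_ge0.
rewrite ler_expR -(real_normK (num_real s)); set t := `|s| in ks *.
have : 0 <= (2 * A * t - (B + 1)) ^+ 2 / (4 * A) by rewrite divr_ge0 ?sqr_ge0 // mulr_ge0 // ltW.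
have -> : (2 * A * t - (B + 1)) ^+ 2 / (4 * A) = A * t ^+ 2 - (B + 1) * t + (B + 1) ^+ 2 / (4 * A).
  by field; rewrite gt_eqF.
lra.
Qed.

(** The integers j with kap j < N are those from - N to N - 1, listed by zr N.
    *)
Definition kap (j : int) : nat := match j with Posz k => k | Negz k => k end.
Definition zr N : seq int := map Posz (iota 0 N) ++ map Negz (iota 0 N).

Lemma mem_zr N j : (j \in zr N) = (kap j < N)%N.
Proof.
rewrite mem_cat; case: j => k /=.
  rewrite mem_map; last by move=> ? ? [].
  rewrite mem_iota /= add0n orbC; case: mapP => [[? ? //]|//].
rewrite [X in _ || X]mem_map; last by move=> ? ? [].
rewrite mem_iota /= add0n; case: mapP => [[? ? //]|//].
Qed.

Lemma kap_lt j N : (kap j < N)%N = (- N%:Z <= j < N%:Z).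
Proof. by case: j => k; rewrite /kap; lia. Qed.

Lemma uniq_zr N : uniq (zr N).
Proof.
rewrite cat_uniq !map_inj_uniq ?iota_uniq //=; try by move=> ? ? [].
by rewrite andbT; apply/hasPn => _ /mapP[k _ ->]; apply/mapP => -[].
Qed.

Lemma zr_sum (V : nmodType) N (f : int -> V) : \sum_(j <- zr N) f j =
  \sum_(0 <= k < N) f k%:Z + \sum_(0 <= k < N) f (Negz k).
Proof. by rewrite big_cat !big_map /index_iota subn0. Qed.

Lemma zr_cvg (f : int -> C) (M : R) : (forall j, nm (f j) <= M * 2^-1 ^+ kap j) ->
  exists2 l, (fun N => \sum_(j <- zr N) f j) @ \oo --> l &
    l = limn (series (fun k : nat => f k%:Z)) + limn (series (fun k : nat => f (- k.+1%:Z))).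
Proof.
move=> fM.
have [a ca _] := @cseries_cvg _ (fun k : nat => f k%:Z) M (fun k => fM _).
have [b cb _] := @cseries_cvg _ (fun k : nat => f (- k.+1%:Z)) M (fun k => fM (Negz k)).
exists (a + b); last by move/cvg_lim: ca => -> //; move/cvg_lim: cb => ->.
have -> : (fun N => \sum_(j <- zr N) f j) = (fun N => series (fun k : nat => f k%:Z) N
    + series (fun k : nat => f (- k.+1%:Z)) N) by apply/funext => N; rewrite zr_sum.
exact: (cvgD ca cb).
Qed.

Variable tau : C.
Hypothesis tau0 : 0 < Im tau.

Definition hint (j : int) : R := j%:~R + 2^-1.

Lemma hintC j : j%:~R + 2^-1 = (hint j)%:C%C :> C.
Proof. by rewrite /hint rmorphD /= fmorphV /= rmorph_int rmorph_nat. Qed.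

Lemma hint_norm j : `|hint j| = (kap j)%:R + 2^-1.
Proof.
rewrite /hint; case: j => k /=; first by rewrite ger0_norm // addr_ge0 // invr_ge0.
rewrite NegzE mulrNz -pmulrn -(natr1 k) ler0_norm; last by have := ler0n R k; lra.
by field.
Qed.

Definition tc (j : int) : C := cexp ('i * cpi * (j%:~R + 2^-1) ^+ 2 * tau
   + 2 * 'i * cpi * (j%:~R + 2^-1) * 2^-1).
Definition ta (j : int) : C := 2 * 'i * cpi * (j%:~R + 2^-1).

Lemma theta_termE z j : theta_term tau z j = tc j * cexp (ta j * z).
Proof. by rewrite /theta_term /tc /ta -cexpD; congr cexp; ring. Qed.

Lemma nm_ta j : nm (ta j) = 2 * pi * `|hint j|.
Proof.
rewrite /ta hintC !nmM nmI !nm_real; have -> : 2 = (2 : R)%:C%C :> C by rewrite rmorph_nat.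
by rewrite nm_real mulr1 (ger0_norm (pi_ge0 R)) ger0_norm.
Qed.

Lemma nm_tc j : nm (tc j) = expR (- (pi * Im tau) * hint j ^+ 2).
Proof.
rewrite nm_cexp hintC imagE; congr expR.
have -> : 2 * 'i%C * cpi * (hint j)%:C%C * 2^-1 = 'i%C * cpi * (hint j)%:C%C :> C by field.
rewrite -rmorphXn /= /cpi; case: tau => u v /=; ring.
Qed.

Lemma tc_decay (K : R) : exists2 M : R, 0 <= M &
  forall j, nm (tc j) * expR (K * nm (ta j)) <= M * 2^-1 ^+ kap j.
Proof.
have A0 : 0 < pi * Im tau by rewrite mulr_gt0 // pi_gt0.
have [M M0 MP] := gauss_bound (K * (2 * pi)) A0; exists M => // j.
rewrite nm_tc nm_ta mulrA -expRD; apply: MP.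
by rewrite hint_norm lerDl invr_ge0.
Qed.

Lemma theta_term_decay z : exists2 M : R, 0 <= M &
  forall j, nm (theta_term tau z j) <= M * 2^-1 ^+ kap j.
Proof.
have [M M0 MP] := tc_decay (nm z); exists M => // j.
apply: le_trans (MP j); rewrite theta_termE nmM ler_wpM2l ?nm_ge0 //.
by rewrite (le_trans (nm_cexp_le _)) // nmM mulrC.
Qed.

Lemma theta_cvg z : (fun N => \sum_(j <- zr N) theta_term tau z j) @ \oo --> - theta tau z.
Proof.
have [M _ /zr_cvg[l cl e]] := theta_term_decay z.
by rewrite /theta opprK -e.
Qed.

Lemma theta_differentiable z : differentiable (theta tau) z.
Proof.
have E : theta tau = - (exp_series (fun k : nat => tc k%:Z) (fun k => ta k%:Z)
    + exp_series (fun k : nat => tc (- k.+1%:Z)) (fun k => ta (- k.+1%:Z))).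
  apply/funext => w; rewrite /theta !fctE /exp_series.
  by congr (- (limn (series _) + limn (series _))); apply/funext => k; rewrite theta_termE.
rewrite E; apply: differentiableN; apply: differentiableD.
  apply: exp_series_differentiable => K; have [M _ MP] := tc_decay K.
  by exists M => k; exact: (MP k%:Z).
apply: exp_series_differentiable => K; have [M _ MP] := tc_decay K.
by exists M => k; exact: (MP (Negz k)).
Qed.

(** In the variables j + k + 1 and j - k the product of a term of theta(x + y)
    and a term of theta(x - y) separates (theta_term_prod). *)
Definition bth (s : int) x : C :=
  cexp ('i * cpi * tau * s%:~R ^+ 2 / 2 + 2 * 'i * cpi * s%:~R * x).

Lemma nm_bth (s : int) x : nm (bth s x) <=
  expR (- (pi * Im tau / 2) * s%:~R ^+ 2 + (2 * pi * nm x) * `|s%:~R|).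
Proof.
rewrite nm_cexp ler_expR imagE.
have -> : 'i%C * cpi * tau * s%:~R ^+ 2 / 2 = 'i%C * tau * ((pi * s%:~R ^+ 2 / 2 : R)%:C)%C :> C.
  by rewrite /cpi !rmorphM /= fmorphV /= rmorph_int rmorph_nat; field.
have -> : 2 * 'i%C * cpi * s%:~R * x = 'i%C * x * ((2 * pi * s%:~R : R)%:C)%C :> C.
  by rewrite /cpi !rmorphM /= rmorph_int rmorph_nat; ring.
rewrite cReD lerD //; first by case: tau => u v /=; rewrite le_eqVlt; apply/orP; left; apply/eqP; field.
have -> : Re ('i%C * x * ((2 * pi * s%:~R : R)%:C)%C) = - Im x * (2 * pi * s%:~R).
  by case: x => u v /=; ring.
apply: le_trans (ler_norm _) _; rewrite !normrM normrN.
rewrite (ger0_norm (pi_ge0 R)) ger0_norm // mulrA [_ * nm x]mulrC ler_wpM2r // ler_wpM2r ?Im_le_nm //.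
by rewrite mulr_ge0 // pi_ge0.
Qed.

Lemma bth_decay x : exists2 M : R, 0 <= M & forall s, nm (bth s x) <= M * 2^-1 ^+ kap s.
Proof.
have A0 : 0 < pi * Im tau / 2 by rewrite divr_gt0 // mulr_gt0 // pi_gt0.
have [M M0 MP] := gauss_bound (2 * pi * nm x) A0; exists M => // s.
apply: le_trans (nm_bth _ _) _; apply: MP.
by case: s => k /=; rewrite ?NegzE ?mulrNz ?normrN -?pmulrn ger0_norm // ler_nat.
Qed.

Lemma cexp_ipi : cexp ('i * cpi) = -1 :> C.
Proof.
have -> : 'i * cpi = (0 +i* pi)%C :> C by apply: Cplx_eq; rewrite imagE /=; ring.
by rewrite /cexp /= expR0 cospi sinpi; apply: Cplx_eq => /=; ring.
Qed.

Definition oddz (s : int) := odd (absz s).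

Lemma cexp_ipiz (n : int) : cexp ('i * cpi * n%:~R) = (-1) ^+ oddz n :> C.
Proof.
rewrite /oddz signr_odd; case: n => k /=.
  by rewrite -pmulrn mulr_natr cexpMn cexp_ipi.
rewrite NegzE mulrNz -pmulrn mulrN mulr_natr -mulNrn cexpMn.
have -> : cexp (- ('i * cpi)) = -1 :> C; last by [].
have -> : - ('i * cpi) = (0 +i* - pi)%C :> C by apply: Cplx_eq; rewrite imagE /=; ring.
by rewrite /cexp /= expR0 cosN sinN cospi sinpi; apply: Cplx_eq => /=; ring.
Qed.

Lemma theta_term_prod x y (j k : int) :
  theta_term tau (x + y) j * theta_term tau (x - y) k =
  (-1) ^+ oddz (j + k + 1) * bth (j + k + 1) x * bth (j - k) y.
Proof.
rewrite -cexp_ipiz /theta_term /bth -!cexpD; congr cexp.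
by rewrite !rmorphD /= rmorphN /= rmorph1; field.
Qed.

(** The part of the series of the bth s x in which s is odd (b = true) or even
    (b = false). *)
Definition epart (b : bool) N x : C := \sum_(s <- zr N | oddz s == b) bth s x.

Lemma epart_cvg b x : exists l, (fun N => epart b N x) @ \oo --> l.
Proof.
have [M M0 MP] := bth_decay x.
have [|l cl _] := @zr_cvg (fun s => if oddz s == b then bth s x else 0) M.
  move=> j; case: ifP => _ //; rewrite nm0 mulr_ge0 // ltW //; exact: half_pow_gt0.
by exists l; under eq_fun do rewrite /epart big_mkcond.
Qed.

(** Partial sums of the double series over a square in (j, k). *)
Definition box N x y : C := \sum_(j <- zr N) \sum_(k <- zr N)
  theta_term tau (x + y) j * theta_term tau (x - y) k.

Lemma box_cvg x y : (fun N => box N x y) @ \oo --> theta tau (x + y) * theta tau (x - y).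
Proof.
have -> : theta tau (x + y) * theta tau (x - y) = - theta tau (x + y) * - theta tau (x - y).
  exact: (esym (mulrNN _ _)).
have -> : (fun N => box N x y) = (fun N => (\sum_(j <- zr N) theta_term tau (x + y) j) *
    (\sum_(k <- zr N) theta_term tau (x - y) k)).
  by apply/funext => N; rewrite /box big_distrlr.
exact: (cvgM (@theta_cvg (x + y)) (@theta_cvg (x - y))).
Qed.

(** Partial sums of the same double series over a square in (j + k + 1, j -
    k), numbers of opposite parity (diamond_reindex). *)
Definition diamond N x y := epart false N x * epart true N y - epart true N x * epart false N y.

Lemma diamondE N x y : diamond N x y =
  \sum_(p <- [seq (s, d) | s <- zr N, d <- zr N] | oddz (p.1 + p.2))
     (-1) ^+ oddz (p.1) * bth p.1 x * bth p.2 y.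
Proof.
rewrite [RHS]big_mkcond big_allpairs_dep /=.
under [RHS]eq_bigr => s _ do rewrite -big_mkcond /=.
rewrite /diamond /epart.
have split (F : int -> C) : \sum_(s <- zr N) F s =
   \sum_(s <- zr N | oddz s == false) F s + \sum_(s <- zr N | oddz s == true) F s.
  rewrite (bigID (fun s => oddz s == false)) /=; congr (_ + _).
  by apply: eq_bigl => s; case: oddz.
rewrite [RHS]split; congr (_ + _); rewrite big_distrl /= -?sumrN; apply: eq_bigr => s /eqP so.
  rewrite big_distrr /= (eq_bigl (fun d => oddz (s + d))).
    by apply: eq_bigr => d _; rewrite so expr0 mul1r.
  by move=> d; move: so; rewrite /oddz; lia.
rewrite big_distrr /= -sumrN (eq_bigl (fun d => oddz (s + d))).
  by apply: eq_bigr => d _; rewrite so expr1 mulN1r mulNr.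
by move=> d; move: so; rewrite /oddz; lia.
Qed.

Lemma diamond_reindex N x y : diamond N x y =
  \sum_(q <- [seq (j, k) | j <- zr N.+1, k <- zr N.+1] |
       (kap (q.1 + q.2 + 1) < N)%N && (kap (q.1 - q.2) < N)%N)
     theta_term tau (x + y) q.1 * theta_term tau (x - y) q.2.
Proof.
rewrite diamondE -big_filter -[RHS]big_filter.
set L1 := seq.filter _ _; set L2 := seq.filter _ _.
pose psi (q : int * int) := (q.1 + q.2 + 1, q.1 - q.2).
have pL : perm_eq (map psi L2) L1.
  apply: uniq_perm.
  - have psiI : injective psi.
      by move=> [a b] [c d] [] /= e1 e2; congr (_, _); lia.
    by rewrite (map_inj_uniq psiI) filter_uniq // allpairs_uniq ?uniq_zr // => -[? ?] [? ?].
  - by rewrite filter_uniq // allpairs_uniq ?uniq_zr // => -[? ?] [? ?].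
  move=> [s d]; rewrite mem_filter /=; apply/mapP/andP.
    move=> [[j k]]; rewrite mem_filter /= => /andP[/andP[c1 c2] _] [-> ->]; split; first by rewrite /oddz; lia.
    by apply/allpairsP; exists (j + k + 1, j - k); rewrite /= !mem_zr c1 c2.
  rewrite /oddz => -[so /allpairsP[[s' d']] /= [+ + [es ed]]]; rewrite -{}es -{}ed !mem_zr => sN dN.
  pose j : int := ((s + d - 1) %/ 2)%Z; pose k : int := ((s - d - 1) %/ 2)%Z.
  have e1 : j + k + 1 = s by rewrite /j /k; lia.
  have e2 : j - k = d by rewrite /j /k; lia.
  exists (j, k); last by rewrite /psi /= e1 e2.
  rewrite mem_filter [X in X && _]/= e1 e2 sN dN.
  apply/allpairsP; exists (j, k); split => //=; rewrite mem_zr;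
    by move: sN dN; rewrite !kap_lt -e1 -e2; move: (j) (k) => j0 k0; lia.
rewrite -(perm_big _ pL) /= big_map; apply: eq_bigr => -[j k] _.
by rewrite theta_term_prod.
Qed.

Lemma zr_sub (V : zmodType) N M (f : int -> V) : (N <= M)%N ->
  \sum_(j <- zr N) f j = \sum_(j <- zr M | (kap j < N)%N) f j.
Proof.
move=> NM.
have pe : perm_eq (zr N) [seq j <- zr M | (kap j < N)%N].
  apply: uniq_perm; [exact: uniq_zr|exact: filter_uniq (uniq_zr M)|].
  move=> j; rewrite mem_filter !mem_zr andb_idr // => jN.
  exact: leq_trans jN NM.
by rewrite (perm_big _ pe) big_filter.
Qed.

Lemma zr_geometric N : \sum_(j <- zr N) (2^-1 ^+ kap j : R) = 4 * (1 - 2^-1 ^+ N).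
Proof.
have e : \sum_(0 <= k < N) (2^-1 ^+ k : R) = 2 * (1 - 2^-1 ^+ N).
  have := geometric_sum (1 : R) N; rewrite mulr1 => <-.
  by apply: eq_bigr => k _; rewrite mul1r.
by rewrite zr_sum /= e; ring.
Qed.

(** The diamond of size 2 N contains the box of size N, and the terms outside
    of the box are dominated by a geometric double series. *)
Lemma diamond_box x y : exists M : R, forall N,
  nm (diamond (2 * N) x y - box N x y) <= M * 2^-1 ^+ N.
Proof.
have [A A0 AP] := theta_term_decay (x + y).
have [B B0 BP] := theta_term_decay (x - y).
exists (32 * A * B) => N; set M := (2 * N).+1.
pose g (q : int * int) := theta_term tau (x + y) q.1 * theta_term tau (x - y) q.2.
pose G (q : int * int) : R := A * B * (2^-1 ^+ kap q.1 * 2^-1 ^+ kap q.2).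
have gG q : nm (g q) <= G q.
  rewrite nmM /G mulrACA; apply: ler_pM; rewrite ?nm_ge0 //.
pose L := [seq (j, k) | j <- zr M, k <- zr M].
pose inb (q : int * int) := (kap q.1 < N)%N && (kap q.2 < N)%N.
pose ind (q : int * int) := (kap (q.1 + q.2 + 1)%R < 2 * N)%N && (kap (q.1 - q.2)%R < 2 * N)%N.
have NM : (N <= M)%N by rewrite /M; lia.
have sub (V : zmodType) (f : int * int -> V) :
    \sum_(q <- L | inb q) f q = \sum_(j <- zr N) \sum_(k <- zr N) f (j, k).
  rewrite /L big_mkcond big_allpairs_dep /= (zr_sub _ NM) [RHS]big_mkcond; apply: eq_bigr => j _.
  rewrite (zr_sub _ NM); case: ifP => jN.
    by rewrite [RHS]big_mkcond; apply: eq_bigr => k _; rewrite /inb jN.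
  by rewrite big1 // => k _; rewrite /inb jN.
have dE : diamond (2 * N) x y - box N x y = \sum_(q <- L | ~~ inb q && ind q) g q.
  rewrite diamond_reindex /box -/M -/L -(sub _ g) -/(ind _).
  rewrite (bigID inb) /= addrAC; apply/eqP; rewrite addrAC subr_eq addrC; apply/eqP.
  congr (_ + _); first by apply: eq_bigl => q; rewrite andbC.
  by apply: eq_bigl => -[j k]; rewrite andb_idl // => /andP[/=]; rewrite !kap_lt; lia.
have GE : \sum_(q <- L | ~~ inb q) G q = A * B * ((4 * (1 - 2^-1 ^+ M)) ^+ 2 - (4 * (1 - 2^-1 ^+ N)) ^+ 2).
  have full : \sum_(q <- L) G q = \sum_(q <- L | inb q) G q + \sum_(q <- L | ~~ inb q) G q.
    by rewrite (bigID inb).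
  have prod n : \sum_(j <- zr n) \sum_(k <- zr n) G (j, k) = A * B * (4 * (1 - 2^-1 ^+ n)) ^+ 2.
    rewrite expr2 -zr_geometric big_distrlr /= big_distrr /=.
    by apply: eq_bigr => j _; rewrite big_distrr.
  move: full; rewrite sub prod {1}/L big_allpairs_dep /= prod => full.
  by rewrite mulrBr full; ring.
rewrite dE; apply: le_trans (nm_sum _ _ _) _.
apply: le_trans (_ : \sum_(q <- L | ~~ inb q) G q <= _).
  rewrite big_mkcond [leRHS]big_mkcond; apply: ler_sum => q _.
  have G0 : 0 <= G q by apply: le_trans (gG q); exact: nm_ge0.
  by move: G0 (gG q); move: (nm (g q)) (G q) => a b; case: (inb q); case: (ind q).
rewrite GE; have -> : 32 * A * B * 2^-1 ^+ N = A * B * (32 * 2^-1 ^+ N) by ring.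
apply: ler_wpM2l; first exact: mulr_ge0.
have h1 := half_pow_gt0 (R := R) M; have h2 := half_pow_gt0 (R := R) N.
have h3 : 2^-1 ^+ M <= 1 :> R by rewrite exprn_ile1 // ?invr_ge0 // invf_le1 // ler1n.
set a := 2^-1 ^+ M in h1 h3 *; set b := 2^-1 ^+ N in h2 *; nra.
Qed.

(** A x and B x are the sums of the bth s x over the even and the odd s. As j
    + k + 1 and j - k have opposite parities, only the products of an even and
    an odd part occur. *)
Lemma theta_addition : exists A B : C -> C, forall x y,
  theta tau (x + y) * theta tau (x - y) = A x * B y - B x * A y.
Proof.
have /choice[A AP] := epart_cvg false; have /choice[B BP] := epart_cvg true.
exists A, B => x y.
have [M MP] := diamond_box x y.
have cD : (fun N => diamond N x y) @ \oo --> A x * B y - B x * A y.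
  exact: (cvgB (cvgM (AP x) (BP y)) (cvgM (BP x) (AP y))).
apply: (@cvgC_unique _ (fun N => box N x y)); first exact: box_cvg.
move/cvgC: cD => cD; apply/cvgC => e e0.
have e2 : 0 < e / 2 by rewrite divr_gt0.
have [N1 N1P] := cD _ e2.
have [N2 N2P] := @half_lt_eventually R `|M| _ e2.
exists (maxn N1 N2) => n; rewrite geq_max => /andP[n1 n2].
rewrite -(subrK (diamond (2 * n) x y) (box n x y)) -addrA.
apply: le_lt_trans (nmD _ _) _.
have A1 : nm (diamond (2 * n) x y - (A x * B y - B x * A y)) < e / 2 by apply: N1P; lia.
have A2 : nm (box n x y - diamond (2 * n) x y) <= `|M| * 2^-1 ^+ N2.
  rewrite nmC; apply: le_trans (MP n) _.
  apply: (@le_trans _ _ (`|M| * 2^-1 ^+ n)).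
    by apply: ler_wpM2r; [exact/ltW/half_pow_gt0|exact: ler_norm].
  apply: ler_wpM2l; first exact: normr_ge0.
  by rewrite ler_wiXn2l // ?invr_ge0 // invf_le1 // ler1n.
lra.
Qed.

Definition gc (j : int) : C := cexp ('i * cpi * (j%:~R + 2^-1) ^+ 2 * tau).
Definition fmode (j : int) w : C := gc j * cexp (2 * 'i * cpi * j%:~R * w).

Lemma theta_term_fmode (j : int) w :
  theta_term tau (w - 2^-1) j = cexp ('i * cpi * w) * fmode j w.
Proof. by rewrite /theta_term /fmode /gc -!cexpD; congr cexp; field. Qed.

Lemma gc_decay : exists2 M : R, 0 <= M & forall j, nm (gc j) <= M * 2^-1 ^+ kap j.
Proof.
have [M M0 MP] := theta_term_decay (- 2^-1); exists M => // j.
by apply: le_trans (MP j); rewrite /theta_term /gc addNr mulr0 addr0.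
Qed.

Lemma fmode_halving (r : nat) (j : int) w : (2 ^ r %| absz j)%N ->
  fmode j w + fmode j (w + 2^-1 ^+ r.+1) = 2 * (if (2 ^ r.+1 %| absz j)%N then fmode j w else 0).
Proof.
move=> dj.
have [i ji] : exists i : int, j = i * (2 ^ r)%N%:Z.
  by apply/dvdzP; rewrite /dvdz.
have r0 : (0 < 2 ^ r)%N by rewrite expn_gt0.
have -> : fmode j (w + 2^-1 ^+ r.+1) = (-1) ^+ odd (absz i) * fmode j w.
  rewrite -cexp_ipiz /fmode /gc -!cexpD; congr cexp.
  have -> : j%:~R = i%:~R * 2 ^+ r :> C by rewrite ji intrM -pmulrn natrX.
  have -> : 2^-1 ^+ r.+1 = (2 * 2 ^+ r)^-1 :> C by rewrite exprVn exprS.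
  have : 2 ^+ r != 0 :> C by rewrite expf_neq0 // pnatr_eq0.
  by move: (2 ^+ r) => u u0; field; rewrite u0.
have -> : (2 ^ r.+1 %| absz j)%N = ~~ odd (absz i).
  by rewrite ji abszM /= expnSr mulnC dvdn_pmul2r // dvdn2.
by case: odd; rewrite ?expr0 ?expr1 ?mulN1r ?subrr ?mulr0 // mul1r mulr2n mulrDl mul1r.
Qed.

(** Up to a factor, theta(w - 1/2) is a series of modes exp(2 pi i j w). If it
    vanishes, so does the average over w and w + 2^-(r+1), and by induction on
    r the series of the modes with 2^r dividing j. For large r the coefficient
    at j = 0 dominates the others. *)
Lemma theta_nonzero : exists z, theta tau z != 0.
Proof.
apply: contrapT => nz.
have th0 z : theta tau z = 0.
  by apply/eqP; apply: contrapT => /negP h; apply: nz; exists z.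
have cvg0 r : forall w, (fun N => \sum_(j <- zr N | (2 ^ r %| absz j)%N) fmode j w) @ \oo --> (0 : C).
  elim: r => [|r IH] w.
    have -> : (fun N => \sum_(j <- zr N | (2 ^ 0 %| absz j)%N) fmode j w) =
       (fun N => cexp (- ('i * cpi * w)) * \sum_(j <- zr N) theta_term tau (w - 2^-1) j).
      apply/funext => N; rewrite big_distrr /=; apply: eq_big => [j|j _]; first by rewrite dvd1n.
      by rewrite theta_term_fmode mulrA -cexpD addNr cexp0 mul1r.
    have L : (fun N => cexp (- ('i * cpi * w)) * \sum_(j <- zr N) theta_term tau (w - 2^-1) j) @ \oo
        --> cexp (- ('i * cpi * w)) * - theta tau (w - 2^-1).
      exact: (cvgM (cvg_cst _) (@theta_cvg _)).
    by move: L; rewrite th0 oppr0 mulr0.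
  have -> : (fun N => \sum_(j <- zr N | (2 ^ r.+1 %| absz j)%N) fmode j w) =
     (fun N => 2^-1 * (\sum_(j <- zr N | (2 ^ r %| absz j)%N) fmode j w +
               \sum_(j <- zr N | (2 ^ r %| absz j)%N) fmode j (w + 2^-1 ^+ r.+1))).
    apply/funext => N; rewrite -big_split /=.
    rewrite (eq_bigr _ (fun j dj => fmode_halving w dj)) -big_distrr /=.
    rewrite mulKf ?pnatr_eq0 // -big_mkcondr; apply: eq_bigl => j.
    by rewrite andb_idl // => /(dvdn_trans _); apply; rewrite expnS dvdn_mull.
  have L := cvgM (cvg_cst (2^-1 : C)) (cvgD (IH w) (IH (w + 2^-1 ^+ r.+1))).
  by rewrite addr0 mulr0 in L; apply: L.
have [M M0 MP] := gc_decay.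
have g0 : 0 < nm (gc 0) / 2 by rewrite divr_gt0 // nm_gt0 cexp_neq0.
have [r rP] := @half_lt_eventually R (4 * M) _ g0.
have /cvgC /(_ _ g0)[N0 N0P] := cvg0 r 0.
pose N := maxn N0 r.+1.
have := N0P N (leq_maxl _ _); rewrite subr0.
have N1 : (r < N)%N by rewrite leq_maxr.
have -> : \sum_(j <- zr N | (2 ^ r %| absz j)%N) fmode j 0 =
    \sum_(j <- zr N | (2 ^ r %| absz j)%N) gc j.
  by apply: eq_bigr => j _; rewrite /fmode mulr0 cexp0 mulr1.
have z0 : 0 \in zr N by rewrite mem_zr /= (leq_ltn_trans _ N1).
rewrite -big_filter (bigD1_seq (0 : int)) ?filter_uniq ?uniq_zr //=; last first.
  by rewrite mem_filter dvdn0.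
rewrite big_filter_cond /=.
set S := \sum_(_ <- _ | _) _.
have SB : nm S <= 4 * M * 2^-1 ^+ r.
  apply: le_trans (nm_sum _ _ _) _.
  apply: le_trans (_ : \sum_(j <- zr N | ~~ (kap j < r)%N) M * 2^-1 ^+ kap j <= _).
    rewrite big_mkcond [leRHS]big_mkcond; apply: ler_sum => j _.
    case: ifP => [/andP[dj j0]|_]; last first.
      by case: ifP => // _; rewrite mulr_ge0 // ltW // half_pow_gt0.
    have jr : (2 ^ r <= absz j)%N by rewrite dvdn_leq // absz_gt0.
    have rr := ltn_expl r (isT : 1 < 2)%N.
    have -> : ~~ (kap j < r)%N by case: (j) jr rr => k /=; lia.
    exact: MP.
  have := zr_geometric N.
  rewrite (bigID (fun j => (kap j < r)%N)) /= -(zr_sub _ (ltnW N1)) zr_geometric => e.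
  rewrite -big_distrr /= [_ * M]mulrC -mulrA ler_wpM2l //.
  have := half_pow_gt0 (R := R) N; lra.
have := nmD (gc 0 + S) (- S); rewrite addrK nmN; lra.
Qed.

Theorem theta_nonzero_germ p : nonzero_germ (theta tau) p.
Proof.
by have [z z0] := theta_nonzero; apply: (entire_nonzero_germ _ z0) => w; exact: theta_differentiable.
Qed.

(** Exchanging x and y in the addition formula changes the sign of the
    right-hand side, and the sign of x - y on the left. *)
Lemma thetaN z : theta tau (- z) = - theta tau z.
Proof.
have [A [B AB]] := theta_addition; have [w w0] := theta_nonzero.
pose x := (w + z) / 2; pose y := (w - z) / 2.
have e1 := AB x y; have e2 := AB y x.
have h1 : x + y = w by rewrite /x /y; field.
have h2 : x - y = z by rewrite /x /y; field.
have h3 : y - x = - z by rewrite /x /y; field.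
rewrite h1 h2 in e1; rewrite addrC h1 h3 in e2.
by apply: (mulfI w0); rewrite e2 mulrN e1; ring.
Qed.

Lemma theta0 : theta tau 0 = 0.
Proof.
by apply/eqP; have := thetaN 0; rewrite oppr0 => /eqP; rewrite -addr_eq0 -mulr2n mulrn_eq0.
Qed.

(** By the addition formula theta(u + v) theta(u - v) is the minor of two
    columns (A u, B u) and (A v, B v), and the minors of four such columns
    satisfy the Pluecker relation. *)
Lemma theta_fay a b c d :
  (theta tau (a + b + d) * theta tau a) * (theta tau (d - b - c) * theta tau c)
  - (theta tau (a + d) * theta tau (a + b)) * (theta tau (d - c) * theta tau (b + c))
  + (theta tau (a + d - c) * theta tau (a + b + c)) * (theta tau d * theta tau b) = 0.
Proof.
have [A [B AB]] := theta_addition.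
pose p := a + (b + d) / 2; pose q := (b + d) / 2; pose r := (d - b) / 2.
pose s := (d - b) / 2 - c.
have F u v u' v' : u = u' + v' -> v = u' - v' ->
   theta tau u * theta tau v = A u' * B v' - B u' * A v'.
  by move=> -> ->; exact: AB.
have -> := F (a + b + d) a p q; [|by rewrite /p /q; field|by rewrite /p /q; field].
have -> := F (d - b - c) c r s; [|by rewrite /r /s; field|by rewrite /r /s; field].
have -> := F (a + d) (a + b) p r; [|by rewrite /p /r; field|by rewrite /p /r; field].
have -> := F (d - c) (b + c) q s; [|by rewrite /q /s; field|by rewrite /q /s; field].
have -> := F (a + d - c) (a + b + c) p s; [|by rewrite /p /s; field|by rewrite /p /s; field].
have -> := F d b q r; [|by rewrite /q /r; field|by rewrite /q /r; field].
by move: (A p) (A q) (A r) (A s) (B p) (B q) (B r) (B s) => *; ring.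
Qed.

End ThetaFunction.

Lemma im_gt0 (R : realType) (tau : Cplx R) : 0 < 'Im tau -> 0 < complex.Im tau.
Proof.
move=> h.
have hr : 'Im tau \is Num.real := Creal_Im tau.
have hr2 : 'Re tau \is Num.real := Creal_Re tau.
have e := Crect tau.
have /complex_realP[x xE] := hr; have /complex_realP[y yE] := hr2.
move: h; rewrite xE ltcR => x0.
have -> : complex.Im tau = x by rewrite {1}e xE yE imagE /=; ring.
by [].
Qed.

(** * Quotients of entire functions *)

(** The real plane as a complete normed space, to which Baire's theorem
    applies. *)
Definition rV2 (R : realType) : completeNormedModType R := HB.pack 'rV[R]_2.

Section GoodFunctions.
Context {R : realType}.
Local Notation C := (Cplx R).

Section General.
Context {V : normedModType C}.
Implicit Types (f g h l : V -> C) (p q : V).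

Definition entire f := forall p, differentiable f p.
(** The admissible denominators. *)
Definition good h := entire h /\ forall p, nonzero_germ h p.

Lemma nonzero_germP h p (U : set V) : nonzero_germ h p -> nbhs p U ->
  exists2 q, U q & h q != 0.
Proof.
move=> nh pU; apply: contrapT => no; apply: nh; apply: filterS pU => q Uq.
by apply/eqP; apply: contrapT => /negP hq; apply: no; exists q.
Qed.

Lemma entire_neq0_open h p : entire h -> h p != 0 -> \forall q \near p, h q != 0.
Proof. by move=> eh; exact: differentiable_neq0. Qed.

Lemma entireM f g : entire f -> entire g -> entire (fun p => f p * g p).
Proof. by move=> ef eg p; exact: (differentiableM (ef p) (eg p)). Qed.

Lemma entireD f g : entire f -> entire g -> entire (fun p => f p + g p).
Proof. by move=> ef eg p; exact: (differentiableD (ef p) (eg p)). Qed.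

Lemma entireN f : entire f -> entire (fun p => - f p).
Proof. by move=> ef p; exact: (differentiableN (ef p)). Qed.

Lemma entire_cst (c : C) : entire (fun=> c).
Proof. by move=> p; exact: differentiable_cst. Qed.

(** Close to any point, f is nonzero somewhere, hence on an open set, and
    there g is nonzero somewhere. *)
Lemma goodM f g : good f -> good g -> good (fun p => f p * g p).
Proof.
move=> [ef nf] [eg ng]; split; first exact: entireM.
move=> p fg0; have pfg : nbhs p (fun q => \forall r \near q, f r * g r = 0).
  by apply: nbhs_interior.
have [q qfg fq] := nonzero_germP (nf p) pfg.
have [r [fr fgr] gr] := nonzero_germP (ng q) (filterI (entire_neq0_open ef fq) qfg).
by move/eqP: fgr; rewrite mulf_eq0 (negbTE fr) (negbTE gr).
Qed.

Lemma good_cst (c : C) : c != 0 -> good (fun=> c).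
Proof.
move=> c0; split; first exact: entire_cst.
by move=> p /nbhs_singleton /eqP; rewrite (negbTE c0).
Qed.

Lemma good_prod (I : Type) (r : seq I) (P : pred I) (F : I -> V -> C) :
  (forall i, P i -> good (F i)) -> good (fun p => \prod_(i <- r | P i) F i p).
Proof. by move=> gF; apply: (big_closed (good_cst (oner_neq0 C)) goodM). Qed.

(** Meromorphic functions with a numerator and a denominator defined
    everywhere, so that goodM applies to the denominators of sums and
    products. *)
Definition quot f := exists g h, [/\ entire g, good h & forall q, h q != 0 -> f q = g q / h q].

Lemma quot_entire f : entire f -> quot f.
Proof.
move=> ef; exists f, (fun=> 1).
split; [exact: ef|exact: good_cst (oner_neq0 _)|by move=> q _; rewrite divr1].
Qed.

Lemma quot_cst (c : C) : quot (fun=> c).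
Proof. exact: quot_entire (@entire_cst c). Qed.

Lemma quotV h : good h -> quot (fun p => (h p)^-1).
Proof.
move=> gh; exists (fun=> 1), h.
split; [exact: entire_cst|exact: gh|by move=> q _; rewrite div1r].
Qed.

Lemma quotM f1 f2 : quot f1 -> quot f2 -> quot (fun p => f1 p * f2 p).
Proof.
move=> [g1 [h1 [eg1 gh1 e1]]] [g2 [h2 [eg2 gh2 e2]]].
exists (fun p => g1 p * g2 p), (fun p => h1 p * h2 p); split.
- exact: entireM.
- exact: goodM.
- by move=> q; rewrite mulf_eq0 negb_or => /andP[/e1 -> /e2 ->]; rewrite mulf_div.
Qed.

Lemma quotD f1 f2 : quot f1 -> quot f2 -> quot (fun p => f1 p + f2 p).
Proof.
move=> [g1 [h1 [eg1 gh1 e1]]] [g2 [h2 [eg2 gh2 e2]]].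
exists (fun p => g1 p * h2 p + g2 p * h1 p), (fun p => h1 p * h2 p); split.
- by apply: entireD; apply: entireM; [|case: gh2| |case: gh1].
- exact: goodM.
- move=> q; rewrite mulf_eq0 negb_or => /andP[h1q h2q].
  by rewrite e1 // e2 // addf_div.
Qed.

Lemma quotN f : quot f -> quot (fun p => - f p).
Proof.
move=> qf; have := quotM (quot_cst (-1)) qf.
by congr quot; apply/funext => p; rewrite mulN1r.
Qed.

Lemma quot_sum (I : Type) (r : seq I) (P : pred I) (F : I -> V -> C) :
  (forall i, P i -> quot (F i)) -> quot (fun p => \sum_(i <- r | P i) F i p).
Proof. by move=> qF; apply: (big_closed (quot_cst 0) quotD). Qed.

Lemma quot_prod (I : Type) (r : seq I) (P : pred I) (F : I -> V -> C) :
  (forall i, P i -> quot (F i)) -> quot (fun p => \prod_(i <- r | P i) F i p).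
Proof. by move=> qF; apply: (big_closed (quot_cst 1) quotM). Qed.

Lemma quot_meromorphic f : quot f -> meromorphic f.
Proof.
move=> [g [h [eg [eh nh] e]]] p; exists g, h; split => //.
- by apply: nearW => q; exact: eg.
- by apply: nearW => q; exact: eh.
- by apply: nearW.
Qed.

Lemma good_off_hypersurface h (P : V -> Prop) : good h ->
  (forall q, h q != 0 -> P q) -> off_hypersurface P.
Proof.
move=> [eh nh] hP p; exists h; split => //; last exact: nearW.
by apply: nearW => q; exact: eh.
Qed.

(** Along some direction the function is affine and not constant, so
    composition with it keeps germs nonzero and it takes values in every dense
    set near each point. *)
Definition slanted l := entire l /\ exists v (c : C), c != 0 /\ forall p t, l (p + t *: v) = l p + t * c.

Lemma line_cvg p v (U : set V) : nbhs p U -> \forall t \near (0 : C), U (p + t *: v).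
Proof.
move=> /nbhs_normP[e /= e0 eU].
have eE : e = (complex.Re e)%:C%C by rewrite RRe_real // gtr0_real.
have vE : `|v| = (complex.Re `|v|)%:C%C by rewrite RRe_real // ger0_real.
have re0 : 0 < complex.Re e by rewrite -ltcR -eE.
have rv0 : 0 <= complex.Re `|v| by rewrite -ler0c -vE.
have k0 : 0 < complex.Re `|v| + 1 by rewrite ltr_wpDl.
apply/nearC; exists (complex.Re e / (complex.Re `|v| + 1)); first by rewrite divr_gt0.
move=> t; rewrite subr0 ltr_pdivlMr // => tv; apply: eU => /=.
rewrite opprD addNKr normrN normrZ vE normE -rmorphM /= eE ltcR.
by apply: le_lt_trans tv; rewrite ler_wpM2l ?nm_ge0 // lerDl.
Qed.

Lemma good_comp_slanted (f : C -> C) l : (forall z, differentiable f z) ->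
  (forall z, nonzero_germ f z) -> slanted l -> good (fun p => f (l p)).
Proof.
move=> ef nf [el [v [c [c0 lv]]]]; split.
  by move=> p; exact: (differentiable_comp (el p) (ef (l p))).
move=> p fl0; apply: (nf (l p)).
have /nearC[d d0 dP] := line_cvg v fl0.
apply/nearC; exists (d * nm c); first by rewrite mulr_gt0 // nm_gt0.
move=> q qd; have := dP ((q - l p) / c); rewrite subr0 nmM nmV ltr_pdivrMr ?nm_gt0 //.
by move=> /(_ qd); rewrite lv divfK // addrC subrK.
Qed.

Lemma slantedD l (c : C) : slanted l -> slanted (fun p => l p + c).
Proof.
move=> [el [v [a [a0 lv]]]]; split; first exact: entireD el (@entire_cst c).
by exists v, a; split => // p t; rewrite lv addrAC.
Qed.

(** If g1 h2 - g2 h1 were nonzero at some point, it would be so on an open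
    set, and there also at a point where h1 h2 h0 <> 0 and where l takes a
    value in D; but at such a point f1 = f2. *)
Lemma slanted_sub (D : set C) l : slanted l ->
  (forall (z : C) (U : set C), nbhs z U -> exists2 w, U w & D w) ->
  forall f1 f2 h0 : V -> C, quot f1 -> quot f2 -> good h0 ->
  (forall q, h0 q != 0 -> D (l q) -> f1 q = f2 q) -> mero_eq f1 f2.
Proof.
move=> [el [v [c [c0 lv]]]] dD f1 f2 h0 [g1 [h1 [eg1 gh1 e1]]] [g2 [h2 [eg2 gh2 e2]]] gh0 f12.
have gh := goodM (goodM gh1 gh2) gh0.
suff E : forall q, g1 q * h2 q = g2 q * h1 q.
  apply: (good_off_hypersurface (goodM gh1 gh2)) => q.
  rewrite mulf_eq0 negb_or => /andP[h1q h2q]; rewrite e1 // e2 //.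
  by apply/eqP; rewrite eqr_div // E.
move=> q; apply/eqP; apply: contrapT => /negP; rewrite -subr_eq0 => nE.
have eE : entire (fun q => g1 q * h2 q - g2 q * h1 q).
  apply: entireD; first by apply: entireM => //; case: gh2.
  by apply: entireN; apply: entireM => //; case: gh1.
have [r rE hr] := nonzero_germP (gh.2 q) (entire_neq0_open eE nE).
have Un : nbhs r (fun q => g1 q * h2 q - g2 q * h1 q != 0 /\ h1 q * h2 q * h0 q != 0).
  exact: filterI (entire_neq0_open eE rE) (entire_neq0_open gh.1 hr).
have /nearC[d d0 dP] := line_cvg v Un.
have [|w wd Dw] := dD (l r) (fun w => nm (w - l r) < d * nm c).
  by apply/nearC; exists (d * nm c) => //; rewrite mulr_gt0 // nm_gt0.
have := dP ((w - l r) / c); rewrite subr0 nmM nmV ltr_pdivrMr ?nm_gt0 //.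
move=> /(_ wd)[]; set x := r + _ *: v => xE xh.
have lx : l x = w by rewrite /x lv divfK // addrC subrK.
move: xh; rewrite !mulf_eq0 !negb_or => /andP[/andP[x1 x2] x0].
have := f12 x x0; rewrite lx => /(_ Dw); rewrite e1 // e2 // => /eqP.
rewrite eqr_div // => /eqP e; move: xE; rewrite e subrr eqxx //.
Qed.

End General.

Lemma slanted_id : slanted (id : C -> C).
Proof.
split; first by move=> p; exact: ex_diff.
by exists 1, 1; split => [|p t]; [exact: oner_neq0|rewrite mulr1 [t *: _]mulr1].
Qed.

(** Baire's theorem for the sets f k <> 0, which are open and dense. *)
Lemma dense_countable_good (f : nat -> C -> C) : (forall k, good (f k)) ->
  forall (z : C) (U : set C), nbhs z U -> exists2 w, U w & forall k, f k w != 0.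
Proof.
move=> gf z U /nearC[d d0 dU].
pose M := rV2 R.
pose phi (x : M) : C := ((x : 'rV[R]_2) 0 0 +i* (x : 'rV[R]_2) 0 1)%C.
have phi_ball (x y : M) (e : R) : ball x e y -> nm (phi y - phi x) < 2 * e.
  move=> xy; apply: le_lt_trans (nm_le_ReIm _) _.
  have b i j : `|(x : 'rV[R]_2) i j - (y : 'rV[R]_2) i j| < e by case: xy => _; apply.
  by have := b 0 0; have := b 0 1; rewrite /= distrC [`|_ 0 0 - _|]distrC; lra.
pose psi (w : C) : M :=
  (\row_(j < 2) (if j == 0 then complex.Re w else complex.Im w : R) : 'rV[R]_2).
have psiK w : phi (psi w) = w.
  by rewrite /phi /psi !mxE /=; case: w.
have psi_ball (x : M) w (e : R) : nm (w - phi x) < e -> ball x e (psi w).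
  move=> xw; split=> [|i j]; first exact: le_lt_trans (nm_ge0 _) xw.
  rewrite ord1 /psi mxE /ball /=.
  case: eqP => [->|/eqP j0].
    apply: le_lt_trans xw; rewrite distrC.
    by apply: le_trans (Re_le_nm _); rewrite cReD cReN.
  have -> : j = 1 by apply/val_inj; case: j j0 => [[|[|]]].
  apply: le_lt_trans xw; rewrite distrC.
  by apply: le_trans (Im_le_nm _); rewrite cImD cImN.
pose O k : set M := [set x | f k (phi x) != 0].
have Ood : forall k, open (O k) /\ dense (O k).
  move=> k; split.
    rewrite openE => x fx; have /nearC[e e0 eP] := entire_neq0_open (gf k).1 fx.
    apply/nbhs_ballP; exists (e / 2); first by rewrite /= divr_gt0.
    move=> y xy; apply: eP; have := phi_ball _ _ _ xy; lra.
  move=> A [x Ax] oA.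
  have /nbhs_ballP[e /= e0 eA] : nbhs x A by apply: open_nbhs_nbhs; split.
  have [|w wx fw] := nonzero_germP ((gf k).2 (phi x)) (U := fun w => nm (w - phi x) < e).
    by apply/nearC; exists e.
  by exists (psi w); split; [apply: eA; exact: psi_ball|rewrite /O /= psiK].
have := @Baire R M O Ood [set x | nm (phi x - z) < d].
case.
- by exists (psi z); rewrite /= psiK subrr nm0.
- rewrite openE => x /= xz; apply/nbhs_ballP; exists ((d - nm (phi x - z)) / 2).
    by rewrite /= divr_gt0 // subr_gt0.
  move=> y /phi_ball xy /=; have := nmD (phi y - phi x) (phi x - z).
  by rewrite addrA subrK; lra.
- move=> x [/dU Ux xO]; exists (phi x) => // k.
  exact: (xO k).
Qed.

(** * Meromorphic functions of one variable *)

Lemma off_hypersurfaceI (P Q : C -> Prop) : off_hypersurface P -> off_hypersurface Q ->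
  off_hypersurface (fun z => P z /\ Q z).
Proof.
move=> hP hQ p; have [h [hh nh eh]] := hP p; have [g [hg ng eg]] := hQ p.
exists (fun q => h q * g q); split.
- near=> q; apply: differentiableM; [near: q; exact: hh|near: q; exact: hg].
- exact: nonzero_germM.
- near=> q; rewrite mulf_eq0 negb_or => /andP[hq gq]; split.
  + by move: hq; near: q.
  + by move: gq; near: q.
Unshelve. all: by end_near. Qed.

Lemma off_hypersurfaceT (P : C -> Prop) : (forall z, P z) -> off_hypersurface P.
Proof.
move=> hP; apply: (good_off_hypersurface (good_cst (oner_neq0 C))) => q _; exact: hP.
Qed.

Lemma off_hypersurface_sub (P Q : C -> Prop) : (forall z, P z -> Q z) ->
  off_hypersurface P -> off_hypersurface Q.
Proof.
move=> PQ hP p; have [h [hh nh eh]] := hP p; exists h; split => //.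
by apply: filterS eh => q eh /eh /PQ.
Qed.

Lemma off_hypersurface_all (I : finType) (P : I -> C -> Prop) :
  (forall i, off_hypersurface (P i)) -> off_hypersurface (fun z => forall i, P i z).
Proof.
move=> hP.
have H (s : seq I) : off_hypersurface (fun z => forall i, i \in s -> P i z).
  elim: s => [|i s IH]; first exact: off_hypersurfaceT.
  apply: off_hypersurface_sub (off_hypersurfaceI (hP i) IH) => z [Pi Ps] j.
  by rewrite in_cons => /orP[/eqP->|/Ps].
apply: off_hypersurface_sub (H (enum I)) => z Pz i.
by apply: Pz; rewrite mem_enum.
Qed.

Lemma meromorphicM (f g : C -> C) : meromorphic f -> meromorphic g ->
  meromorphic (fun z => f z * g z).
Proof.
move=> mf mg p; have [a [b [ha hb nb e]]] := mf p; have [c [d [hc hd nd e']]] := mg p.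
exists (fun q => a q * c q), (fun q => b q * d q); split.
- near=> q; apply: differentiableM; [near: q; exact: ha|near: q; exact: hc].
- near=> q; apply: differentiableM; [near: q; exact: hb|near: q; exact: hd].
- exact: nonzero_germM.
- near=> q; rewrite mulf_eq0 negb_or => /andP[bq dq].
  rewrite -mulf_div; congr (_ * _).
  + by move: bq; near: q.
  + by move: dq; near: q.
Unshelve. all: by end_near. Qed.

Lemma meromorphicD (f g : C -> C) : meromorphic f -> meromorphic g ->
  meromorphic (fun z => f z + g z).
Proof.
move=> mf mg p; have [a [b [ha hb nb e]]] := mf p; have [c [d [hc hd nd e']]] := mg p.
exists (fun q => a q * d q + c q * b q), (fun q => b q * d q); split.
- near=> q; apply: (@differentiableD _ _ _ (fun q => a q * d q) (fun q => c q * b q));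
    apply: differentiableM.
  + by near: q; exact: ha.
  + by near: q; exact: hd.
  + by near: q; exact: hc.
  + by near: q; exact: hb.
- near=> q; apply: differentiableM; [near: q; exact: hb|near: q; exact: hd].
- exact: nonzero_germM.
- near=> q; rewrite mulf_eq0 negb_or => /andP[bq dq].
  rewrite -addf_div //; congr (_ + _).
  + by move: bq; near: q.
  + by move: dq; near: q.
Unshelve. all: by end_near. Qed.

Lemma meromorphic_sum (I : Type) (r : seq I) (F : I -> C -> C) :
  (forall i, meromorphic (F i)) -> meromorphic (fun p => \sum_(i <- r) F i p).
Proof. by move=> mF; apply: (big_closed (quot_meromorphic (quot_cst 0)) meromorphicD) => i _. Qed.

(** The numerator is entire and nonzero at one point, hence has nonzero germs
    everywhere: this is where one variable is used. *)
Lemma quot_inv (f : C -> C) : quot f ->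
  (forall (z : C) (U : set C), nbhs z U -> exists2 w, U w & f w != 0) ->
  quot (fun z => (f z)^-1).
Proof.
move=> [g [h [eg gh e]]] nf.
have [z0 _ hz0] := nonzero_germP (gh.2 0) (filterT : nbhs (0 : C) setT).
have [z hz fz] := nf z0 _ (entire_neq0_open gh.1 hz0).
have gg : good g.
  split => //; apply: (entire_nonzero_germ eg (z0 := z)).
  by move: fz; rewrite e //; apply: contraNneq => ->; rewrite mul0r.
exists (fun z => h z * h z), (fun z => g z * h z); split.
- by apply: entireM; case: gh.
- exact: goodM.
- move=> q; rewrite mulf_eq0 negb_or => /andP[gq hq].
  by rewrite e // invf_div -mulf_div divff // mulr1.
Qed.

End GoodFunctions.

(** * Meromorphy of theta quotients *)

Section ThetaQuotients.
Context {R : realType}.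
Local Notation C := (Cplx R).
Variable tau : C.
Hypothesis tau0 : 0 < complex.Im tau.
Local Notation th := (theta tau).

Section General.
Context {V : normedModType C}.
Implicit Types (f g Z L : V -> C).

(** Each of Z and L can be moved with the other one fixed. *)
Definition coordinates Z L := [/\ entire Z, entire L &
  exists vz vl, forall p (t : C), [/\ Z (p + t *: vz) = Z p + t, L (p + t *: vz) = L p,
    Z (p + t *: vl) = Z p & L (p + t *: vl) = L p + t]].

Lemma coordinatesZ Z L (c : C) : coordinates Z L -> coordinates (fun p => Z p + c) L.
Proof.
move=> [eZ eL [vz [vl ZL]]]; split; [exact: entireD eZ (@entire_cst _ _ c)|exact: eL|].
by exists vz, vl => p t; have [-> -> -> ->] := ZL p t; split; rewrite 1?addrAC.
Qed.

Lemma coordinatesL Z L (c : C) : coordinates Z L -> coordinates Z (fun p => L p + c).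
Proof.
move=> [eZ eL [vz [vl ZL]]]; split; [exact: eZ|exact: entireD eL (@entire_cst _ _ c)|].
by exists vz, vl => p t; have [-> -> -> ->] := ZL p t; split; rewrite 1?addrAC.
Qed.

Lemma slanted_comb f Z L (a b : C) : coordinates Z L -> (a != 0) || (b != 0) ->
  (forall p q, f p - (a * Z p + b * L p) = f q - (a * Z q + b * L q)) -> slanted f.
Proof.
move=> [eZ eL [vz [vl ZL]]] ab fE; pose c := f 0 - (a * Z 0 + b * L 0).
have {}fE : f = fun p => a * Z p + b * L p + c.
  by apply/funext => p; rewrite /c -(fE p) addrC subrK.
rewrite fE; split.
  apply: entireD (@entire_cst _ _ c); apply: entireD; apply: entireM => //; exact: entire_cst.
have [a0|a0] := eqVneq a 0.
  rewrite a0 eqxx /= in ab; exists vl, b; split => // p t; have [_ _ -> ->] := ZL p t.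
  by rewrite a0; ring.
by exists vz, a; split => // p t; have [-> -> _ _] := ZL p t; ring.
Qed.

(** The last hypothesis says that f is a Z + b L up to a constant, in a form
    that ring can check. *)
Lemma good_theta f Z L (a b : C) : coordinates Z L -> (a != 0) || (b != 0) ->
  (forall p q, f p - (a * Z p + b * L p) = f q - (a * Z q + b * L q)) ->
  good (fun p => th (f p)).
Proof.
move=> ZL ab fE; apply: good_comp_slanted; last exact: slanted_comb fE.
- by move=> z; exact: (theta_differentiable tau0).
- by move=> z; exact: (theta_nonzero_germ tau0).
Qed.

Lemma quot_theta f Z L (a b : C) : coordinates Z L -> (a != 0) || (b != 0) ->
  (forall p q, f p - (a * Z p + b * L p) = f q - (a * Z q + b * L q)) ->
  quot (fun p => th (f p)) /\ quot (fun p => (th (f p))^-1).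
Proof.
move=> ZL ab fE; have gf := good_theta ZL ab fE; split; last exact: quotV.
by apply: quot_entire; case: gf.
Qed.

End General.

Lemma good_theta1 (c : C) : good (fun l => th (l + c)).
Proof.
apply: good_comp_slanted; last exact: slantedD slanted_id.
- by move=> z; exact: (theta_differentiable tau0).
- by move=> z; exact: (theta_nonzero_germ tau0).
Qed.

Lemma quot_theta1 (c : C) : quot (fun l => th (l + c)).
Proof. by apply: quot_entire; case: (good_theta1 c). Qed.

Lemma quotV_theta1 (c : C) : quot (fun l => (th (l + c))^-1).
Proof. exact: quotV (good_theta1 c). Qed.

Lemma thN z : th (- z) = - th z.
Proof. exact: (thetaN tau0). Qed.

(** There are countably many conditions theta(l + e k) <> 0. *)
Lemma dense_dom (e : C) : forall (z : C) (U : set C), nbhs z U ->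
  exists2 w, U w & dom th e w.
Proof.
pose f (j : nat) l := if unpickle j is Some k then th (l + e * (k : int)%:~R) else 1.
move=> z U zU; have [|w Uw fw] := @dense_countable_good _ f _ z U zU.
  move=> j; rewrite /f; case: (unpickle j) => [k|]; first exact: good_theta1.
  exact: good_cst (oner_neq0 _).
by exists w => // k; have := fw (pickle k); rewrite /f pickleK.
Qed.

Lemma coordinates_pair : coordinates (fun p : C * C => p.1) (fun p : C * C => p.2).
Proof.
split.
- by move=> p; apply: (linear_differentiable (f := fst)); move=> q; exact: cvg_fst.
- by move=> p; apply: (linear_differentiable (f := snd)); move=> q; exact: cvg_snd.
- by exists (1, 0), (0, 1) => p t; split; rewrite /= ?[t *: 1]mulr1 ?scaler0 ?addr0.
Qed.
Section TensorEntries.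
Variables (e : C) (n : nat) (Lam : 'I_n -> nat) (Y : 'I_n -> C).
Local Notation I := {dffun forall i, 'I_(Lam i).+1}.
Local Notation wl := (fun i => @hat_wt (Lam i)).
Local Notation Xl := (fun i => @hat_eval C th e (Lam i) (Y i)).
Local Notation tens := (@tensors C e n (fun i => 'I_(Lam i).+1) wl Xl).

(** On highest weight vectors the entries (false, true) vanish, and those with
    (true, true) have the factor theta(l) / theta(l) in l. *)
Lemma tensors_vac r v z l (k : I) : dom th e l ->
  tens r v true z l k (vacuum Lam) = (v && (k == vacuum Lam))%:R * \prod_(i <- r) th (z - Y i).
Proof.
elim: r v l k => [|i r IH] v l k dl /=; first by rewrite big_nil mulr1; case: v.
rewrite /tensor2 big_cons.
have E q j : emb_entries Xl i v q z (shifted e (wts wl r) l j) k j *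
    tens r q true z l j (vacuum Lam) =
  (if q && (j == vacuum Lam) then emb_entries Xl i v true z
    (shifted e (wts wl r) l (vacuum Lam)) k (vacuum Lam) * \prod_(i <- r) th (z - Y i) else 0).
  rewrite IH //; case: q => /=; last by rewrite mul0r mulr0.
  by have [->|_] := eqVneq j (vacuum Lam); rewrite ?mul1r // mul0r mulr0.
set c := _ * \prod_(_ <- _) _ in E.
transitivity (\sum_q \sum_(j : I) (if q && (j == vacuum Lam) then c else 0)).
  by apply: eq_bigr => q _; apply: eq_bigr => j _; exact: E.
rewrite /c big_bool /= [X in _ + X]big1 ?addr0 // -big_mkcond big_pred1_eq mulrA; congr (_ * _).
have l0 : th (shifted e (wts wl r) l (vacuum Lam)) != 0.
  by apply: dom_neq0; exact: dom_shiftN dl.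
rewrite /emb_entries /emb /hat_eval ffunE /= mulr0; case: v {c E} => /=; last first.
  by rewrite addn1 !mul0r if_same.
rewrite !addr0 !addn0 mulfK //; case: ifP => km.
  congr (_%:R * _); congr nat_of_bool; apply/eqP/eqP => [k0|->]; last by rewrite ffunE.
  by apply: (same_off_at km); apply/val_inj; rewrite ffunE.
suff -> : (k == vacuum Lam) = false by rewrite mul0r.
apply: contraFF km => /eqP ->; by apply/forallP => j; rewrite eqxx implybT.
Qed.

Lemma entire_theta1 (c : C) : entire (fun z => th (z + c)).
Proof. by case: (good_theta1 c). Qed.

Lemma entire_sum (J : Type) (r : seq J) (f : J -> C -> C) :
  (forall j, entire (f j)) -> entire (fun z => \sum_(j <- r) f j z).
Proof. by move=> ef; apply: (big_closed (@entire_cst _ C 0) (@entireD _ C)) => j _. Qed.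

Lemma entire_hat_eval i v u l k k' : entire (fun z => Xl i v u z l k k').
Proof.
rewrite /hat_eval; apply: entireM; first exact: entire_cst.
have E (c : C) : entire (fun z => th (z - Y i + c)).
  have -> : (fun z => th (z - Y i + c)) = (fun z => th (z + (c - Y i))).
    by apply/funext => z; congr th; ring.
  exact: entire_theta1.
case: v u => [] []; rewrite /eval_entry.
- by apply: entireM; [apply: entireM; [exact: E|exact: entire_cst]|exact: entire_cst].
- apply: entireM; [apply: entireM; [|exact: entire_cst]|exact: entire_cst].
  have -> : (fun z => th (l + (z - Y i) + e * k'%:R + e)) =
    (fun z => th (z - Y i + (l + e * k'%:R + e))) by apply/funext => z; congr th; ring.
  exact: E.
- apply: entireN; apply: entireM; [apply: entireM; [|exact: entire_cst]|exact: entire_cst].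
  have -> : (fun z => th (z - Y i - l + e * (Lam i).+1%:R - e * k'%:R)) =
    (fun z => th (z - Y i + (- l + e * (Lam i).+1%:R - e * k'%:R))).
    by apply/funext => z; congr th; ring.
  exact: E.
- apply: entireM; [apply: entireM; [|exact: entire_cst]|exact: entire_cst].
  have -> : (fun z => th (z - Y i + e * (Lam i).+1%:R - e * k'%:R - e)) =
    (fun z => th (z - Y i + (e * (Lam i).+1%:R - e * k'%:R - e))).
    by apply/funext => z; congr th; ring.
  exact: E.
Qed.

Lemma entire_tensors r v u l k k' : entire (fun z => tens r v u z l k k').
Proof.
elim: r v u k k' => [|i r IH] v u k k' /=; first exact: entire_cst.
apply: entire_sum => q; apply: entire_sum => j; apply: entireM; last exact: IH.
rewrite /emb_entries /emb; case: (same_off i k j); last exact: entire_cst.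
exact: entire_hat_eval.
Qed.

Lemma quot_hat_eval i v u z k k' (c : C) : quot (fun l => Xl i v u z (l + c) k k').
Proof.
rewrite /hat_eval; apply: quotM; first exact: quot_cst.
have E f a : (forall l, f l = l + a) -> quot (fun l => th (f l)).
  by move=> h; have := quot_theta1 a; congr quot; apply/funext => l; rewrite h.
case: v u => [] []; rewrite /eval_entry.
- apply: quotM (quotV_theta1 c); apply: quotM; first exact: quot_cst.
  by apply: (E _ (c + e * k'%:R)) => l; ring.
- apply: quotM (quotV_theta1 c); apply: quotM; last exact: quot_cst.
  by apply: (E _ (c + (z - Y i) + e * k'%:R + e)) => l; ring.
- apply: quotN; apply: quotM (quotV_theta1 c); apply: quotM; last exact: quot_cst.
  have -> : (fun l => th (z - Y i - (l + c) + e * (Lam i).+1%:R - e * k'%:R)) =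
    (fun l => - th (l + (c - (z - Y i) - e * (Lam i).+1%:R + e * k'%:R))).
    by apply/funext => l; rewrite -thN; congr th; ring.
  exact: quotN (quot_theta1 _).
- apply: quotM (quotV_theta1 c); apply: quotM; first exact: quot_cst.
  by apply: (E _ (c - e * (Lam i).+1%:R + e * k'%:R + e)) => l; ring.
Qed.

Lemma quot_tensors r v u z k k' (c : C) : quot (fun l => tens r v u z (l + c) k k').
Proof.
elim: r v u k k' => [|i r IH] v u k k' /=; first exact: quot_cst.
apply: quot_sum => q _; apply: quot_sum => j _; apply: quotM; last exact: IH.
rewrite /emb_entries /emb; case: (same_off i k j); last exact: quot_cst.
have := @quot_hat_eval i v q z (k i) (j i) (c - e * (wts wl r j)%:~R).
by congr quot; apply/funext => l; rewrite /shifted addrA.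
Qed.

Local Notation T := (tens (enum 'I_n)).

Lemma quot_vec m k (c : C) : quot (fun l => vec th e Y T m (l + c) k).
Proof.
rewrite /vec; elim: (words _ _ _ _) k c => [|y s IH] k c /=; first exact: quot_cst.
apply: quotM; first exact: quot_theta1.
apply: quot_sum => j _; apply: quotM; first exact: quot_tensors.
by have := IH j (c + e); congr quot; apply/funext => l; rewrite /dyn_shift addrA.
Qed.

Lemma quot_vec0 m k : quot (fun l => vec th e Y T m l k).
Proof. by have := quot_vec m k 0; congr quot; apply/funext => l; rewrite addr0. Qed.

Lemma quot_gauge m (c : C) : quot (fun l => gauge th e Y m (l + c)) /\
  quot (fun l => (gauge th e Y m (l + c))^-1).
Proof.
have gP : good (fun l => \prod_(r < size_of m) th (l + c + e * r.+1%:R)).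
  apply: good_prod => r _; have := good_theta1 (c + e * r.+1%:R).
  by congr good; apply/funext => l; rewrite addrA.
split; first by apply: quotM; [exact: quot_cst|exact: quotV].
have -> : (fun l => (gauge th e Y m (l + c))^-1) =
  (fun l => (gauge_num th e Y m)^-1 * \prod_(r < size_of m) th (l + c + e * r.+1%:R)).
  by apply/funext => l; rewrite /gauge invfM invrK.
by apply: quotM; [exact: quot_cst|apply: quot_entire; case: gP].
Qed.

Lemma quot_Mx k p (c : C) : quot (fun l => Mx th e Y T (l + c) k p).
Proof. by apply: quotM; [case: (quot_gauge (fun i => p i) c)|exact: quot_vec]. Qed.

Lemma quot_Mx0 k p : quot (fun l => Mx th e Y T l k p).
Proof. by have := quot_Mx k p 0; congr quot; apply/funext => l; rewrite addr0. Qed.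

Lemma quot_det m (A : C -> 'M[C]_m) :
  (forall i j, quot (fun l => A l i j)) -> quot (fun l => \det (A l)).
Proof.
move=> qA; apply: quot_sum => s _; apply: quotM; first exact: quot_cst.
by apply: quot_prod => i _; exact: qA.
Qed.

Lemma quot_adj m (A : C -> 'M[C]_m) i j :
  (forall i j, quot (fun l => A l i j)) -> quot (fun l => (\adj (A l)) i j).
Proof.
move=> qA; under [X in quot X]eq_fun do rewrite mxE.
apply: quotM; first exact: quot_cst.
apply: quot_det => i' j'; under [X in quot X]eq_fun do rewrite !mxE.
exact: qA.
Qed.

End TensorEntries.
Section ExplicitQuotients.
Context {V : normedModType C}.
Variables (e : C) (n : nat) (Lam : 'I_n -> nat) (Y : 'I_n -> C).
Local Notation I := {dffun forall i, 'I_(Lam i).+1}.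
Variable wt : I -> int.
Implicit Types (f X Z L : V -> C).

Lemma quot_th (a b : C) f Z L : coordinates Z L -> (a != 0) || (b != 0) ->
  (forall p q, f p - (a * Z p + b * L p) = f q - (a * Z q + b * L q)) -> quot (fun p => th (f p)).
Proof. by move=> ZL ab fE; case: (quot_theta ZL ab fE). Qed.

Lemma quot_thV (a b : C) f Z L : coordinates Z L -> (a != 0) || (b != 0) ->
  (forall p q, f p - (a * Z p + b * L p) = f q - (a * Z q + b * L q)) ->
  quot (fun p => (th (f p))^-1).
Proof. by move=> ZL ab fE; case: (quot_theta ZL ab fE). Qed.

Lemma neq0Z (b : C) : (1 != 0 :> C) || (b != 0).
Proof. by rewrite oner_neq0. Qed.

Lemma neq0L (a : C) : (a != 0) || (1 != 0 :> C).
Proof. by rewrite oner_neq0 orbT. Qed.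

Lemma good_acoef m Z L : coordinates Z L -> good (fun p => acoef th e Y m (Z p)).
Proof.
move=> ZL; apply: good_prod => i _; apply: (good_theta (a := 1) (b := 0) ZL (neq0Z 0)).
by move=> p q; rewrite /=; ring.
Qed.

(** What the kernels W need of Z and L to be quotients. It holds for
    coordinates, and for z constant and L the identity (theta_class_cst). *)
Definition theta_class Z L := forall f (a b : C), (a != 0) || (b != 0) ->
  (forall p q, f p - (a * Z p + b * L p) = f q - (a * Z q + b * L q)) ->
  quot (fun p => th (f p)) /\ quot (fun p => (th (f p))^-1).

Lemma theta_class_coordinates Z L : coordinates Z L -> theta_class Z L.
Proof. by move=> ZL f a b ab fE; exact: quot_theta ZL ab fE. Qed.

Lemma theta_classZ Z L (c : C) : theta_class Z L -> theta_class (fun p => Z p + c) L.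
Proof.
move=> ZL f a b ab fE; apply: (ZL f a b ab) => p q.
by have := fE p q; rewrite !mulrDr ![_ + a * c + _]addrAC !opprD !addrA => /addIr.
Qed.

Lemma theta_classL Z L (c : C) : theta_class Z L -> theta_class Z (fun p => L p + c).
Proof.
move=> ZL f a b ab fE; apply: (ZL f a b ab) => p q.
by have := fE p q; rewrite !mulrDr !opprD !addrA => /addIr.
Qed.

Lemma class_th Z L (a b : C) f : theta_class Z L -> (a != 0) || (b != 0) ->
  (forall p q, f p - (a * Z p + b * L p) = f q - (a * Z q + b * L q)) -> quot (fun p => th (f p)).
Proof. by move=> ZL ab fE; case: (ZL f a b ab fE). Qed.

Lemma class_thV Z L (a b : C) f : theta_class Z L -> (a != 0) || (b != 0) ->
  (forall p q, f p - (a * Z p + b * L p) = f q - (a * Z q + b * L q)) ->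
  quot (fun p => (th (f p))^-1).
Proof. by move=> ZL ab fE; case: (ZL f a b ab fE). Qed.

Lemma quot_Wa Z L (q q' : I) : theta_class Z L -> quot (fun p => Wa th e Y (Z p) (L p) q q').
Proof.
move=> ZL; apply: quotM; first exact: quot_cst.
apply: quotM; last by apply: (class_thV ZL (neq0L 0)) => ? ?; ring.
apply: quotM; first by apply: quot_prod => i _; apply: (class_th ZL (neq0Z 0)) => ? ?; ring.
by apply: (class_th ZL (neq0L 0)) => ? ?; ring.
Qed.

Lemma quot_Wb Z L (q q' : I) : theta_class Z L -> quot (fun p => Wb th e Y (Z p) (L p) q q').
Proof.
move=> ZL; apply: quot_sum => j _; apply: quotM; first exact: quot_cst.
apply: quotN; apply: quotM; last exact: quot_cst.
apply: quotM.
  apply: quotM; last by apply: (class_thV ZL (neq0L 0)) => ? ?; ring.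
  by apply: (class_th ZL (neq0L 1)) => ? ?; ring.
apply: quot_prod => i _; apply: quotM; last exact: quot_cst.
by apply: (class_th ZL (neq0Z 0)) => ? ?; ring.
Qed.

Lemma quot_Wc Z L (q q' : I) : theta_class Z L -> quot (fun p => Wc th e Y wt (Z p) (L p) q q').
Proof.
move=> ZL; apply: quot_sum => j _; apply: quotM; first exact: quot_cst.
apply: quotN; apply: quotM; last exact: quot_cst.
apply: quotM.
  apply: quotM; last by apply: (class_thV ZL (neq0L 0)) => ? ?; ring.
  by apply: (class_th ZL (neq0Z (-1))) => ? ?; ring.
apply: quot_prod => i _; apply: quotM; last exact: quot_cst.
by apply: (class_th ZL (neq0Z 0)) => ? ?; ring.
Qed.

Lemma quot_Wd Z L (q q' : I) : theta_class Z L -> quot (fun p => Wd th e Y wt (Z p) (L p) q q').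
Proof.
move=> ZL; apply: quotM.
  apply: quotD.
    apply: quotM; last exact: quot_cst.
    apply: quotM.
      apply: quotM; last by apply: (class_thV ZL (neq0L 0)) => ? ?; ring.
      by apply: (class_th ZL (neq0L 0)) => ? ?; ring.
    apply: quot_prod => i _; apply: quotM; apply: (class_th ZL (neq0Z 0)) => ? ?; ring.
  apply: quot_sum => r _; apply: quotM; last exact: quot_Wb.
  by apply: quot_Wc; apply: theta_classL; apply: theta_classZ.
have -> : (fun p => (acoef th e Y (fun i => q i) (Z p + e) *
     th (L p + e + e * (size_of (fun i => q i))%:R) / th (L p + e))^-1) =
  (fun p => (acoef th e Y (fun i => q i) (Z p + e))^-1 *
     (th (L p + e + e * (size_of (fun i => q i))%:R))^-1 * th (L p + e)).
  by apply/funext => p; rewrite !invfM invrK.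
apply: quotM; last by apply: (class_th ZL (neq0L 0)) => ? ?; ring.
apply: quotM; last by apply: (class_thV ZL (neq0L 0)) => ? ?; ring.
under [X in quot X]eq_fun do rewrite /acoef -prodfV.
apply: quot_prod => i _; apply: (class_thV ZL (neq0Z 0)) => ? ?; ring.
Qed.

Lemma quot_W_class v u Z L (q q' : I) : theta_class Z L -> quot (fun p => W th e Y wt v u (Z p) (L p) q q').
Proof.
case: v u => [] []; [exact: quot_Wa|exact: quot_Wb|exact: quot_Wc|exact: quot_Wd].
Qed.

Lemma quot_W v u Z L (q q' : I) : coordinates Z L -> quot (fun p => W th e Y wt v u (Z p) (L p) q q').
Proof. by move=> /theta_class_coordinates; exact: quot_W_class. Qed.

Lemma quot_Rhat s r X L : coordinates X L -> quot (fun p => Rhat th e (X p) (L p) s r).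
Proof.
move=> XL; have LV : quot (fun p => (th (L p))^-1) by apply: (quot_thV XL (neq0L 0)) => ? ?; ring.
case: s r => [[] []] [[] []] /=; try exact: quot_cst.
- by apply: (quot_th XL (neq0Z 0)) => ? ?; ring.
- apply: quotM LV; apply: quotM; first by apply: (quot_th XL (neq0L 0)) => ? ?; ring.
  by apply: (quot_th XL (neq0Z 0)) => ? ?; ring.
- apply: quotN; apply: quotM LV; apply: quotM; last exact: quot_cst.
  by apply: (quot_th XL (neq0L 1)) => ? ?; ring.
- apply: quotM LV; apply: quotM; last exact: quot_cst.
  by apply: (quot_th XL (neq0Z (-1))) => ? ?; ring.
- apply: quotM LV; apply: quotM; first by apply: (quot_th XL (neq0L 0)) => ? ?; ring.
  by apply: (quot_th XL (neq0Z 0)) => ? ?; ring.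
- by apply: (quot_th XL (neq0Z 0)) => ? ?; ring.
Qed.

End ExplicitQuotients.

(** If b = 0 the function theta(f) is constant and its inverse exists as a
    quotient even if it is zero. *)
Lemma theta_class_cst (z : C) : theta_class (fun=> z) (id : C -> C).
Proof.
move=> f a b _ fE; have {}fE p : f p = b * p + f 0.
  have := fE p 0; rewrite mulr0 addr0 => h.
  by rewrite -[LHS](subrK (a * z + b * p)) h; ring.
have [b0|b0] := eqVneq b 0.
  have -> : f = fun=> f 0 by apply/funext => p; rewrite fE b0 mul0r add0r.
  by split; exact: quot_cst.
have gf : good (fun p => th (f p)).
  apply: good_comp_slanted.
  - by move=> w; exact: (theta_differentiable tau0).
  - by move=> w; exact: (theta_nonzero_germ tau0).
  split; last by exists 1, b; split => // p t; rewrite (fE (p + _)) (fE p) [t *: 1]mulr1; ring.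
  have -> : f = fun p => b * p + f 0 by apply/funext.
  apply: entireD (@entire_cst _ _ _); apply: entireM; first exact: entire_cst.
  by case: (slanted_id (R := R)).
by split; [apply: quot_entire; case: gf|exact: quotV].
Qed.

(** * The tensor product of evaluation modules *)

Lemma sum_pair (A B : finType) (f : A * B -> C) : \sum_p f p = \sum_a \sum_b f (a, b).
Proof. by rewrite pair_bigA; apply: eq_bigr => -[]. Qed.

Section TensorProduct.
Variables (n : nat) (eta : C) (zs : 'rV[C]_n) (Lam : 'I_n -> nat).
Local Notation I := (S0_index Lam).
Local Notation e := (2 * eta).

(** The zero of the highest eigenvalue coming from the i-th factor, which is
    also the zero of its denominator in z. *)
Definition top_pt (i : 'I_n) : C := zs 0 i + eta * (Lam i)%:R.
Local Notation wl := (fun i => @hat_wt (Lam i)).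
Local Notation Xl := (fun i => @hat_eval C th e (Lam i) (top_pt i)).
Definition tens_list := @tensors C e n (fun i => 'I_(Lam i).+1) wl Xl.
Definition tens := tens_list (enum 'I_n).
Definition tens_wt : I -> int := wts wl (enum 'I_n).

Local Notation evals := (fun i : 'I_n => eval_module tau eta (Lam i) (zs 0 i - eta)).

Lemma eval_entE i w lam s t : ent (evals i) w lam s t =
  (th (w - top_pt i))^-1 * Xl i s.1 t.1 w lam s.2 t.2.
Proof.
have D : w - (zs 0 i - eta) - ((Lam i)%:R + 1) * eta = w - top_pt i by rewrite /top_pt; ring.
have nn (k m : 'I_(Lam i).+1) (x y : C) : (k == m :> nat)%:R * x = (k == m)%:R * x by [].
case: s t => [[] k] [[] m]; rewrite /= /hat_eval /eval_entry /eval_a /eval_b /eval_c /eval_d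
  /eval_den D /= ?addn0 ?addn1 ?eqSS -?[(Lam i).+1%:R]natr1; set b := (_ == _)%:R.
- have -> : w - (zs 0 i - eta) - ((Lam i)%:R + 1 - 2 * m%:R) * eta = w - top_pt i + e * m%:R.
    by rewrite /top_pt; ring.
  have -> : lam + 2 * m%:R * eta = lam + e * m%:R by ring.
  by rewrite invfM; move: (th _) (th _) (th _) (th _) => *; ring.
- have -> : lam + w - (zs 0 i - eta) - ((Lam i)%:R - 2 * m%:R - 1) * eta =
      lam + (w - top_pt i) + e * m%:R + e by rewrite /top_pt; ring.
  have -> : 2 * (m%:R + 1) * eta = e * m%:R + e by ring.
  by rewrite invfM; move: (th _) (th _) (th _) (th _) => *; ring.
- have -> : - lam + w - (zs 0 i - eta) + ((Lam i)%:R - 2 * m%:R + 1) * eta =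
      w - top_pt i - lam + e * ((Lam i)%:R + 1) - e * m%:R by rewrite /top_pt; ring.
  have -> : 2 * ((Lam i)%:R - m%:R + 1) * eta = e * ((Lam i)%:R + 1) - e * m%:R by ring.
  by rewrite invfM; move: (th _) (th _) (th _) (th _) => *; ring.
- have -> : w - (zs 0 i - eta) + ((Lam i)%:R - 2 * m%:R - 1) * eta =
      w - top_pt i + e * ((Lam i)%:R + 1) - e * m%:R - e by rewrite /top_pt; ring.
  have -> : lam - 2 * ((Lam i)%:R - m%:R) * eta =
      lam - e * ((Lam i)%:R + 1) + e * m%:R + e by ring.
  by rewrite invfM; move: (th _) (th _) (th _) (th _) => *; ring.
Qed.

Lemma hat_wtE i (k : 'I_(Lam i).+1) : (hat_wt k)%:~R = (Lam i)%:R - 2 * k%:R :> C.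
Proof. by rewrite /hat_wt intrB -!pmulrn natrD; ring. Qed.

Lemma L0E i (z lam : C) (s t : bool * I) :
  L0 eta evals i z lam s t = (th (z - top_pt i))^-1 *
    emb_entries Xl i s.1 t.1 z (lam - e * (\sum_(j < n | (i < j)%N) hat_wt (t.2 j))%:~R) s.2 t.2.
Proof.
have EA : \sum_(j < n | (i < j)%N) wt (evals j) (t.2 j) =
    (\sum_(j < n | (i < j)%N) hat_wt (t.2 j))%:~R.
  by rewrite rmorph_sum /=; apply: eq_bigr => j _; rewrite hat_wtE.
rewrite /L0 EA eval_entE /emb_entries /emb /same_off.
by case: ifP => _; rewrite ?mulr0.
Qed.

(** The factors are multiplied from the left, and the shift of a factor
    involves only the factors on its right. So for a final segment r of the
    indices the product is tens_list r up to the denominators. *)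
Lemma big_L0 (r : seq 'I_n) (z lam : C) (s t : bool * I) :
  sorted (fun i j : 'I_n => (i < j)%N) r -> (forall i j : 'I_n, i \in r -> (i <= j)%N -> j \in r) ->
  (\big[opcomp/opid]_(i <- r) L0 eta evals i z lam) s t =
  (\prod_(i <- r) (th (z - top_pt i))^-1) * tens_list r s.1 t.1 z lam s.2 t.2.
Proof.
elim: r s t => [|i r IH] s t sr cr.
  by rewrite !big_nil mul1r /opid; case: s t => [? ?] [? ?].
have tr : transitive (fun i j : 'I_n => (i < j)%N) by move=> a b c; exact: ltn_trans.
have /allP ir : all (fun j : 'I_n => (i < j)%N) r by exact: order_path_min sr.
have sr' : sorted (fun i j : 'I_n => (i < j)%N) r by exact: path_sorted sr.
have mem j : (j \in r) = (i < j)%N.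
  apply/idP/idP => [/ir//|ij]; have := cr i j (mem_head _ _) (ltnW ij).
  by rewrite inE; case/predU1P => // ji; rewrite ji ltnn in ij.
have ur : uniq r by apply: (sorted_uniq tr) sr' => a; rewrite ltnn.
have cr' (a b : 'I_n) : a \in r -> (a <= b)%N -> b \in r.
  by rewrite !mem => ia ab; exact: leq_trans ia ab.
rewrite !big_cons /opcomp /= /tensor2.
rewrite sum_pair mulr_sumr.
apply: eq_bigr => q _; rewrite mulr_sumr; apply: eq_bigr => j _.
rewrite L0E (IH (q, j) t sr' cr') /=.
have -> : \sum_(j0 < n | (i < j0)%N) hat_wt (j j0) = wts wl r j.
  by rewrite /wts (big_uniq _ ur) /=; apply: eq_bigl => j0; rewrite mem.
by rewrite -/(shifted e (wts wl r) lam j) -!mulrA; congr (_ * _); rewrite mulrCA.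
Qed.

Lemma kappaE z : kappa tau eta zs Lam z = \prod_i (th (z - top_pt i))^-1.
Proof. by apply: eq_bigr => i _; congr (theta tau _)^-1; rewrite /top_pt; ring. Qed.

Lemma tensor_entE (z lam : C) (s t : bool * I) : ent (tensor eta evals) z lam s t =
  kappa tau eta zs Lam z * tens s.1 t.1 z lam s.2 t.2.
Proof.
have sE : sorted (fun i j : 'I_n => (i < j)%N) (enum 'I_n).
  by have := iota_ltn_sorted 0 n; rewrite -val_enum_ord sorted_map.
have cE (i j : 'I_n) : i \in enum 'I_n -> (i <= j)%N -> j \in enum 'I_n by rewrite !mem_enum.
have iE : enum 'I_n = index_enum 'I_n by rewrite enumT [index_enum _]unlock.
by have := big_L0 z lam s t sE cE; rewrite kappaE iE /tens iE => E; exact: E.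
Qed.

Lemma tensor_wtE (k : I) : wt (tensor eta evals) k = (tens_wt k)%:~R.
Proof.
rewrite /tens_wt /wts big_enum rmorph_sum /=; by apply: eq_bigr => i _; rewrite hat_wtE.
Qed.

Lemma tens_wt_vacuum : (tens_wt (vacuum Lam))%:~R = \sum_i (Lam i)%:R :> C.
Proof.
rewrite -tensor_wtE /=; apply: eq_bigr => i _; by rewrite ffunE mulr0 subr0.
Qed.

Lemma wtIE (p : I) : (wtI tens_wt p)%:~R = \sum_i ((Lam i)%:R - 2 * (p i)%:R) :> C.
Proof.
rewrite /wtI intrB tens_wt_vacuum -pmulrn natrD /size_of natr_sum sumrB; congr (_ - _).
by rewrite -mulr_sumr; ring.
Qed.

End TensorProduct.
End ThetaQuotients.

(** * The module of functions on S_0 *)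

Section ThetaModule.
Context {R : realType}.
#[local] Arguments GRing.mul : simpl never.
#[local] Arguments GRing.add : simpl never.
#[local] Arguments GRing.opp : simpl never.
#[local] Arguments GRing.inv : simpl never.
#[local] Arguments GRing.natmul : simpl never.
Local Notation C := (Cplx R).
Variable tau : C.
Hypothesis tau0 : 0 < complex.Im tau.
Local Notation th := (theta tau).
Section GenericParameters.
Variables (n : nat) (eta : C) (zs : 'rV[C]_n) (Lam : 'I_n -> nat).
Local Notation I := (S0_index Lam).
Local Notation e := (2 * eta).
Local Notation Y := (top_pt eta zs Lam).
Local Notation T := (@tens R tau n eta zs Lam).
Local Notation wT := (@tens_wt n Lam).
Local Notation Wk := (W th e Y wT).
Local Notation M := (Mx th e Y T).
Hypothesis gen_e : forall k : int, k != 0 -> th (e * k%:~R) != 0.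
Hypothesis gen_z : forall (i j : 'I_n) (k : int), i != j ->
  th (zs 0 i - zs 0 j + eta * k%:~R) != 0.

Lemma gen_top (i j : 'I_n) (k : int) : i != j -> th (Y i - Y j + e * k%:~R) != 0.
Proof.
have -> : Y i - Y j + e * k%:~R =
    zs 0 i - zs 0 j + eta * ((Lam i)%:Z - (Lam j)%:Z + (k + k))%:~R.
  by rewrite /top_pt !intrD intrN -!pmulrn; ring.
exact: gen_z.
Qed.

Lemma th_odd z : th (- z) = - th z. Proof. exact: (thN tau0). Qed.
Lemma th_0 : th 0 = 0. Proof. exact: (theta0 tau0). Qed.

Lemma fayP a b c d : fay_sum th a b c d = 0.
Proof. exact: (theta_fay tau0). Qed.

Let cX (i : 'I_n) : conserves (@hat_wt (Lam i)) (hat_eval th e (Y i)).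
Proof. exact: conserves_hat_eval. Qed.

Lemma tens_conserves : conserves wT T.
Proof. by apply: conserves_tensors cX _ _; exact: enum_uniq. Qed.

Lemma tens_RLL : RLL th e wT T.
Proof.
apply: RLL_tensors cX _ _ _; last exact: enum_uniq.
move=> i; exact: (RLL_hat_eval th_odd fayP th_0).
Qed.

Lemma tens_qdet : qdet th e wT (delta th e Lam Y) T.
Proof.
have -> : delta th e Lam Y =
    (fun w => \prod_(i <- enum 'I_n) (th (w - Y i) * th (w - Y i + e * (Lam i).+1%:R))).
  by apply/funext => w; rewrite big_enum.
apply: qdet_tensors cX _ _ _; last exact: enum_uniq.
move=> i; exact: (qdet_hat_eval th_odd fayP th_0).
Qed.

Lemma tens_vac z l (k : I) : dom th e l ->
  T true true z l k (vacuum Lam) = (k == vacuum Lam)%:R * \prod_i th (z - Y i).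
Proof. by move=> dl; rewrite /tens /tens_list tensors_vac //= big_enum. Qed.

(** Division by theta(z - c), whose germs are nonzero. *)
Lemma entire_eq0 (f : C -> C) c : entire f -> (forall z, th (z - c) != 0 -> f z = 0) ->
  forall z, f z = 0.
Proof.
move=> ef f0 z; apply/eqP; apply: contraT => fz.
have [w fw tw] := nonzero_germP ((good_theta1 tau0 (- c)).2 z) (entire_neq0_open ef fz).
by rewrite f0 ?eqxx // in fw.
Qed.

Lemma tens_entire v u l (k k' : I) : dom th e l -> entire (fun z => T v u z l k k').
Proof. by move=> _; exact: (entire_tensors tau0). Qed.

Lemma M_W v u z l (k p : I) : regular_at th e Lam Y z -> regular_at th e Lam Y (z + e) ->
  dom th e l -> kcomp (M l) (Wk v u z l) k p = kcomp (T v u z l) (M (dyn_shift e u l)) k p.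
Proof.
exact: (Mx_W th_odd th_0 gen_e gen_top tens_conserves tens_RLL tens_qdet tens_vac
  (reg := entire) (@entire_cst _ _) (@entireM _ _) (@entireD _ _)
  (fun c => entire_theta1 tau0 (- c)) tens_entire entire_eq0).
Qed.

Lemma W_RLL z w l s t (q p : I) : regular_at th e Lam Y z -> regular_at th e Lam Y (z + e) ->
  regular_at th e Lam Y w -> regular_at th e Lam Y (w + e) -> dom th e l ->
  \sum_r Rhat th e (z - w) (l - e * (wtI wT q)%:~R) s r * comp2 e Wk r t z w l q p =
  \sum_r comp2 e Wk (swap s) (swap r) w z l q p * Rhat th e (z - w) l r t.
Proof.
exact: (RLL_W th_odd th_0 gen_e gen_top tens_conserves tens_RLL tens_qdet tens_vac
  (reg := entire) (@entire_cst _ _) (@entireM _ _) (@entireD _ _)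
  (fun c => entire_theta1 tau0 (- c)) tens_entire entire_eq0).
Qed.

Lemma M_unit l : dom th e l -> vecs_mx th e Y T l \in unitmx.
Proof.
exact: (vecs_mx_unit th_odd th_0 gen_e gen_top tens_RLL tens_qdet tens_vac
  (reg := entire) (@entire_cst _ _) (@entireM _ _) (@entireD _ _)
  (fun c => entire_theta1 tau0 (- c)) tens_entire entire_eq0).
Qed.

Definition S0_module : Ldata I := {|
  wt := fun p => (wtI wT p)%:~R;
  ent := fun z lam s t => kappa tau eta zs Lam z * Wk s.1 t.1 z lam s.2 t.2 |}.

Lemma spin_spinz v : spin v = (spinz v)%:~R :> C.
Proof. by case: v. Qed.

Lemma spin_dyn v l : l - e * spin v = dyn_shift e v l.
Proof. by rewrite dynE spin_spinz. Qed.

Lemma sum_delta (K : finType) (y : K) (f : K -> C) : \sum_x (x == y)%:R * f x = f y.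
Proof. by rewrite (bigD1 y) //= eqxx mul1r big1 ?addr0 // => x /negbTE ->; rewrite mul0r. Qed.

Lemma RLL_lhsE z w lam (s t : bool * bool * I) :
  opcomp (opcomp (R12_h3 tau eta S0_module (z - w) lam) (L13 S0_module z lam))
    (L23_h1 eta S0_module w lam) s t =
  kappa tau eta zs Lam z * kappa tau eta zs Lam w *
  \sum_r Rmx tau eta (z - w) (lam - e * (wtI wT s.2)%:~R) s.1 r * comp2 e Wk r t.1 z w lam s.2 t.2.
Proof.
case: s t => [[s1 s2] k] [[t1 t2] m]; rewrite /opcomp.
pose Rl r := Rmx tau eta (z - w) (lam - e * (wtI wT k)%:~R) (s1, s2) r.
pose A r1 b1 j := kappa tau eta zs Lam z * Wk r1 b1 z lam k j.
pose B b1 r2 j := kappa tau eta zs Lam w * Wk r2 t2 w (lam - e * spin b1) j m.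
transitivity (\sum_j \sum_r2 \sum_b1 (b1 == t1)%:R * ((\sum_r1 Rl (r1, r2) * A r1 b1 j) * B t1 r2 j)).
  rewrite sum_pair exchange_big; apply: eq_bigr => j _.
  rewrite sum_pair exchange_big; apply: eq_bigr => r2 _; apply: eq_bigr => b1 _.
  rewrite [X in X * _](_ : _ = \sum_r1 Rl (r1, r2) * A r1 b1 j).
    by rewrite /L23_h1 /= /B mulrCA.
  rewrite sum_pair exchange_big (bigD1 k) //= [X in _ + X]big1 ?addr0 => [|i ik]; last first.
    by apply: big1 => r _; rewrite /R12_h3 /= eq_sym (negbTE ik) !mul0r.
  rewrite sum_pair; apply: eq_bigr => r1 _.
  rewrite (bigD1 r2) //= big1 ?addr0 => [|r rr]; last first.
    by rewrite /L13 /= (negbTE rr) mul0r mulr0.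
  by rewrite /R12_h3 /L13 /= !eqxx !mul1r.
transitivity (\sum_j \sum_r2 (\sum_r1 Rl (r1, r2) * A r1 t1 j) * B t1 r2 j).
  by apply: eq_bigr => j _; apply: eq_bigr => r2 _; rewrite sum_delta.
rewrite [LHS]exchange_big sum_pair [X in _ = _ * X]exchange_big mulr_sumr.
apply: eq_bigr => r2 _.
under eq_bigr do rewrite mulr_suml.
rewrite exchange_big mulr_sumr; apply: eq_bigr => r1 _.
rewrite /comp2 /kcomp mulr_sumr mulr_sumr; apply: eq_bigr => j _.
by rewrite /A /B /Rl spin_dyn /=; ring.
Qed.

Lemma RLL_rhsE z w lam (s t : bool * bool * I) :
  opcomp (opcomp (L23 S0_module w lam) (L13_h2 eta S0_module z lam))
    (R12 tau eta (z - w) lam) s t =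
  kappa tau eta zs Lam z * kappa tau eta zs Lam w *
  \sum_r comp2 e Wk (swap s.1) (swap r) w z lam s.2 t.2 * Rmx tau eta (z - w) lam r t.1.
Proof.
case: s t => [[s1 s2] k] [[t1 t2] m]; rewrite /opcomp.
pose A r2 j := kappa tau eta zs Lam w * Wk s2 r2 w lam k j.
pose B r1 r2 j := kappa tau eta zs Lam z * Wk s1 r1 z (lam - e * spin r2) j m.
rewrite sum_pair exchange_big (bigD1 m) //= [X in _ + X]big1 ?addr0 => [|i im]; last first.
  by apply: big1 => r _; rewrite /R12 /= (negbTE im) mul0r mulr0.
rewrite mulr_sumr; apply: eq_bigr => -[r1 r2] _.
rewrite /R12 /= eqxx mul1r [RHS]mulrA; congr (_ * _).
transitivity (\sum_j A r2 j * B r1 r2 j).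
  rewrite sum_pair exchange_big; apply: eq_bigr => j _.
  rewrite (bigD1 (s1, r2)) //= big1 ?addr0 => [|[a1 a2] a12]; last first.
    rewrite /L23 /L13_h2 /=; move: a12; rewrite xpair_eqE negb_and eq_sym.
    by case/orP => /negbTE ->; rewrite ?mul0r ?mulr0.
  by rewrite /L23 /L13_h2 /= !eqxx !mul1r.
rewrite /comp2 /kcomp mulr_sumr; apply: eq_bigr => j _.
by rewrite /A /B spin_dyn /=; ring.
Qed.

Lemma Rmx_Rhat x l s r : th (x - e) != 0 -> Rmx tau eta x l s r = (th (x - e))^-1 * Rhat th e x l s r.
Proof.
move=> x0; rewrite /Rmx /ktens /Emx /alpha /beta.
case: s r => [[] []] [[] []] /=; rewrite ?(mul0r, mulr0, mul1r, mulr1, addr0, add0r) ?mulVf //.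
- by rewrite invfM; ring.
- by rewrite invfM; ring.
- have -> : - l + x = x - l by ring.
  by rewrite th_odd invfM invrN; ring.
- have -> : - l + e = - (l - e) by ring.
  by rewrite !th_odd invfM invrN; ring.
Qed.

(** Multiplying numerator and denominator by h0 makes the values of f on the
    zeros of h0 irrelevant. *)
Lemma quot_ae (V : normedModType C) (f f' h0 : V -> C) : quot f' -> good h0 ->
  (forall q, h0 q != 0 -> f q = f' q) -> quot f.
Proof.
move=> [g [h [eg gh E]]] g0 ff; exists (fun q => g q * h0 q), (fun q => h q * h0 q); split.
- by apply: entireM => //; case: g0.
- exact: goodM.
- move=> q; rewrite mulf_eq0 negb_or => /andP[hq h0q].
  by rewrite ff // E // -mulf_div divff // mulr1.
Qed.

Lemma entire_fst (V1 V2 : normedModType C) (f : V1 -> C) : entire f -> entire (fun p : V1 * V2 => f p.1).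
Proof.
move=> ef p; apply: (@differentiable_comp _ _ _ _ fst f); last exact: ef.
by apply: (linear_differentiable (f := fst)) => q; exact: cvg_fst.
Qed.

Lemma entire_snd (V1 V2 : normedModType C) (f : V2 -> C) : entire f -> entire (fun p : V1 * V2 => f p.2).
Proof.
move=> ef p; apply: (@differentiable_comp _ _ _ _ snd f); last exact: ef.
by apply: (linear_differentiable (f := snd)) => q; exact: cvg_snd.
Qed.

Lemma entire_id : entire (id : C -> C).
Proof. by case: (slanted_id (R := R)). Qed.

Lemma coordinates_zl : coordinates (fun p : C * C * C => p.1.1) (fun p => p.2).
Proof.
split; [exact: entire_fst (entire_fst entire_id)|exact: entire_snd entire_id|].
exists (1, 0, 0), (0, 0, 1) => p t.
by split; rewrite /= ?[t *: 1]mulr1 ?scaler0 ?addr0.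
Qed.

Lemma coordinates_wl : coordinates (fun p : C * C * C => p.1.2) (fun p => p.2).
Proof.
split; [exact: (entire_fst (entire_snd entire_id))|exact: entire_snd entire_id|].
exists (0, 1, 0), (0, 0, 1) => p t.
by split; rewrite /= ?[t *: 1]mulr1 ?scaler0 ?addr0.
Qed.

Lemma coordinates_zwl : coordinates (fun p : C * C * C => p.1.1 - p.1.2) (fun p => p.2).
Proof.
split; [|exact: entire_snd entire_id|].
  apply: entireD; first exact: (entire_fst (entire_fst entire_id)).
  by apply: entireN; exact: (entire_fst (entire_snd entire_id)).
exists (1, 0, 0), (0, 0, 1) => p t.
by split; rewrite /= ?[t *: 1]mulr1 ?scaler0 ?addr0 // addrAC.
Qed.

(** A single function of z off whose zeros all the eigenvalues of a(z) are
    nonzero. *)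
Definition all_regular (z : C) := \prod_(p : I) acoef th e Y (fun i => p i) z.

Lemma all_regularP z : all_regular z != 0 -> regular_at th e Lam Y z.
Proof. by move=> /prodf_neq0 h p i; have /prodf_neq0 := h p isT; apply. Qed.

Section Regular.
Context {V : normedModType C}.
Variables Z L : V -> C.
Hypothesis ZL : coordinates Z L.

Lemma good_all_regular : good (fun p => all_regular (Z p)).
Proof. by apply: good_prod => p _; exact: (good_acoef tau0 e Y _ ZL). Qed.

Lemma quot_kappa : quot (fun p => kappa tau eta zs Lam (Z p)).
Proof.
apply: quot_prod => i _; apply: (quot_thV tau0 ZL (neq0Z 0)) => p q; ring.
Qed.
End Regular.

Lemma quot_comp2_W r t (q p : I) (V : normedModType C) (Z Wc L : V -> C) :
  coordinates Z L -> coordinates Wc L ->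
  quot (fun x => comp2 e Wk r t (Z x) (Wc x) (L x) q p).
Proof.
move=> ZL WL; apply: quot_sum => j _; apply: quotM; first exact: (quot_W tau0).
have := quot_W tau0 e Y wT r.2 t.2 j p (coordinatesL (- e * (spinz t.1)%:~R) WL).
by congr quot; apply/funext => x; rewrite dynE mulNr.
Qed.

(** The RLL relation holds where z, w, z + e, w + e avoid the zeros of the
    eigenvalues and lambda lies in a dense set; slanted_sub extends it to an
    equality of meromorphic functions. *)
Lemma S0_module_is_module : is_module tau eta S0_module.
Proof.
split.
- move=> s t; apply: quot_meromorphic; apply: quotM; first exact: quot_kappa (@coordinates_pair R).
  exact: (quot_W tau0 e Y wT s.1 t.1 s.2 t.2 (@coordinates_pair R)).
- move=> s t; apply: (good_off_hypersurface (good_cst (oner_neq0 C))) => p _ /=.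
  have [->|/conserves_W h] := eqVneq (Wk s.1 t.1 p.1 p.2 s.2 t.2) 0; first by rewrite !(mulr0, mul0r).
  by rewrite mulrC !spin_spinz -!intrD h.
move=> s t.
pose h0 (p : C * C * C) := all_regular p.1.1 * all_regular (p.1.1 + e) *
   (all_regular p.1.2 * all_regular (p.1.2 + e)) * th (p.1.1 - p.1.2 - e).
have gx : good (fun p : C * C * C => th (p.1.1 - p.1.2 - e)).
  by apply: (good_theta tau0 coordinates_zwl (neq0Z 0)) => p q; ring.
have g0 : good h0.
  apply: goodM gx; apply: goodM; apply: goodM.
  - exact: good_all_regular coordinates_zl.
  - exact: good_all_regular (coordinatesZ e coordinates_zl).
  - exact: good_all_regular coordinates_wl.
  - exact: good_all_regular (coordinatesZ e coordinates_wl).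
pose kk (p : C * C * C) := kappa tau eta zs Lam p.1.1 * kappa tau eta zs Lam p.1.2.
have qk : quot kk by apply: quotM; [exact: quot_kappa coordinates_zl|exact: quot_kappa coordinates_wl].
have qc r t' q p : quot (fun x : C * C * C => comp2 e Wk r t' x.1.1 x.1.2 x.2 q p).
  exact: (quot_comp2_W r t' q p coordinates_zl coordinates_wl).
have qc' r t' q p : quot (fun x : C * C * C => comp2 e Wk r t' x.1.2 x.1.1 x.2 q p).
  exact: (quot_comp2_W r t' q p coordinates_wl coordinates_zl).
pose xV (p : C * C * C) := (th (p.1.1 - p.1.2 - e))^-1.
pose f1 (p : C * C * C) := kk p * \sum_r (xV p * Rhat th e (p.1.1 - p.1.2)
   (p.2 - e * (wtI wT s.2)%:~R) s.1 r) * comp2 e Wk r t.1 p.1.1 p.1.2 p.2 s.2 t.2.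
pose f2 (p : C * C * C) := kk p * \sum_r comp2 e Wk (swap s.1) (swap r) p.1.2 p.1.1 p.2 s.2 t.2 *
   (xV p * Rhat th e (p.1.1 - p.1.2) p.2 r t.1).
have qx : quot xV by exact: quotV gx.
have qf1 : quot f1.
  apply: quotM qk _; apply: quot_sum => r _; apply: quotM; last exact: qc.
  apply: quotM qx _.
  exact: (quot_Rhat tau0 e s.1 r (coordinatesL (- (e * (wtI wT s.2)%:~R)) coordinates_zwl)).
have qf2 : quot f2.
  apply: quotM qk _; apply: quot_sum => r _; apply: quotM; first exact: qc'.
  by apply: quotM qx _; exact: (quot_Rhat tau0 e r t.1 coordinates_zwl).
have E1 (p : C * C * C) : h0 p != 0 -> (let: (z, w, lam) := p in
    opcomp (opcomp (R12_h3 tau eta S0_module (z - w) lam) (L13 S0_module z lam))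
      (L23_h1 eta S0_module w lam) s t) = f1 p.
  case: p => [[z w] lam]; rewrite /h0 /= mulf_eq0 negb_or => /andP[_ x0].
  rewrite RLL_lhsE /f1 /kk; congr (_ * _); apply: eq_bigr => r _; congr (_ * _).
  by rewrite Rmx_Rhat.
have E2 (p : C * C * C) : h0 p != 0 -> (let: (z, w, lam) := p in
    opcomp (opcomp (L23 S0_module w lam) (L13_h2 eta S0_module z lam)) (R12 tau eta (z - w) lam) s t) = f2 p.
  case: p => [[z w] lam]; rewrite /h0 /= mulf_eq0 negb_or => /andP[_ x0].
  rewrite RLL_rhsE /f2 /kk; congr (_ * _); apply: eq_bigr => r _; congr (_ * _).
  by rewrite Rmx_Rhat.
have sl : slanted (fun p : C * C * C => p.2).
  by apply: (slanted_comb coordinates_zl (neq0L 0)) => p q; ring.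
apply: (slanted_sub sl (dense_dom tau0 e) (quot_ae qf1 g0 E1) (quot_ae qf2 g0 E2) g0).
move=> p p0 dl; rewrite E1 // E2 // /f1 /f2; congr (_ * _).
move: p0; rewrite /h0 !mulf_eq0 !negb_or -!andbA => /and5P[z0 ze0 w0 we0 _].
have := W_RLL s.1 t.1 s.2 t.2 (all_regularP z0) (all_regularP ze0) (all_regularP w0)
  (all_regularP we0) dl => E.
transitivity (xV p * \sum_r Rhat th e (p.1.1 - p.1.2) (p.2 - e * (wtI wT s.2)%:~R) s.1 r *
   comp2 e Wk r t.1 p.1.1 p.1.2 p.2 s.2 t.2).
  by rewrite mulr_sumr; apply: eq_bigr => r _; rewrite mulrA.
by rewrite E mulr_sumr; apply: eq_bigr => r _; rewrite mulrCA.
Qed.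

(** * Restriction of the difference operators *)

Local Notation nv p := (fun i => nat_of_ord (p i)).
Local Notation S0 := (S0_point eta zs Lam).
Local Notation yp p := (ypt e Y (nv p)).
Implicit Types (F : C -> 'rV[C]_n -> C) (p q : I).

Lemma fun_eq_pt (J : finType) (f g : C -> J -> C) : (forall lam k, f lam k = g lam k) -> fun_eq f g.
Proof.
by move=> fg k; apply: (good_off_hypersurface (good_cst (oner_neq0 C))) => lam _; exact: fg.
Qed.

Lemma S0E p i : S0 p 0 i = - yp p i.
Proof. by rewrite mxE /ypt /top_pt; ring. Qed.

Lemma sxzE p : sxz zs (S0 p) = - (eta * (wtI wT p)%:~R).
Proof.
rewrite (wtIE tau eta zs p) /sxz -mulrN -sumrN mulr_sumr; apply: eq_bigr => i _; by rewrite mxE; ring.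
Qed.

Lemma size_ofE p : e * (size_of (nv p))%:R = \sum_i (S0 p 0 i + zs 0 i + (Lam i)%:R * eta).
Proof.
by rewrite /size_of natr_sum mulr_sumr; apply: eq_bigr => i _; rewrite mxE; ring.
Qed.

Lemma dop_hE F lam p : eta != 0 ->
  dop_h eta zs F lam (S0 p) = (wtI wT p)%:~R * F lam (S0 p).
Proof. by move=> eta0; rewrite /dop_h sxzE; field. Qed.

Lemma coef_aE z lam p : coef_a tau eta zs Lam z lam (S0 p) =
  acoef th e Y (nv p) z * th (lam + e * (size_of (nv p))%:R) / th lam.
Proof.
rewrite /coef_a -size_ofE mulrA; congr (_ * _ / _).
by apply: eq_bigr => i _; rewrite S0E.
Qed.

Lemma Delta_plusE y : Delta_plus tau eta zs Lam y = Delta_p th Y y.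
Proof. by apply: eq_bigr => i _; congr (theta tau _); rewrite /top_pt; ring. Qed.

Lemma Delta_minusE y : Delta_minus tau eta zs Lam y = Delta_m th e Lam Y y.
Proof. by apply: eq_bigr => i _; congr (theta tau _); rewrite /top_pt; ring. Qed.

Lemma S0_up p q j : is_up p q j -> shift_x j (- e) (S0 q) = S0 p.
Proof.
move=> /forallP pq; apply/rowP => i; rewrite !mxE (eqP (pq i)) /up /= natrD [(i == j)%:R]/(_%:R).
by case: (i == j); rewrite ?mulr0n ?mulr1n; ring.
Qed.

Lemma S0_down p q j : is_up q p j -> shift_x j e (S0 q) = S0 p.
Proof.
move=> /S0_up <-; rewrite /shift_x scaleNr -addrA addNr addr0 //.
Qed.

Lemma dop_aE z F lam q : dop_a tau eta zs Lam z F lam (S0 q) =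
  \sum_p Wa th e Y z lam q p * F (lam - e) (S0 p).
Proof.
rewrite /dop_a coef_aE (bigD1 q) //= /Wa eqxx mul1r big1 ?addr0 // => p pq.
by rewrite eq_sym (negbTE pq) !mul0r.
Qed.

Lemma sum_neighbour (P : I -> bool) (c : C) (f : I -> C) (x : C) :
  (forall p p', P p -> P p' -> p = p') -> (forall p, P p -> f p = x) ->
  ((forall p, ~~ P p) -> c = 0) -> \sum_p (P p)%:R * c * f p = c * x.
Proof.
move=> uP fP cP; have [p Pp|noP] := pickP P; last first.
  by rewrite cP ?mul0r ?big1 // => p; rewrite noP ?mul0r.
rewrite (bigD1 p) //= Pp mul1r fP // big1 ?addr0 // => p' pp'.
by case Pp' : (P p'); rewrite ?mul0r //; rewrite (uP _ _ Pp' Pp) eqxx in pp'.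
Qed.

(** If q_j = 0, the shift of x_j leads out of S_0; then y_j = Y_j, and the
    coefficient vanishes because of its factor Delta_plus. *)
Lemma dop_bE z F lam q : dop_b tau eta zs Lam z F lam (S0 q) =
  \sum_p Wb th e Y z lam q p * F (lam + e) (S0 p).
Proof.
rewrite /dop_b /Wb -sumrN; under [RHS]eq_bigr do rewrite mulr_suml.
rewrite [RHS]exchange_big; apply: eq_bigr => j _; rewrite -mulNr.
rewrite Delta_plusE S0E opprK -addrA.
have -> : \prod_(i | i != j) (th (z + S0 q 0 i) / th (- yp q j - S0 q 0 i)) =
    \prod_(i | i != j) (th (z - yp q i) / th (yp q i - yp q j)).
  by apply: eq_bigr => i _; rewrite S0E opprK [- _ + _]addrC.
rewrite addrA [RHS](sum_neighbour (x := F (lam + e) (shift_x j (- e) (S0 q)))) //.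
- by move=> p p'; exact: is_down_uniq.
- by move=> p /S0_up ->.
- move=> no; have qj : q j = 0%N :> nat.
    by apply/eqP; rewrite -leqn0 leqNgt; apply/negP => /down_exists[p pq]; have := no p; rewrite pq.
  have -> : Delta_p th Y (yp q j) = 0.
    by rewrite /Delta_p (bigD1 j) //= /ypt qj mulr0 subr0 subrr th_0 mul0r.
  by rewrite mulr0 oppr0.
Qed.

(** If q_j = Lambda_j, the shift of x_j leads out of S_0; then the factor
    Delta_minus of the coefficient vanishes. *)
Lemma dop_cE z F lam q : dop_c tau eta zs Lam z F lam (S0 q) =
  \sum_p Wc th e Y wT z lam q p * F (lam - e) (S0 p).
Proof.
rewrite /dop_c /Wc -sumrN; under [RHS]eq_bigr do rewrite mulr_suml.
rewrite [RHS]exchange_big; apply: eq_bigr => j _; rewrite -mulNr.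
rewrite Delta_minusE S0E opprK sxzE.
have -> : - lam + z - yp q j - 2 * - (eta * (wtI wT q)%:~R) =
    - lam + z - yp q j + e * (wtI wT q)%:~R by ring.
have -> : \prod_(i | i != j) (th (z + S0 q 0 i) / th (- yp q j - S0 q 0 i)) =
    \prod_(i | i != j) (th (z - yp q i) / th (yp q i - yp q j)).
  by apply: eq_bigr => i _; rewrite S0E opprK [- _ + _]addrC.
rewrite [RHS](sum_neighbour (x := F (lam - e) (shift_x j e (S0 q)))) //.
- by move=> p p'; exact: is_up_uniq.
- by move=> p /S0_down ->.
- move=> no; have qj : q j = Lam j :> nat.
    apply/eqP; rewrite eqn_leq -ltnS ltn_ord /= leqNgt; apply/negP => /up_exists[p pq].
    by have := no p; rewrite pq.
  have -> : Delta_m th e Lam Y (yp q j) = 0.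
    rewrite /Delta_m (bigD1 j) //= /ypt qj.
    have -> : Y j - e * (Lam j)%:R - Y j + e * (Lam j)%:R = 0 by ring.
    by rewrite th_0 mul0r.
  by rewrite mulr0 oppr0.
Qed.

Lemma dop_detE z F lam q : dop_det tau eta zs Lam z F lam (S0 q) =
  det_elt th e Y wT z lam q * F lam (S0 q).
Proof.
rewrite /dop_det /det_elt sxzE; congr (_ * _ * _); first by congr (theta tau _ / _); ring.
apply: eq_bigr => i _; rewrite -natr1.
by congr (theta tau _ * theta tau _); rewrite /top_pt; ring.
Qed.

Lemma opL_S0 v u z f lam q : opL eta S0_module v u z f lam q =
  kappa tau eta zs Lam z * \sum_p Wk v u z lam q p * f (dyn_shift e u lam) p.
Proof.
rewrite /opL mulr_sumr; apply: eq_bigr => p _; by rewrite spin_dyn mulrA.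
Qed.

Lemma S0_module_op_h F : eta != 0 ->
  fun_eq (op_h S0_module (res_S0 eta zs Lam F)) (res_S0 eta zs Lam (dop_h eta zs F)).
Proof. by move=> eta0; apply: fun_eq_pt => lam p; rewrite /res_S0 dop_hE. Qed.

Lemma S0_module_op_a :
  induced_on_S0 tau eta zs (dop_a tau eta zs Lam) (op_a eta S0_module).
Proof.
apply: off_hypersurfaceT => z F _; apply: fun_eq_pt => lam q.
by rewrite /op_a opL_S0 /res_S0 dop_aE.
Qed.

Lemma S0_module_op_b :
  induced_on_S0 tau eta zs (dop_b tau eta zs Lam) (op_b eta S0_module).
Proof.
apply: off_hypersurfaceT => z F _; apply: fun_eq_pt => lam q.
by rewrite /op_b opL_S0 /res_S0 dop_bE.
Qed.

Lemma S0_module_op_c :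
  induced_on_S0 tau eta zs (dop_c tau eta zs Lam) (op_c eta S0_module).
Proof.
apply: off_hypersurfaceT => z F _; apply: fun_eq_pt => lam q.
by rewrite /op_c opL_S0 /res_S0 dop_cE.
Qed.

Lemma good_all_regular1 (c : C) : good (fun z => all_regular (z + c)).
Proof.
apply: good_prod => p _; apply: good_prod => i _.
by have := good_theta1 tau0 (c - yp p i); congr good; apply/funext => z; congr (theta tau _); ring.
Qed.

(** The equation that defines d(z), taken at lambda + e, can be solved since
    a(z + e) acts by a nonzero coefficient. *)
Lemma S0_module_op_d dop_d : defines_d tau eta zs Lam dop_d ->
  induced_on_S0 tau eta zs (Lam := Lam) dop_d (op_d eta S0_module).
Proof.
move=> dd.
apply: (good_off_hypersurface (good_all_regular1 e)) => z /all_regularP rz F _ q.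
have gl : good (fun lam => th (lam + (e + e * (size_of (nv q))%:R)) * th (lam + e)).
  by apply: goodM; exact: (good_theta1 tau0).
apply: (good_off_hypersurface gl) => lam; rewrite mulf_eq0 negb_or addrA => /andP[l1 l2].
have cn : coef_a tau eta zs Lam (z + e) (lam + e) (S0 q) != 0.
  rewrite coef_aE !mulf_neq0 ?invr_neq0 //.
  by apply/prodf_neq0 => i _; exact: rz.
have := dd z F (lam + e) (S0 q) cn.
rewrite {1}/dop_a addrK => /(canRL (subrK _)) E.
rewrite /op_d opL_S0 /res_S0; congr (_ * _).
apply: (mulfI cn); rewrite E dop_detE dop_cE mulr_sumr.
under [X in _ = _ + X]eq_bigr => p _ do rewrite addrK dop_bE mulr_sumr.
transitivity (\sum_p (det_elt th e Y wT z (lam + e) q * (q == p)%:R +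
    kcomp (Wc th e Y wT (z + e) (lam + e)) (Wb th e Y z lam) q p) * F (lam + e) (S0 p)).
  apply: eq_bigr => p _; rewrite coef_aE mulrA; congr (_ * _).
  by rewrite mulrC /= /Wd divfK // -coef_aE.
under [LHS]eq_bigr do rewrite mulrDl.
rewrite big_split; congr (_ + _).
  rewrite (bigD1 q) //= eqxx mulr1 big1 ?addr0 // => p.
  by rewrite eq_sym => /negbTE ->; rewrite mulr0 mul0r.
rewrite exchange_big; apply: eq_bigr => p _; rewrite /kcomp mulr_suml.
by apply: eq_bigr => r _; rewrite mulrA.
Qed.

(** * The isomorphism *)

Local Notation wevals := (fun i : 'I_n => eval_module tau eta (Lam i) (zs 0 i - eta)).
Local Notation V := (vecs_mx th e Y T).

(** The inverse of the matrix M by Cramer's rule, which shows that its entries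
    are quotients. *)
Definition Minv lam p k := (gauge th e Y (nv p) lam)^-1 *
  ((\det (V lam))^-1 * (\adj (V lam)) (enum_rank k) (enum_rank p)).

Lemma vecs_mxE lam p k : V lam (enum_rank p) (enum_rank k) = vecs th e Y T p lam k.
Proof. by rewrite mxE !enum_rankK. Qed.

Lemma sum_rank (f : 'I_#|I| -> C) : \sum_(p : I) f (enum_rank p) = \sum_i f i.
Proof. by rewrite [RHS](reindex (@enum_rank I)) //; apply: onW_bij; exact: enum_rank_bij. Qed.

Lemma det_neq0 lam : dom th e lam -> \det (V lam) != 0.
Proof. by move=> /M_unit; rewrite unitmxE unitfE. Qed.

Lemma gauge_dom_neq0 p lam : dom th e lam -> gauge th e Y (nv p) lam != 0.
Proof. by move=> dl; exact: gauge_neq0 gen_e gen_top _ _ dl. Qed.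

Lemma M_Minv lam k k' : dom th e lam -> \sum_p M lam k p * Minv lam p k' = (k == k')%:R.
Proof.
move=> dl; have d0 := det_neq0 dl.
transitivity ((\det (V lam))^-1 * (\adj (V lam) *m V lam) (enum_rank k') (enum_rank k)).
  rewrite mxE mulr_sumr -sum_rank; apply: eq_bigr => p _.
  rewrite vecs_mxE /Mx /Minv -/(vecs th e Y T p) mulrACA.
  by rewrite divff ?gauge_dom_neq0 // mul1r mulrCA; congr (_ * _); exact: mulrC.
rewrite mul_adj_mx mxE (inj_eq enum_rank_inj) eq_sym.
by case: (k == k'); rewrite ?mulr1n ?mulr0n ?mulr0 // mulVf.
Qed.

Lemma Minv_M lam p p' : dom th e lam -> \sum_k Minv lam p k * M lam k p' = (p == p')%:R.
Proof.
move=> dl; have d0 := det_neq0 dl; pose g q := gauge th e Y (nv q) lam.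
transitivity (g p' / g p * ((\det (V lam))^-1 * (V lam *m \adj (V lam)) (enum_rank p') (enum_rank p))).
  rewrite mxE !mulr_sumr -sum_rank; apply: eq_bigr => k _.
  by rewrite vecs_mxE /Mx /Minv -/(vecs th e Y T p') /g; ring.
rewrite mul_mx_adj mxE (inj_eq enum_rank_inj) eq_sym.
have [->|_] := eqVneq p p'; last by rewrite mulr0n !mulr0.
by rewrite mulr1n mulVf // mulr1 divff // gauge_dom_neq0.
Qed.

Lemma quot_Minv p k : quot (fun lam => Minv lam p k).
Proof.
have qV i j : quot (fun lam => V lam i j).
  under [X in quot X]eq_fun do rewrite mxE.
  exact: (quot_vec0 tau0).
apply: quotM.
  have [_ /=] := quot_gauge tau0 e Y (nv p) 0.
  by congr quot; apply/funext => l; rewrite addr0.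
apply: quotM; last exact: quot_adj.
apply: quot_inv; first exact: quot_det.
move=> z U zU; have [w Uw dw] := dense_dom tau0 e zU.
by exists w => //; exact: det_neq0.
Qed.

Lemma off_dom (f g : C -> C) : quot f -> quot g -> (forall lam, dom th e lam -> f lam = g lam) ->
  mero_eq f g.
Proof.
move=> qf qg fg; apply: (slanted_sub (slanted_id (R := R)) (dense_dom tau0 e) qf qg
  (good_cst (oner_neq0 C))) => lam _; exact: fg.
Qed.

Lemma off_M_Minv : off_hypersurface (fun lam => forall k k',
  \sum_p M lam k p * Minv lam p k' = (k == k')%:R).
Proof.
apply: off_hypersurface_all => k; apply: off_hypersurface_all => k'.
apply: off_dom; last by move=> lam; exact: M_Minv.
  by apply: quot_sum => p _; apply: quotM; [exact: (quot_Mx0 tau0)|exact: quot_Minv].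
exact: quot_cst.
Qed.

Lemma off_Minv_M : off_hypersurface (fun lam => forall p p',
  \sum_k Minv lam p k * M lam k p' = (p == p')%:R).
Proof.
apply: off_hypersurface_all => k; apply: off_hypersurface_all => k'.
apply: off_dom; last by move=> lam; exact: Minv_M.
  by apply: quot_sum => p _; apply: quotM; [exact: quot_Minv|exact: (quot_Mx0 tau0)].
exact: quot_cst.
Qed.

Definition to_tensor (f : C -> I -> C) : C -> I -> C := fun lam k => \sum_p M lam k p * f lam p.
Definition of_tensor (f : C -> I -> C) : C -> I -> C := fun lam p => \sum_k Minv lam p k * f lam k.

Lemma to_of lam f : (forall k k', \sum_p M lam k p * Minv lam p k' = (k == k')%:R) ->
  forall k, to_tensor (of_tensor f) lam k = f lam k.
Proof.
move=> E k; rewrite /to_tensor /of_tensor; under eq_bigr do rewrite mulr_sumr.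
rewrite exchange_big; transitivity (\sum_k' (k == k')%:R * f lam k').
  by apply: eq_bigr => k' _; rewrite -E mulr_suml; apply: eq_bigr => p _; rewrite mulrA.
rewrite (bigD1 k) //= eqxx mul1r big1 ?addr0 // => k'.
by rewrite eq_sym => /negbTE ->; rewrite mul0r.
Qed.

Lemma of_to lam f : (forall p p', \sum_k Minv lam p k * M lam k p' = (p == p')%:R) ->
  forall p, of_tensor (to_tensor f) lam p = f lam p.
Proof.
move=> E k; rewrite /to_tensor /of_tensor; under eq_bigr do rewrite mulr_sumr.
rewrite exchange_big; transitivity (\sum_k' (k == k')%:R * f lam k').
  by apply: eq_bigr => k' _; rewrite -E mulr_suml; apply: eq_bigr => p _; rewrite mulrA.
rewrite (bigD1 k) //= eqxx mul1r big1 ?addr0 // => k'.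
by rewrite eq_sym => /negbTE ->; rewrite mul0r.
Qed.

Lemma to_tensor_iso : mero_linear_iso to_tensor.
Proof.
have mero (A : C -> I -> I -> C) f : (forall k p, quot (fun lam => A lam k p)) -> fun_mero f ->
    fun_mero (fun lam k => \sum_p A lam k p * f lam p).
  move=> qA mf k; apply: meromorphic_sum => p.
  by apply: meromorphicM (mf p); exact: quot_meromorphic.
split.
- by move=> f mf; apply: mero => // k p; exact: (quot_Mx0 tau0).
- move=> f g mf mg; split => fg k.
    apply: off_hypersurface_sub (off_hypersurface_all fg) => lam E.
    by apply: eq_bigr => p _; rewrite E.
  apply: off_hypersurface_sub (off_hypersurfaceI off_Minv_M (off_hypersurface_all fg)) => lam.
  move=> [E E']; rewrite -(of_to f E) -(of_to g E).
  by apply: eq_bigr => p _; rewrite E'.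
- move=> u f g mu mf mg; apply: fun_eq_pt => lam k.
  by rewrite /to_tensor mulr_sumr -big_split; apply: eq_bigr => p _ /=; ring.
- move=> g mg; exists (of_tensor g); first by apply: mero => // p k; exact: quot_Minv.
  by move=> k; apply: off_hypersurface_sub off_M_Minv => lam E; exact: to_of.
Qed.

Lemma opL_tensor v u z f lam k : opL eta (tensor eta wevals) v u z f lam k =
  kappa tau eta zs Lam z * \sum_p T v u z lam k p * f (dyn_shift e u lam) p.
Proof.
rewrite /opL mulr_sumr; apply: eq_bigr => p _.
by rewrite tensor_entE spin_dyn mulrA.
Qed.

(** For fixed z the identity M W = T M holds for lambda in a dense set, hence
    as an equality of meromorphic functions of lambda. *)
Lemma to_tensor_opL v u z : all_regular z != 0 -> all_regular (z + e) != 0 ->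
  forall f, fun_eq (to_tensor (opL eta S0_module v u z f)) (opL eta (tensor eta wevals) v u z (to_tensor f)).
Proof.
move=> /all_regularP rz /all_regularP rz' f k.
have E : off_hypersurface (fun lam => forall p,
    kcomp (M lam) (Wk v u z lam) k p = kcomp (T v u z lam) (M (dyn_shift e u lam)) k p).
  apply: off_hypersurface_all => p; apply: off_dom; last by move=> lam; exact: M_W.
    apply: quot_sum => j _; apply: quotM; first exact: (quot_Mx0 tau0).
    exact: (quot_W_class e Y wT v u j p (@theta_class_cst R tau tau0 z)).
  apply: quot_sum => j _; apply: quotM.
    have := quot_tensors tau0 e Y (enum 'I_n) v u z k j 0.
    by congr quot; apply/funext => l; rewrite addr0.
  have := quot_Mx tau0 e Y j p (- e * (spinz u)%:~R).
  by congr quot; apply/funext => x; rewrite dynE mulNr.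
apply: off_hypersurface_sub E => lam E; rewrite opL_tensor /to_tensor.
transitivity (kappa tau eta zs Lam z *
    \sum_q kcomp (M lam) (Wk v u z lam) k q * f (dyn_shift e u lam) q).
  under eq_bigr do rewrite opL_S0 mulrCA mulr_sumr.
  rewrite -mulr_sumr exchange_big; congr (_ * _); apply: eq_bigr => q _.
  by rewrite /kcomp mulr_suml; apply: eq_bigr => j _; rewrite mulrA.
congr (_ * _); under [RHS]eq_bigr do rewrite mulr_sumr.
rewrite exchange_big; apply: eq_bigr => q _; rewrite E /kcomp mulr_suml.
by apply: eq_bigr => j _; rewrite -[LHS]mulrA.
Qed.

Lemma to_tensor_intertwines v u : intertwines to_tensor (opL eta S0_module v u)
  (opL eta (tensor eta wevals) v u).
Proof.
have g := goodM (good_all_regular1 0) (good_all_regular1 e).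
apply: (good_off_hypersurface g) => z; rewrite addr0 mulf_eq0 negb_or => /andP[z0 ze0] f _.
exact: to_tensor_opL.
Qed.

Lemma S0_module_iso : module_iso eta S0_module (tensor eta wevals).
Proof.
exists to_tensor; split; first exact: to_tensor_iso.
split; [|exact: to_tensor_intertwines..].
move=> f mf k.
have E : off_hypersurface (fun lam => forall p,
    M lam k p * (wtI wT p)%:~R = (wT k)%:~R * M lam k p).
  apply: off_hypersurface_all => p; apply: off_dom.
  - by apply: quotM (quot_cst _); exact: (quot_Mx0 tau0).
  - by apply: quotM (quot_cst _) _; exact: (quot_Mx0 tau0).
  move=> lam dl; have [->|Mk] := eqVneq (M lam k p) 0; first by rewrite mulr0 mul0r.
  rewrite (_ : wT k = wtI wT p); first exact: mulrC.
  exact: (Mx_wt tens_conserves tens_RLL (reg := entire) (@entire_cst _ _) (@entireM _ _)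
    (@entireD _ _) tens_entire entire_eq0 dl Mk).
apply: off_hypersurface_sub E => lam E; rewrite /to_tensor /op_h (tensor_wtE tau eta zs) mulr_sumr.
by apply: eq_bigr => p _; rewrite mulrA [M lam k p * _](E p) -mulrA.
Qed.
End GenericParameters.

(** * Generic parameters *)

Lemma good_hypersurface (V : normedModType C) (g : V -> C) : good g ->
  analytic_hypersurface [set q | g q = 0].
Proof.
move=> [eg ng] p; exists g; split; [|exact: ng|]; apply: nearW => q; first exact: eg.
by split.
Qed.

Section Generic.
Variable n : nat.
Local Notation P := (C * 'rV[C]_n)%type.
Implicit Types (p : P).

Lemma entire_eta : entire (fun p : P => p.1).
Proof. exact: (@entire_fst _ _ id entire_id). Qed.

Lemma entire_zs (i : 'I_n) : entire (fun p : P => p.2 0 i).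
Proof.
apply: (@entire_snd _ _ (fun v : 'rV[C]_n => v 0 i)) => v.
exact: (differentiable_coord v 0 i).
Qed.

Lemma good_eta (k : int) : k != 0 -> good (fun p : P => th (2 * p.1 * k%:~R)).
Proof.
move=> k0; apply: good_comp_slanted.
- by move=> z; exact: (theta_differentiable tau0).
- by move=> z; exact: (theta_nonzero_germ tau0).
split.
  apply: entireM; last exact: entire_cst.
  by apply: entireM; [exact: entire_cst|exact: entire_eta].
exists (1, 0), (2 * k%:~R); split; first by rewrite mulf_neq0 ?pnatr_eq0 // intr_eq0.
by move=> p t; rewrite /= [t *: 1]mulr1; ring.
Qed.

Lemma good_zs (i j : 'I_n) (k : int) : i != j ->
  good (fun p : P => th (p.2 0 i - p.2 0 j + p.1 * k%:~R)).
Proof.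
move=> ij; apply: good_comp_slanted.
- by move=> z; exact: (theta_differentiable tau0).
- by move=> z; exact: (theta_nonzero_germ tau0).
split.
  apply: entireD.
    by apply: entireD; [exact: entire_zs|apply: entireN; exact: entire_zs].
  by apply: entireM; [exact: entire_eta|exact: entire_cst].
exists (0, delta_mx 0 i), 1; split; first exact: oner_neq0.
move=> p t; rewrite /= !mxE !eqxx [j == i]eq_sym (negbTE ij) /= scaler0 addr0 mulr1 mulr0; ring.
Qed.

Lemma generic_parameters : for_generic (fun p : P =>
  (forall k : int, k != 0 -> th (2 * p.1 * k%:~R) != 0) /\
  (forall (i j : 'I_n) (k : int), i != j -> th (p.2 0 i - p.2 0 j + p.1 * k%:~R) != 0)).
Proof.
pose cond (x : int + 'I_n * 'I_n * int) (p : P) : C := match x with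
  | inl k => if k == 0 then 1 else th (2 * p.1 * k%:~R)
  | inr (i, j, k) => if i == j then 1 else th (p.2 0 i - p.2 0 j + p.1 * k%:~R) end.
have gc x : good (cond x).
  case: x => [k|[[i j] k]]; rewrite /cond.
    have [_|k0] := eqVneq k 0; [exact: good_cst (oner_neq0 _)|exact: good_eta].
  have [_|ij] := eqVneq i j; [exact: good_cst (oner_neq0 _)|exact: good_zs].
pose c (m : nat) p : C := if unpickle m is Some x then cond x p else 1.
exists (fun m => [set p | c m p = 0]); split.
  move=> m; apply: good_hypersurface; rewrite /c; case: (unpickle m) => [x|].
    exact: gc.
  exact: good_cst (oner_neq0 _).
move=> p Hp; have nz x : cond x p != 0.
  by apply/eqP => x0; apply: (Hp (pickle x)); rewrite /c /= pickleK.
split=> [k k0|i j k ij]; first by have := nz (inl k); rewrite /cond (negbTE k0).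
by have := nz (inr (i, j, k)); rewrite /cond (negbTE ij).
Qed.

End Generic.
End ThetaModule.

Theorem proposition3p3 (R : realType) (tau : Cplx R) (htau : 0 < 'Im tau)
    (n : nat) :
  for_generic (fun p : Cplx R * 'rV[Cplx R]_n =>
    let: (eta, zs) := p in
    forall (Lam : 'I_n -> nat)
      (dop_d : Cplx R -> (Cplx R -> 'rV[Cplx R]_n -> Cplx R) ->
               (Cplx R -> 'rV[Cplx R]_n -> Cplx R)),
    defines_d tau eta zs Lam dop_d ->
    exists W : Ldata (S0_index Lam),
      [/\ is_module tau eta W,
          forall F, fun_mero (res_S0 eta zs Lam F) ->
            fun_eq (op_h W (res_S0 eta zs Lam F)) (res_S0 eta zs Lam (dop_h eta zs F)),
          [/\ induced_on_S0 tau eta zs (dop_a tau eta zs Lam) (op_a eta W),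
              induced_on_S0 tau eta zs (dop_b tau eta zs Lam) (op_b eta W),
              induced_on_S0 tau eta zs (dop_c tau eta zs Lam) (op_c eta W)
            & induced_on_S0 tau eta zs dop_d (op_d eta W)]
        & module_iso eta W
            (tensor eta (fun i : 'I_n =>
               eval_module tau eta (Lam i) (zs 0 i - eta)))]).
Proof.
have tau0 := im_gt0 htau.
have [H [aH gH]] := generic_parameters tau0 n.
exists H; split=> // -[eta zs] /gH[/= ge gz] Lam dop_d dd.
have eta0 : eta != 0.
  by apply: contraNneq (ge 1 (oner_neq0 _)) => ->; rewrite mulr0 mul0r (theta0 tau0).
exists (S0_module tau eta zs Lam); split.
- exact: S0_module_is_module.
- by move=> F _; exact: S0_module_op_h.
- split; [exact: S0_module_op_a|exact: S0_module_op_b|exact: S0_module_op_c|exact: S0_module_op_d].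
- exact: S0_module_iso.
Qed.
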